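(* Consider the constrained minimax problem $$\min_{\mathbf x\in\mathbb R^{n_x}}\max_{\mathbf y\in\mathbb R^{n_y}}J(\mathbf x,\mathbf y)\quad\text{s.t.}\quad A\mathbf x+B\mathbf y-\mathbf b=\mathbf 0,\quad\mathbf G(\mathbf x,\mathbf y)\le\mathbf 0,$$ where $[A\ B]\in\mathbb R^{q\times(n_x+n_y)}$ has full row rank $q$ and $\mathbf G:\mathbb R^{n_x+n_y}\to\mathbb R^p$ collects $p$ convex inequality constraints. Suppose $J\in\mathcal C^2$ is convex in $\mathbf x$ (for each fixed $\mathbf y$) and concave in $\mathbf y$ (for each fixed $\mathbf x$), and the feasible set of the problem is compact. Let $\varepsilon>0$, let $\mathbf S$ be the smoothed stationarity vector defined in the context, $V=\tfrac12\|\mathbf S\|^2$, and $\mathcal S=\{\mathbf z:\mathbf S(\mathbf z)=\mathbf 0\}$. Suppose the following two assumptions hold on an open neighborhood $\mathcal U$ of the saddle point: (a) (OLF regularity) $V$ is an optimization Lyapunov function (continuously differentiable, nonnegative, and zero exactly on $\mathcal S$), $\mathcal U$ is an open set with $\mathcal S\subseteq\mathcal U$, and $\nabla V(\mathbf z)\neq\mathbf 0$ for all $\mathbf z\in\mathcal U$ with $V(\mathbf z)\ne0$; (b) (Łojasiewicz inequality) there exist a neighborhood $\mathcal N\subseteq\mathcal U$ of $\mathcal S\cap\mathcal U$ and constants $c_{\mathrm L}>0$, $\alpha\in[0,1)$ with $\|\nabla V(\mathbf z)\|\ge c_{\mathrm L}V(\mathbf z)^\alpha$ for all $\mathbf z\in\mathcal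 N$. Let $\sigma$ be any of the decay laws in the context, and let $\Omega_c=\{\mathbf z\in\mathcal U:V(\mathbf z)\le c\}\subseteq\mathcal U$ be a forward-invariant sublevel set with $0<c\le\rho^\ast$, where $\rho^\ast>0$ is a threshold (which exists under (a) and (b)) such that for every $c'\in(0,\rho^\ast]$ the set $\Omega_{c'}$ is closed in $\mathcal U$ and forward invariant under the dynamics below. Assume LICQ holds at the KKT point, and that there exists $(\bar{\mathbf x},\bar{\mathbf y})$ satisfying Slater's condition, i.e. $A\bar{\mathbf x}+B\bar{\mathbf y}=\mathbf b$ and $\mathbf G(\bar{\mathbf x},\bar{\mathbf y})<\mathbf 0$. Then a saddle point $(\mathbf x^\star,\mathbf y^\star)$ exists, and for every $\mathbf z(0)\in\Omega_c$ the trajectory of $$\dot{\mathbf z}=-\frac{\nabla\mathbf S(\mathbf z)^\top\mathbf S(\mathbf z)}{\|\nabla\mathbf S(\mathbf z)^\top\mathbf S(\mathbf z)\|^2}\,\sigma(V(\mathbf z),t)$$ remains in the compact set $\Omega_c$ and satisfies $\mathbf S(\mathbf z(t))\to\mathbf 0$ with the convergence law $\sigma$; in particular, any cluster point of $\mathbf z(t)$ (which exists by compactness of $\Omega_c$) is a KKT point of the minimax problem satisfying the KKT system up to the smoothing tolerance $\varepsilon$.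
   Context: Write $\mathbf z=(\mathbf x,\mathbf y,\boldsymbol\lambda,\boldsymbol\mu)$ with $\boldsymbol\lambda\in\mathbb R^p$, $\boldsymbol\mu\in\mathbb R^q$ the multipliers of the inequality and equality constraints. A saddle point of the coupled problem is understood in variational-inequality form: with $\mathbf w=(\mathbf x,\mathbf y)$ and $\mathcal F(\mathbf w)=(\nabla_{\mathbf x}J,-\nabla_{\mathbf y}J)$, $\mathbf w^\star$ is feasible and $\langle\mathcal F(\mathbf w^\star),\mathbf w-\mathbf w^\star\rangle\ge0$ for all feasible $\mathbf w$. The neighborhood $\mathcal U$ lives in $\mathbf z$-space (saddle point together with its multipliers). KKT system: $\nabla_{\mathbf x}J+A^\top\boldsymbol\mu+\nabla_{\mathbf x}\mathbf G^\top\boldsymbol\lambda=\mathbf 0$; $-\nabla_{\mathbf y}J+B^\top\boldsymbol\mu+\nabla_{\mathbf y}\mathbf G^\top\boldsymbol\lambda=\mathbf 0$; $\mathbf G\le\mathbf 0$, $\boldsymbol\lambda\ge\mathbf 0$, $\langle\boldsymbol\lambda,\mathbf G\rangle=0$; $A\mathbf x+B\mathbf y-\mathbf b=\mathbf 0$. LICQ at $(\mathbf x,\mathbf y)$: the rows of $[A\ B]$ together with the gradients (in $(\mathbf x,\mathbf y)$) of all $G_i$ with $G_i(\mathbf x,\mathbf y)=0$ are linearly independent. For $\varepsilon>0$: $\phi_\varepsilon(a,b)=\sqrt{a^2+b^2+\varepsilon^2}-(a+b)$ (applied componentwise as $\boldsymbol\phi_\varepsilon$), $\widetilde\lambda_i=\tfrac12(\sqrt{\lambda_i^2+\varepsilon^2}+\lambda_i)$,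 and $$\mathbf S(\mathbf z)=\mathrm{col}\Big(\nabla_{\mathbf x}J+A^\top\boldsymbol\mu+\nabla_{\mathbf x}\mathbf G^\top\widetilde{\boldsymbol\lambda},\ -\nabla_{\mathbf y}J+B^\top\boldsymbol\mu+\nabla_{\mathbf y}\mathbf G^\top\widetilde{\boldsymbol\lambda},\ \boldsymbol\phi_\varepsilon(\boldsymbol\lambda,-\mathbf G(\mathbf x,\mathbf y)),\ A\mathbf x+B\mathbf y-\mathbf b\Big),$$ where col stacks vectors. $\nabla\mathbf S$ is the Jacobian; $\nabla V=\nabla\mathbf S^\top\mathbf S$. A point with $\mathbf S=\mathbf 0$ is said to satisfy the KKT system up to the smoothing tolerance $\varepsilon$. Forward invariant: every trajectory starting in the set stays in it for all later times ($t\ge0$; $t\in[0,T)$ for (PT), where $\sigma$ is defined). The formula for the dynamics is well defined on $\mathcal U\setminus\mathcal S$. Decay laws and their timing (positive constants $a,b,c_0,k,\mu,T$; $V_0=V(\mathbf z(0))$); ''with convergence law $\sigma$'' means $\frac{d}{dt}V(\mathbf z(t))=-\sigma(V,t)$, hence: (Exp) $\sigma=c_0V$, $V(\mathbf z(t))\le V_0e^{-c_0t}$; (FT) $\sigma=kV^\gamma$, $0<\gamma<1$, $V$ reaches zero in finite time at most $V_0^{1-\gamma}/[k(1-\gamma)]$; (FxT) $\sigma=aV^\gamma+bV^\delta$, $0<\gamma<1<\delta$, $V$ reaches zero in time at most $1/[a(1-\gamma)]+1/[b(\delta-1)]$, independent of $\mathbf z(0)$; (PT) $\sigma=\frac{\mu}{T-t}V$,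 $t\in[0,T)$, $V(\mathbf z(t))\to0$ exactly as $t\to T$.
   Formalization: For an arbitrary threshold ρ* the set Ω_c need not be compact; it is shown that some ρ* makes all Ω_c, c ≤ ρ*, compact, and that for every threshold each trajectory stays in a compact subset of Ω_c. G is taken twice differentiable so that ∇S exists. *)

(* Defs.v *)
(* Vectors are row vectors, so that [A x] is [x *m A^T] and
   [A^T mu] is [mu *m A]. *)
From HB Require Import structures.
From mathcomp Require Import all_boot all_order all_algebra.
From mathcomp Require Import all_classical all_reals all_analysis.

Set Implicit Arguments.
Unset Strict Implicit.
Unset Printing Implicit Defensive.

Import Order.TTheory GRing.Theory Num.Theory.
Import numFieldNormedType.Exports.

Local Open Scope classical_set_scope.
Local Open Scope ring_scope.

Section Calculus.
Context {R : realType}.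

Definition dot n (u v : 'rV[R]_n) : R := \sum_i u ord0 i * v ord0 i.

(* The norm [`|v|] of the library on ['rV_n] is the sup norm; the Euclidean
   norm induces the same topology. *)
Definition enorm n (v : 'rV[R]_n) : R := Num.sqrt (dot v v).

Definition grad n (f : 'rV[R]_n -> R) (w : 'rV[R]_n) : 'rV[R]_n :=
  \row_j 'D_(delta_mx ord0 j) f w.

(* [jacobian] of the library acts on row vectors; its transpose is the usual
   Jacobian, whose [i]-th row is the gradient of the [i]-th component. *)
Definition Jac m n (F : 'rV[R]_n -> 'rV[R]_m) (w : 'rV[R]_n) : 'M[R]_(m, n) :=
  (jacobian F w)^T.

Definition C1 n (f : 'rV[R]_n -> R) : Prop :=
  (forall w, differentiable f w) /\ continuous (grad f).

Definition C2 n (f : 'rV[R]_n -> R) : Prop :=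
  [/\ C1 f, forall w, differentiable (grad f) w & continuous (Jac (grad f))].

Definition twice_differentiable m n (F : 'rV[R]_n -> 'rV[R]_m) : Prop :=
  (forall w, differentiable F w) /\ (forall w, differentiable (Jac F) w).

Definition convex_fun n (f : 'rV[R]_n -> R) : Prop :=
  convex_function [set: 'rV[R]_n] f.

Definition concave_fun n (f : 'rV[R]_n -> R) : Prop :=
  convex_fun (fun w => - f w).

Definition closed_in n (U D : set 'rV[R]_n) : Prop :=
  exists2 C, closed C & D = U `&` C.

End Calculus.

Record minimax_problem (R : realType) (nx ny p q : nat) := MinimaxProblem {
  obj : 'rV[R]_(nx + ny) -> R;
  ineq : 'rV[R]_(nx + ny) -> 'rV[R]_p;
  eqA : 'M[R]_(q, nx);
  eqB : 'M[R]_(q, ny);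
  eqb : 'rV[R]_q
}.

Section Problem.
Context {R : realType} {nx ny p q : nat}.
Variable P : minimax_problem R nx ny p q.

Local Notation J := (obj P).
Local Notation G := (ineq P).
Local Notation A := (eqA P).
Local Notation B := (eqB P).
Local Notation b := (eqb P).

Definition eq_residual (w : 'rV[R]_(nx + ny)) : 'rV[R]_q :=
  lsubmx w *m A^T + rsubmx w *m B^T - b.

Definition feasible : set 'rV[R]_(nx + ny) :=
  [set w | eq_residual w = 0 /\ forall i, G w ord0 i <= 0].

Definition slater : Prop :=
  exists w, eq_residual w = 0 /\ forall i, G w ord0 i < 0.

Definition pseudo_gradient (w : 'rV[R]_(nx + ny)) : 'rV[R]_(nx + ny) :=
  row_mx (lsubmx (grad J w)) (- rsubmx (grad J w)).

Definition saddle_point (ws : 'rV[R]_(nx + ny)) : Prop :=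
  feasible ws /\
  forall w, feasible w -> 0 <= dot (pseudo_gradient ws) (w - ws).

Definition LICQ (w : 'rV[R]_(nx + ny)) : Prop :=
  free ([seq row i (row_mx A B) | i <- enum 'I_q] ++
        [seq row i (Jac G w) | i <- enum 'I_p & G w ord0 i == 0]).

Definition stat_x (w : 'rV[R]_(nx + ny)) (lam : 'rV[R]_p) (mu : 'rV[R]_q) :
    'rV[R]_nx :=
  lsubmx (grad J w) + mu *m A + lam *m lsubmx (Jac G w).

Definition stat_y (w : 'rV[R]_(nx + ny)) (lam : 'rV[R]_p) (mu : 'rV[R]_q) :
    'rV[R]_ny :=
  - rsubmx (grad J w) + mu *m B + lam *m rsubmx (Jac G w).

(* [z = (x, y, lam, mu)], stacked as [row_mx (row_mx x y) (row_mx lam mu)]. *)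
Local Notation state := 'rV[R]_((nx + ny) + (p + q)).

Definition primal (z : state) : 'rV[R]_(nx + ny) := lsubmx z.
Definition ineq_mult (z : state) : 'rV[R]_p := lsubmx (rsubmx z).
Definition eq_mult (z : state) : 'rV[R]_q := rsubmx (rsubmx z).

Definition KKT (z : state) : Prop :=
  let w := primal z in let lam := ineq_mult z in let mu := eq_mult z in
  [/\ stat_x w lam mu = 0 /\ stat_y w lam mu = 0,
      forall i, G w ord0 i <= 0,
      forall i, 0 <= lam ord0 i,
      dot lam (G w) = 0
    & eq_residual w = 0].

Variable eps : R.

Definition phi (a c : R) : R :=
  Num.sqrt (a ^+ 2 + c ^+ 2 + eps ^+ 2) - (a + c).

Definition smooth_mult (lam : 'rV[R]_p) : 'rV[R]_p :=
  \row_i (2^-1 * (Num.sqrt (lam ord0 i ^+ 2 + eps ^+ 2) + lam ord0 i)).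

Definition Svec (z : state) : state :=
  let w := primal z in let lam := ineq_mult z in let mu := eq_mult z in
  row_mx
    (row_mx (stat_x w (smooth_mult lam) mu) (stat_y w (smooth_mult lam) mu))
    (row_mx (\row_i phi (lam ord0 i) (- G w ord0 i)) (eq_residual w)).

Definition KKT_up_to_smoothing (z : state) : Prop := Svec z = 0.

Definition Vfun (z : state) : R := 2^-1 * enorm (Svec z) ^+ 2.

Definition Sset : set state := [set z | Svec z = 0].

(* The row vector [(nabla S^T S)^T]. *)
Definition descent (z : state) : state := Svec z *m Jac Svec z.

Definition is_OLF (W : state -> R) (Z : set state) : Prop :=
  [/\ C1 W, forall z, 0 <= W z & forall z, W z = 0 <-> Z z].

Definition OLF_regularity (U : set state) : Prop :=
  [/\ is_OLF Vfun Sset, open U, Sset `<=` U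
    & forall z, U z -> Vfun z != 0 -> grad Vfun z != 0].

Definition Lojasiewicz (U : set state) : Prop :=
  exists (N : set state) (cL alpha : R),
    [/\ N `<=` U, set_nbhs (Sset `&` U) N, 0 < cL, 0 <= alpha < 1
      & forall z, N z -> cL * Vfun z `^ alpha <= enorm (grad Vfun z)].

Inductive decay_law : Type :=
  | Exp of R                 (* c0 *)
  | FT of R & R              (* k, gamma *)
  | FxT of R & R & R & R     (* a, b, gamma, delta *)
  | PT of R & R.             (* mu, T *)

Definition admissible (l : decay_law) : Prop :=
  match l with
  | Exp c0 => 0 < c0
  | FT k gamma => [/\ 0 < k, 0 < gamma & gamma < 1]
  | FxT a' b' gamma delta =>
      [/\ 0 < a', 0 < b', 0 < gamma, gamma < 1 & 1 < delta]
  | PT mu T => 0 < mu /\ 0 < T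
  end.

Definition sigma (l : decay_law) (v t : R) : R :=
  match l with
  | Exp c0 => c0 * v
  | FT k gamma => k * v `^ gamma
  | FxT a' b' gamma delta => a' * v `^ gamma + b' * v `^ delta
  | PT mu T => mu / (T - t) * v
  end.

Definition horizon (l : decay_law) : \bar R :=
  match l with PT _ T => T%:E | _ => +oo%E end.

Definition to_horizon (l : decay_law) : set_system R :=
  match l with PT _ T => at_left T | _ => pinfty_nbhs R end.

Definition times (tau : \bar R) : set R := [set t | 0 <= t /\ (t%:E < tau)%E].

Definition reaches_zero_by (v : R -> R) (t1 : R) : Prop :=
  exists2 ts, 0 <= ts <= t1 & forall t : R, ts <= t -> v t = 0.

Definition decay_timing (l : decay_law) (v : R -> R) : Prop :=
  match l with
  | Exp c0 => forall t : R, 0 <= t -> v t <= v 0 * expR (- (c0 * t))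
  | FT k gamma =>
      reaches_zero_by v (v 0 `^ (1 - gamma) / (k * (1 - gamma)))
  | FxT a' b' gamma delta =>
      reaches_zero_by v ((a' * (1 - gamma))^-1 + (b' * (delta - 1))^-1)
  | PT _ T =>
      v t @[t --> at_left T] --> 0 /\
      (0 < v 0 -> forall t : R, 0 <= t < T -> 0 < v t)
  end.

Definition vfield (l : decay_law) (z : state) (t : R) : state :=
  - (sigma l (Vfun z) t / enorm (descent z) ^+ 2) *: descent z.

(* Solutions on [[0, tau)].  The formula is undefined on [Sset]: a solution that
   reaches [Sset] (which may happen in finite time, where it need not be
   differentiable) rests there.  Outside of [Sset] a solution lives where the
   denominator does not vanish. *)
Definition solution_on (l : decay_law) (tau : \bar R) (z : R -> state) : Prop :=
  [/\ {within times tau, continuous z},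
      forall t, times tau t -> ~ Sset (z t) -> descent (z t) != 0,
      forall t, times tau t -> 0 < t -> ~ Sset (z t) ->
        is_derive t (1 : R) z (vfield l (z t) t)
    & forall s t : R, times tau t -> 0 <= s <= t -> Sset (z s) -> z t = z s].

Definition maximal_solution (l : decay_law) (tau : \bar R) (z : R -> state) :
    Prop :=
  [/\ (0 < tau <= horizon l)%E, solution_on l tau z
    & forall tau' z', (tau < tau' <= horizon l)%E -> solution_on l tau' z' ->
        ~ {in times tau, z' =1 z}].

Definition trajectory (l : decay_law) (z : R -> state) : Prop :=
  solution_on l (horizon l) z.

(* Staying in [D] for all later times includes not ceasing to exist before the
   horizon. *)
Definition forward_invariant (l : decay_law) (D : set state) : Prop :=
  forall tau z, maximal_solution l tau z -> D (z 0) ->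
    tau = horizon l /\ forall t, times tau t -> D (z t).

Definition Omega (U : set state) (c : R) : set state :=
  [set z | U z /\ Vfun z <= c].

Definition threshold (l : decay_law) (U : set state) (rho : R) : Prop :=
  0 < rho /\
  forall c, 0 < c <= rho ->
    closed_in U (Omega U c) /\ forward_invariant l (Omega U c).

End Problem.

(* Main.v *)
(** A saddle point is a solution of the variational inequality of the monotone
    field [(grad_x J, - grad_y J)] on the compact convex feasible set.  By
    Minty's argument it suffices to satisfy finitely many inequalities at a
    time, and a monotone matrix always has a suitable point in the simplex.

    Small sublevel sets of [V] are compact: [S] being small makes the primal
    part nearly feasible, hence bounded, the Slater point bounds the smoothed
    multipliers, hence also [lam] because [phi] is small, and full row rank
    bounds [mu].  Hence small sublevel sets lie in the Lojasiewicz
    neighbourhood.  Along solutions [V' = - sigma(V, t)], so that [V] decreases;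
    by the Lojasiewicz inequality a solution has finite length up to any finite
    time and therefore converges there, and Peano's theorem continues it (or it
    rests, if the limit is in [Sset]).  Hence maximal solutions, which exist by
    Zorn's lemma, reach the horizon, and integrating the scalar equation for [V]
    gives the decay estimates. *)
Require Import Defs.
From HB Require Import structures.
From mathcomp Require Import all_boot all_order all_algebra.
From mathcomp Require Import all_classical all_reals all_analysis.
From mathcomp Require Import ring lra.

Set Implicit Arguments.
Unset Strict Implicit.
Unset Printing Implicit Defensive.

Import Order.TTheory GRing.Theory Num.Theory.
Import numFieldNormedType.Exports.
Local Open Scope classical_set_scope.
Local Open Scope ring_scope.

(** Dividing by the squared gradient norm fixes the rate of decay of [V] exactly, but the speed of
    the solution is [sigma] over the gradient norm and may blow up near [Sset]. So a bound on [V]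
    does not exclude that a solution oscillates without a limit at a premature end time; this is
    where the Lojasiewicz inequality enters. The field is only known to be continuous away from the
    zeros of the gradient: solutions need not be unique, and every statement on trajectories is
    proved for all of them. At the time of arrival in [Sset] a solution need not be differentiable,
    yet [V] along it is, because [sigma] vanishes at [V = 0]. The bounds on the multipliers are
    circular: the bound on [mu] contains the sum of the smoothed multipliers, and the bound on that
    sum contains [mu] times the residual. A small level of [V] makes the residual small and lets the
    loop be absorbed. Compactness of sublevel sets is shown for small levels, whereas the level [c]
    of a given threshold may be larger. There the compact set is made of an initial arc of the
    trajectory and a small sublevel set that contains the rest. *)

Lemma cvg_continuous_comp (T : Type) (U W : topologicalType) (F : set_system T)
    (f : T -> U) (g : U -> W) (a : U) :
  f x @[x --> F] --> a -> continuous g -> g (f x) @[x --> F] --> g a.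
Proof. by move=> fa cg; exact: cvg_comp fa (cg a). Qed.

(** * Row vectors: norms, limits and derivatives by coordinates *)

Section row_vectors.
Context {R : realType}.

Lemma coord_norm_le n (v : 'rV[R]_n) i : `|v ord0 i| <= `|v|.
Proof.
rewrite [leRHS]/Num.Def.normr/= mx_normrE.
exact: (le_bigmax _ (fun ij : 'I_1 * 'I_n => `|v ij.1 ij.2|) (ord0, i)).
Qed.

Lemma rV_norm_le n (v : 'rV[R]_n) (M : R) :
  0 <= M -> (forall i, `|v ord0 i| <= M) -> `|v| <= M.
Proof.
move=> M0 vM; rewrite [leLHS]/Num.Def.normr/= mx_normrE.
by apply: bigmax_le => // -[i j] _ /=; rewrite ord1.
Qed.

Lemma cvg_rV n (T : Type) (F : set_system T) (f : T -> 'rV[R]_n)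
    (l : 'rV[R]_n) :
  Filter F -> (forall i, f x ord0 i @[x --> F] --> l ord0 i) ->
  f x @[x --> F] --> l.
Proof.
move=> FF fl; apply/cvgrPdist_le => e e0.
have : \forall x \near F, forall i, `|l ord0 i - f x ord0 i| <= e.
  apply: filter_forall => i.
  by move/cvgrPdist_le : (fl i); apply.
apply: filterS => x lfx; apply: rV_norm_le; first exact: ltW.
by move=> i; rewrite !mxE.
Qed.

Lemma cvg_rV_coord n (T : Type) (F : set_system T) (f : T -> 'rV[R]_n)
    (l : 'rV[R]_n) i :
  Filter F -> f x @[x --> F] --> l -> f x ord0 i @[x --> F] --> l ord0 i.
Proof.
move=> FF fl.
exact: (cvg_comp _ _ fl (@coord_continuous _ _ _ ord0 i l)).
Qed.

Lemma closed_sublevel (T : topologicalType) (f : T -> R) (c : R) :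
  continuous f -> closed [set x | f x <= c].
Proof.
move=> cf; rewrite (_ : mkset _ = f @^-1` [set r | r <= c])//.
apply: preimage_closed; last exact: closed_le.
by move=> x _; exact: cf.
Qed.

Lemma compact_rV_bounded n (A : set 'rV[R]_n) (r : R) :
  closed A -> (forall x, A x -> `|x| <= r) -> compact A.
Proof.
move=> cA Ar; apply: bounded_closed_compact => //.
exists r; split => [|s rs x /Ar]; first exact: num_real.
by move=> /le_trans; apply; exact: ltW.
Qed.

Lemma compact_rV_ball n (c : 'rV[R]_n) (r : R) :
  compact [set x : 'rV[R]_n | `|x - c| <= r].
Proof.
apply: (@compact_rV_bounded _ _ (r + `|c|)) => [|x /= xr].
  have cB : continuous (fun x : 'rV[R]_n => x - c).
    move=> y; apply: (@cvgB _ _ _ (nbhs y)); [exact: cvg_id|exact: cvg_cst].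
  by apply: closed_sublevel => x; exact: (cvg_norm (cB x)).
by rewrite -(subrK c x) (le_trans (ler_normD _ _))// lerD2r.
Qed.

Lemma is_derive_rV n (z : R -> 'rV[R]_n) (t : R) (v : 'rV[R]_n) :
  is_derive t (1 : R) z v <->
  forall i, is_derive t (1 : R) (fun s => z s ord0 i) (v ord0 i).
Proof.
split=> [[dz zv] i|dz].
  apply: DeriveDef; first by move/derivable_mxP : dz; apply.
  by rewrite -zv derive_mx// mxE.
have dz' : derivable z t (1 : R).
  by apply/derivable_mxP => i j; rewrite ord1; have [] := dz j.
apply: DeriveDef => //; rewrite derive_mx//.
by apply/rowP => j; rewrite mxE; have [] := dz j.
Qed.

Lemma differentiable_rV m n (F : 'rV[R]_n -> 'rV[R]_m) w :
  (forall i, differentiable (fun x => F x ord0 i) w) -> differentiable F w.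
Proof.
move=> dF.
have -> : F = \sum_(i < m) (fun x => F x ord0 i *: (delta_mx ord0 i : 'rV[R]_m)).
  apply/funext => x; rewrite fct_sumE; exact: row_sum_delta.
by apply: differentiable_sum => i; exact: differentiableZl.
Qed.

Lemma differentiable_rV_coord m n (F : 'rV[R]_n -> 'rV[R]_m) w i :
  differentiable F w -> differentiable (fun x => F x ord0 i) w.
Proof.
move=> dF.
exact: (differentiable_comp dF (differentiable_coord (F w) ord0 i)).
Qed.

Lemma Jac_coord m n (F : 'rV[R]_n -> 'rV[R]_m) w :
  differentiable F w -> forall i, row i (Jac F w) = grad (fun x => F x ord0 i) w.
Proof.
move=> dF i; apply/rowP => j; rewrite !mxE.
by rewrite -deriveE// derive_mx ?mxE//; exact: diff_derivable.
Qed.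

Lemma diff_grad n (f : 'rV[R]_n -> R) w v :
  differentiable f w -> 'd f w v = dot (grad f w) v.
Proof.
move=> df; rewrite {1}[v]row_sum_delta linear_sum; apply: eq_bigr => j _.
by rewrite linearZ/= mxE deriveE// mulrC.
Qed.

End row_vectors.

(** * Derivatives of functions of one real variable *)

Section real_derivatives.
Context {R : realType}.

Lemma is_derive_cvg n (f : R -> 'rV[R]_n) (t : R) l :
  h^-1 *: (f (h + t) - f t) @[h --> (0 : R)^'] --> l -> is_derive t (1 : R) f l.
Proof.
move=> fl.
have fl' : h^-1 *: (f (h *: (1 : R) + t) - f t) @[h --> (0 : R)^'] --> l.
  by under eq_fun do rewrite [_ *: 1]mulr1.
by apply: DeriveDef; [apply: cvgP fl' | apply: cvg_lim fl'].
Qed.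

Lemma is_derive_cvg1 (f : R -> R) (t l : R) :
  h^-1 * (f (h + t) - f t) @[h --> (0 : R)^'] --> l -> is_derive t (1 : R) f l.
Proof.
move=> fl.
have fl' : h^-1 *: (f (h *: (1 : R) + t) - f t) @[h --> (0 : R)^'] --> l.
  by under eq_fun do rewrite [_ *: 1]mulr1.
by apply: DeriveDef; [apply: cvgP fl' | apply: cvg_lim fl'].
Qed.

Lemma is_derive_continuous (f : R -> R) (t l : R) :
  is_derive t (1 : R) f l -> {for t, continuous f}.
Proof.
by move=> [df _]; apply: differentiable_continuous; exact/derivable1_diffP.
Qed.

(** By the mean value theorem a difference quotient at [t] is a value of [df] near [t], so it
    inherits the limit [l]. This yields derivatives at exceptional times: the arrival in [Sset] and
    the junction of two solutions. *)
Lemma is_derive_punctured (f df : R -> R) (t l : R) :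
  {for t, continuous f} -> (\forall s \near t^', is_derive s (1 : R) f (df s)) ->
  df s @[s --> t^'] --> l -> is_derive t (1 : R) f l.
Proof.
move=> cf dfs dfl; apply: is_derive_cvg1; apply/cvgrPdist_le => e e0.
move/cvgrPdist_le : dfl => /(_ _ e0) dfl.
have [d /= d0 dH] : exists2 d : R, 0 < d & forall s, `|s - t| < d -> s != t ->
    is_derive s (1 : R) f (df s) /\ `|l - df s| <= e.
  have : nbhs t [set s | s != t -> is_derive s (1 : R) f (df s) /\ `|l - df s| <= e].
    exact: (filterI dfs dfl).
  move=> /nbhs_ballP[d /= d0 H].
  by exists d => // s sd st; apply: H => //; rewrite /ball/= distrC.
(* The disjunction keeps [t] out of the open interval, where the derivative has to exist; at [t] as
   an endpoint continuity is enough. *)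
have MVTs a b : a < b -> `|a - t| < d -> `|b - t| < d -> (t <= a) || (b <= t) ->
    `|l * (b - a) - (f b - f a)| <= e * (b - a).
  move=> ab ad bd tab.
  have inH s : s \in `]a, b[ -> is_derive s (1 : R) f (df s) /\ `|l - df s| <= e.
    rewrite in_itv/= => /andP[as_ sb]; apply: dH.
      by move: ad bd; rewrite !ltr_norml; lra.
    by case/orP: tab => ?; [rewrite gt_eqF//|rewrite lt_eqF//]; lra.
  have [||c cab ->] := @MVT R f df a b ab.
  - by move=> s /inH[].
  - have cs s : a <= s <= b -> {for s, continuous f}.
      have [-> //|st] := eqVneq s t => sab.
      have [|//|+ _] := dH s.
        by move: ad bd sab; rewrite !ltr_norml; lra.
      exact: is_derive_continuous.
    apply: continuous_in_subspaceT => s; rewrite inE/= in_itv/=; exact: cs.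
  have ba : 0 < b - a by rewrite subr_gt0.
  rewrite -mulrBl normrM (gtr0_norm ba) ler_pM2r//.
  by case: (inH _ cab).
near=> h.
have h0 : h != 0 by near: h; exact: nbhs_dnbhs_neq.
have hd : `|h| < d by near: h; exact: dnbhs0_lt.
have hV : `|h^-1| * `|h| = 1 by rewrite -normrM mulVf// normr1.
have -> : l - h^-1 * (f (h + t) - f t) = h^-1 * (l * h - (f (h + t) - f t)).
  by field.
rewrite normrM -[leRHS]mul1r -hV -mulrA ler_wpM2l//.
have [hp|hn] := ltP 0 h.
  have := MVTs t (h + t); rewrite addrK subrr normr0 lexx (gtr0_norm hp) mulrC [e * _]mulrC.
  by apply => //; [lra|rewrite -(gtr0_norm hp)].
have {}hn : h < 0 by rewrite lt_neqAle h0.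
have := MVTs (h + t) t; rewrite addrK subrr normr0 lexx orbT (ltr0_norm hn).
rewrite (_ : t - (h + t) = - h); last by ring.
rewrite [e * _]mulrC => H; rewrite -normrN.
have -> : - (l * h - (f (h + t) - f t)) = l * - h - (f t - f (h + t)) by ring.
by apply: H => //; [lra|rewrite -(ltr0_norm hn)].
Unshelve. all: by end_near. Qed.

Lemma lipschitz_within (V : normedModType R) (A : set R) (y : R -> V)
    (M t : R) :
  (forall s x, A s -> A x -> s <= x -> `|y x - y s| <= M * (x - s)) -> A t ->
  y x @[x --> within A (nbhs t)] --> y t.
Proof.
move=> yM At; apply/cvgrPdist_le => e e0.
have M0 : 0 < `|M| + 1 by rewrite ltr_wpDl.
have d0 : 0 < e / (`|M| + 1) by rewrite divr_gt0.
have : nbhs t [set x | A x -> `|y t - y x| <= e].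
  apply/nbhs_ballP; exists (e / (`|M| + 1)) => //= x; rewrite /ball/= => tx Ax.
  have bnd s u : A s -> A u -> s <= u -> `|s - u| < e / (`|M| + 1) -> `|y u - y s| <= e.
    move=> As Au su; rewrite distrC ger0_norm ?subr_ge0// ltr_pdivlMr// => h.
    apply: le_trans (yM _ _ As Au su) _; apply: le_trans (ltW h).
    by rewrite mulrC ler_wpM2l ?subr_ge0//; have := ler_norm M; lra.
  have [tx'|xt] := leP t x; first by rewrite distrC; exact: bnd.
  by apply: bnd => //; [exact: ltW|rewrite distrC].
exact.
Qed.

Lemma within_continuousP (V : topologicalType) (A : set R) (y : R -> V) :
  (forall t, A t -> y x @[x --> within A (nbhs t)] --> y t) ->
  {within A, continuous y}.
Proof. by move=> cy; apply/subspace_continuousP => t At; exact: cy. Qed.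

End real_derivatives.

(** * Peano's existence theorem *)

Lemma ultra_fmap (T U : Type) (f : T -> U) (F : set_system T) :
  UltraFilter F -> UltraFilter (f @ F).
Proof.
move=> FU; split => [|G GP FG]; first exact: fmap_proper_filter.
rewrite eqEsubset; split => // A GA.
have [//|FnA] := in_ultra_setVsetC (f @^-1` A) FU.
have /FG GnA : (f @ F) (~` A) by [].
by have [x []] := filter_ex (filterI GA GnA).
Qed.

(* Peano's theorem: the solution is the pointwise limit, along an ultrafilter,
   of piecewise constant Euler approximations. *)
Section peano.
Context {R : realType} {n : nat}.
Variables (f : R -> 'rV[R]_n -> 'rV[R]_n) (M : R) (z0 : 'rV[R]_n) (t0 : R).
Hypothesis fM : forall t x, `|f t x| <= M.

Fixpoint euler_step (h : R) (m : nat) : 'rV[R]_n :=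
  if m is m'.+1 then
    euler_step h m' + h *: f (t0 + m'%:R * h) (euler_step h m')
  else z0.

Let step (N : nat) : R := N.+1%:R^-1.

(** The number of complete steps between [t0] and [t]. Truncation sends negative reals to 0, so the
    approximations equal [z0] before [t0]. *)
Let idx (N : nat) (t : R) : nat := Num.truncn ((t - t0) * N.+1%:R).

Definition euler (N : nat) (t : R) : 'rV[R]_n := euler_step (step N) (idx N t).

Let step_gt0 N : 0 < step N. Proof. by rewrite invr_gt0. Qed.

Let M_ge0 : 0 <= M. Proof. exact: le_trans (normr_ge0 _) (fM 0 0). Qed.

Let idxP N t : t0 <= t ->
  (idx N t)%:R * step N <= t - t0 < (idx N t)%:R * step N + step N.
Proof.
move=> t0t.
have /truncn_itv/andP[h1 h2] : 0 <= (t - t0) * N.+1%:R.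
  by rewrite mulr_ge0// subr_ge0.
rewrite -[X in _ < _ + X]mul1r -mulrDl natr1.
by rewrite /step ler_pdivrMr// ltr_pdivlMr// h1.
Qed.

Let idx_le N s t : s <= t -> (idx N s <= idx N t)%N.
Proof. by move=> st; apply: le_truncn; rewrite ler_wpM2r// lerB. Qed.

(** The increment is a sum of [k] slopes times [h], each within [e] of [x]. It is used twice: with
    [x = 0] and [e = M] for a Lipschitz bound, and with [x] the expected derivative for the
    difference quotient. *)
Lemma euler_step_incr (h e : R) (x : 'rV[R]_n) (m k : nat) : 0 <= h ->
  (forall i, (i < k)%N ->
    `|f (t0 + (m + i)%:R * h) (euler_step h (m + i)) - x| <= e) ->
  `|euler_step h (m + k) - euler_step h m - (k%:R * h) *: x| <= k%:R * h * e.
Proof.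
move=> h0; elim: k => [|k IH] H.
  by rewrite addn0 !mul0r scale0r !subrr normr0.
rewrite addnS /= -[k.+1%:R]natr1 !mulrDl scalerDl mul1r.
set a := euler_step h (m + k); set b := euler_step h m.
rewrite (_ : _ - _ - _ = (a - b - (k%:R * h) *: x) +
  h *: (f (t0 + (m + k)%:R * h) a - x)); last first.
  by apply/rowP => i; rewrite !mxE; ring.
rewrite (le_trans (ler_normD _ _))// lerD//.
  by apply: IH => i ik; apply: H; rewrite ltnS ltnW.
by rewrite normrZ (ger0_norm h0) ler_wpM2l// H.
Qed.

Let euler_step_lip (h : R) m k : 0 <= h ->
  `|euler_step h (m + k) - euler_step h m| <= k%:R * h * M.
Proof.
move=> h0; have := @euler_step_incr h M 0 m k h0.
by rewrite scaler0 subr0; apply => i _; rewrite subr0.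
Qed.

Let idx_diff N s t : t0 <= s -> s <= t ->
  `|(idx N t - idx N s)%:R * step N - (t - s)| <= step N.
Proof.
move=> t0s st.
have /andP[h1 h2] := idxP N t0s; have /andP[h3 h4] := idxP N (le_trans t0s st).
rewrite natrB ?idx_le// mulrBl ler_norml; apply/andP; split; lra.
Qed.

Let euler_lip N s t : t0 <= s -> s <= t ->
  `|euler N t - euler N s| <= (t - s + step N) * M.
Proof.
move=> t0s st.
have := euler_step_lip (idx N s) (idx N t - idx N s) (ltW (step_gt0 N)).
rewrite subnKC ?idx_le// => /le_trans; apply.
rewrite ler_wpM2r//.
by have := idx_diff N t0s st; rewrite ler_norml => /andP[_]; lra.
Qed.

Let euler0 N t : t <= t0 -> euler N t = z0.
Proof.
move=> tt0; rewrite /euler /idx (_ : Num.truncn _ = 0%N)//.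
apply/eqP; rewrite -leqn0 -[leqRHS](@truncn0 R).
by apply: le_truncn; rewrite pmulr_lle0// subr_le0.
Qed.

Lemma peano : exists z : R -> 'rV[R]_n,
  [/\ z t0 = z0,
      forall s t : R, t0 <= s -> s <= t -> `|z t - z s| <= M * (t - s) &
      forall t : R, t0 < t ->
        {for (t, z t), continuous (fun p : R * 'rV[R]_n => f p.1 p.2)} ->
        is_derive t (1 : R) z (f t (z t))].
Proof.
have [U [UU ooU]] := @ultraFilterLemma nat \oo _.
have cvU t : cvg (euler N t @[N --> U]).
  pose B := [set x : 'rV[R]_n | `|x - z0| <= (`|t - t0| + 1) * M].
  have cB : compact B by exact: compact_rV_ball.
  have UB : \forall N \near U, B (euler N t).
    apply: (@filterE _ U) => N /=.
    have [tt0|/ltW t0t] := leP t t0.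
      rewrite /B/= euler0// subrr normr0 mulr_ge0// addr_ge0//.
    rewrite /B/= -(euler0 N (lexx t0)) (le_trans (euler_lip N (lexx _) t0t))//.
    rewrite ler_wpM2r// lerD ?ler_norm//.
    by rewrite invf_le1// ler1n.
  move: cB; rewrite compact_ultra => /(_ _ (ultra_fmap _ UU) UB)[x [_ xU]].
  by apply/cvg_ex; exists x.
pose z t : 'rV[R]_n := lim (euler N t @[N --> U]).
(* The convergence is only pointwise, but each estimate below compares [z] at two times, so one [N]
   that is good at both of them suffices. *)
have approx (s t e : R) : 0 < e -> exists N : nat,
    [/\ step N <= e, `|z s - euler N s| <= e & `|z t - euler N t| <= e].
  move=> e0.
  have h1 : \forall N \near U, step N <= e.
    apply: ooU; near=> N; rewrite /step -[leRHS]invrK lef_pV2 ?posrE ?invr_gt0//.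
    apply: (@le_trans _ _ N%:R); last by rewrite ler_nat.
    by apply: ltW; near: N; exact: nbhs_infty_gtr.
  have h2 : \forall N \near U, `|z s - euler N s| <= e.
    by have /cvgrPdist_le := cvU s; apply.
  have h3 : \forall N \near U, `|z t - euler N t| <= e.
    by have /cvgrPdist_le := cvU t; apply.
  have [N [hN [? ?]]] := filter_ex (filterI h1 (filterI h2 h3)).
  by exists N.
have zlip s t : t0 <= s -> s <= t -> `|z t - z s| <= M * (t - s).
  move=> t0s st; apply/ler_addgt0Pr => e e0.
  have e'0 : 0 < e / (M + 2) by rewrite divr_gt0// ltr_wpDl.
  have [N [hN sN tN]] := approx s t _ e'0.
  rewrite (_ : z t - z s =
    (z t - euler N t) + (euler N t - euler N s) - (z s - euler N s)); last first.
    by apply/rowP => i; rewrite !mxE; ring.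
  rewrite (le_trans (ler_normB _ _))//.
  have := ler_normD (z t - euler N t) (euler N t - euler N s).
  have := euler_lip N t0s st.
  have : step N * M <= e / (M + 2) * M by rewrite ler_wpM2r.
  have : e / (M + 2) * M + e / (M + 2) * 2 = e.
    by rewrite -mulrDr divfK// gt_eqF// ltr_wpDl.
  set q := e / (M + 2) in sN tN hN * => Hq Hm Hl Hd.
  rewrite mulrDl in Hl.
  by rewrite [M * _]mulrC; lra.
exists z; split => //.
  rewrite /z (_ : (fun N => _) = fun=> z0); first exact: lim_cst.
  by apply/funext => N; exact: euler0.
move=> t t0t cf; set x := f t (z t).
apply: is_derive_cvg; apply/cvgrPdist_le => e e0.
have [d /= d0 dH] : exists2 d : R, 0 < d & forall s w,
    `|s - t| < d -> `|w - z t| < d -> `|f s w - x| <= e.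
  move/cvgrPdist_le : cf => /(_ _ e0)/nbhs_ballP[d /= d0 H].
  exists d => // s w sd wd; rewrite distrC.
  apply: (H (s, w)); split => /=; first by rewrite /ball/= distrC.
  by rewrite -ball_normE/= distrC.
(* The first bound keeps the window after [t0]; by the second, moving for a duration [r] at speed
   [M] covers at most [d / 4]. *)
pose r := Order.min (t - t0) (d / (4 * (M + 1))).
have r0 : 0 < r by rewrite lt_min subr_gt0 t0t divr_gt0// mulr_gt0// ltr_wpDl.
have incr a b : t0 <= a -> a <= b -> (a = t \/ b = t) -> b - a < r ->
    `|z b - z a - (b - a) *: x| <= e * (b - a).
  move=> t0a ab atb bar; apply/ler_addgt0Pr => c c0.
  (* The approximation error and the step size are at most [q]. The first bound leaves them another
     [d / 4]. The second makes the total error at most [c]: [q] at each endpoint, and [q] times [e]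
     and the norm of [x] because the steps fill [b - a] only up to one step. *)
  pose q := Order.min (d / (4 * (M + 1))) (c / (2 + e + `|x|)).
  have K0 : 0 < 2 + e + `|x| by rewrite ltr_wpDr// addr_gt0.
  have q0 : 0 < q by rewrite lt_min !divr_gt0// mulr_gt0// ltr_wpDl.
  have M4 : d / (4 * (M + 1)) * (M + 1) = d / 4.
    have M1 : M + 1 != 0 by rewrite gt_eqF// ltr_wpDl.
    by field.
  have rd : r * (M + 1) <= d / 4.
    by rewrite -M4 ler_wpM2r// ?addr_ge0// ge_min lexx orbT.
  have qd : q * (M + 1) <= d / 4.
    by rewrite -M4 ler_wpM2r// ?addr_ge0// ge_min lexx.
  have qc : q * (2 + e + `|x|) <= c.
    by rewrite -ler_pdivlMr// ge_min lexx orbT.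
  have [N [hN aN bN]] := approx a b _ q0.
  have ba0 : 0 <= b - a by rewrite subr_ge0.
  have bM : (b - a) * M <= r * M by rewrite ler_wpM2r// ltW.
  have hM : step N * M <= q * M by rewrite ler_wpM2r.
  have rM0 : 0 <= r * M by rewrite mulr_ge0// ltW.
  have qM0 : 0 <= q * M by rewrite mulr_ge0// ltW.
  have /andP[ia1 ia2] := idxP N t0a.
  have /andP[ib1 ib2] := idxP N (le_trans t0a ab).
  have hN0 := step_gt0 N.
  have := @euler_step_incr (step N) e x (idx N a) (idx N b - idx N a) (ltW (step_gt0 N)).
  rewrite subnKC ?idx_le// -/(euler N b) -/(euler N a) => /(_ _)/wrap[i ib|incrN].
    have iab : (idx N a + i < idx N b)%N by rewrite -ltn_subRL.
    have ti1 : (idx N a)%:R * step N <= (idx N a + i)%:R * step N.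
      by rewrite ler_wpM2r ?(ltW hN0)// ler_nat leq_addr.
    have ti2 : (idx N a + i)%:R * step N <= (idx N b)%:R * step N.
      by rewrite ler_wpM2r ?(ltW hN0)// ler_nat ltnW.
    rewrite mulrDr mulr1 in rd; rewrite mulrDr mulr1 in qd.
    apply: dH.
      by rewrite ltr_norml; case: atb => <-; lra.
    (* The Euler point is compared with [z t] forwards from [a] if [t = a] and backwards from [b] if
       [t = b]; either way they are at most [d / 2] apart. *)
    case: atb => Et; subst t.
      have := euler_step_lip (idx N a) i (ltW hN0); rewrite -/(euler N a) => Hl.
      have il : i%:R * step N * M <= (b - a + step N) * M.
        rewrite ler_wpM2r//.
        by move: ti2; rewrite natrD mulrDl; lra.
      rewrite (_ : _ - z a = (euler_step (step N) (idx N a + i) - euler N a) - (z a - euler N a)).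
        rewrite (le_lt_trans (ler_normB _ _))//.
        by rewrite mulrDl in il; lra.
      by apply/rowP => ?; rewrite !mxE; ring.
    have Eb : idx N b = (idx N a + i + (idx N b - (idx N a + i)))%N
      by rewrite subnKC// ltnW.
    have := euler_step_lip (idx N a + i) (idx N b - (idx N a + i)) (ltW hN0).
    rewrite -Eb -/(euler N b) => Hl.
    have il : (idx N b - (idx N a + i))%:R * step N * M <= (b - a + step N) * M.
      rewrite ler_wpM2r// natrB ?(ltnW iab)// mulrBl; lra.
    rewrite (_ : _ - z b = - ((euler N b - euler_step (step N) (idx N a + i)) + (z b - euler N b))).
      rewrite normrN (le_lt_trans (ler_normD _ _))//.
      by rewrite mulrDl in il; lra.
    by apply/rowP => ?; rewrite !mxE; ring.
  set k := (idx N b - idx N a)%N in incrN.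
  have kN : `|k%:R * step N - (b - a)| <= step N := idx_diff N t0a ab.
  rewrite (_ : z b - z a - (b - a) *: x = (z b - euler N b) - (z a - euler N a) +
     (euler N b - euler N a - (k%:R * step N) *: x) + (k%:R * step N - (b - a)) *: x);
       last first.
    by apply/rowP => ?; rewrite !mxE; ring.
  rewrite (le_trans (ler_normD _ _))// normrZ.
  have n1 := ler_normD ((z b - euler N b) - (z a - euler N a))
    (euler N b - euler N a - (k%:R * step N) *: x).
  have n2 := ler_normB (z b - euler N b) (z a - euler N a).
  have n3 : `|k%:R * step N - (b - a)| * `|x| <= q * `|x|.
    by rewrite ler_wpM2r// (le_trans kN).
  have n4 : k%:R * step N * e <= (b - a + q) * e.
    rewrite ler_wpM2r ?(ltW e0)//.
    by move: kN; rewrite ler_norml => /andP[_]; lra.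
  by rewrite !mulrDr in qc; rewrite !mulrDl in n4; rewrite [e * (b - a)]mulrC; lra.
near=> h.
have h0 : h != 0 by near: h; exact: nbhs_dnbhs_neq.
have hr : `|h| < r by near: h; exact: dnbhs0_lt.
have hrt : r <= t - t0 by rewrite ge_min lexx.
have -> : x - h^-1 *: (z (h + t) - z t) = - h^-1 *: (z (h + t) - z t - h *: x).
  by apply/rowP => i; rewrite !mxE; field.
have hV : `|h^-1| * `|h| = 1 by rewrite -normrM mulVf// normr1.
rewrite normrZ normrN -[leRHS]mul1r -hV -mulrA ler_wpM2l//.
have [hp|hn] := ltP 0 h.
  have := incr t (h + t); rewrite addrK (gtr0_norm hp) [h * e]mulrC.
  apply => //; [exact: ltW|lra|by left|by rewrite -(gtr0_norm hp)].
have := incr (h + t) t; rewrite (_ : t - (h + t) = - h); last by ring.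
rewrite -(ler0_norm hn) mulrC -normrN.
rewrite (_ : - (z t - z (h + t) - `|h| *: x) = z (h + t) - z t - h *: x).
  apply => //; [|lra|by right].
  by move: hr; rewrite (ler0_norm hn); lra.
by rewrite (ler0_norm hn); apply/rowP => ?; rewrite !mxE; ring.
Unshelve. all: by end_near. Qed.

End peano.

(** * The Euclidean inner product and its continuity *)

Section dot_product.
Context {R : realType}.

Lemma dotC n (u v : 'rV[R]_n) : dot u v = dot v u.
Proof. by apply: eq_bigr => i _; rewrite mulrC. Qed.

Lemma dotDl n (u v w : 'rV[R]_n) : dot (u + v) w = dot u w + dot v w.
Proof. by rewrite /dot -big_split/=; apply: eq_bigr => i _; rewrite mxE mulrDl. Qed.

Lemma dotDr n (u v w : 'rV[R]_n) : dot u (v + w) = dot u v + dot u w.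
Proof. by rewrite dotC dotDl ![dot _ u]dotC. Qed.

Lemma dotZl n (a : R) (u v : 'rV[R]_n) : dot (a *: u) v = a * dot u v.
Proof. by rewrite /dot mulr_sumr; apply: eq_bigr => i _; rewrite mxE mulrA. Qed.

Lemma dotZr n (a : R) (u v : 'rV[R]_n) : dot u (a *: v) = a * dot u v.
Proof. by rewrite dotC dotZl dotC. Qed.

Lemma dotNl n (u v : 'rV[R]_n) : dot (- u) v = - dot u v.
Proof. by rewrite -scaleN1r dotZl mulN1r. Qed.

Lemma dotNr n (u v : 'rV[R]_n) : dot u (- v) = - dot u v.
Proof. by rewrite dotC dotNl dotC. Qed.

Lemma dotBr n (u v w : 'rV[R]_n) : dot u (v - w) = dot u v - dot u w.
Proof. by rewrite dotDr dotNr. Qed.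

Lemma dotBl n (u v w : 'rV[R]_n) : dot (u - v) w = dot u w - dot v w.
Proof. by rewrite dotDl dotNl. Qed.

Lemma dot0r n (u : 'rV[R]_n) : dot u 0 = 0.
Proof. by rewrite /dot big1// => i _; rewrite mxE mulr0. Qed.

Lemma dot_sumr n m (u : 'rV[R]_n) (v : 'I_m -> 'rV[R]_n) :
  dot u (\sum_j v j) = \sum_j dot u (v j).
Proof.
elim/big_ind2 : _ => // [|x y a b <- <-]; first exact: dot0r.
exact: dotDr.
Qed.

Lemma dot_row_mx n1 n2 (a c : 'rV[R]_n1) (b d : 'rV[R]_n2) :
  dot (row_mx a b) (row_mx c d) = dot a c + dot b d.
Proof.
rewrite /dot big_split_ord/=; congr (_ + _); apply: eq_bigr => i _.
  by rewrite !row_mxEl.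
by rewrite !row_mxEr.
Qed.

Lemma dot_mulmx m n (u : 'rV[R]_m) (B : 'M[R]_(m, n)) (v : 'rV[R]_n) :
  dot (u *m B) v = dot u (v *m B^T).
Proof.
rewrite /dot; under eq_bigr do rewrite mxE mulr_suml.
rewrite exchange_big/=; apply: eq_bigr => i _; rewrite mxE mulr_sumr.
by apply: eq_bigr => j _; rewrite mxE [v _ _ * _]mulrC mulrA.
Qed.

Lemma dotvv_ge0 n (u : 'rV[R]_n) : 0 <= dot u u.
Proof. by apply: sumr_ge0 => i _; rewrite -expr2 sqr_ge0. Qed.

Lemma dotvv_eq0 n (u : 'rV[R]_n) : (dot u u == 0) = (u == 0).
Proof.
apply/eqP/eqP => [|->]; last exact: dot0r.
move=> /psumr_eq0P H; apply/rowP => i; rewrite mxE; apply/eqP.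
by rewrite -sqrf_eq0 expr2 H// => j _; rewrite -expr2 sqr_ge0.
Qed.

Lemma enorm_sqr n (u : 'rV[R]_n) : enorm u ^+ 2 = dot u u.
Proof. by rewrite sqr_sqrtr// dotvv_ge0. Qed.

Lemma coord_enorm_le n (u : 'rV[R]_n) i : `|u ord0 i| <= enorm u.
Proof.
rewrite -sqrtr_sqr ler_wsqrtr// /dot (bigD1 i)//= -expr2 lerDl.
by apply: sumr_ge0 => j _; rewrite -expr2 sqr_ge0.
Qed.

Lemma norm_dot_le n (u v : 'rV[R]_n) : `|dot u v| <= n%:R * (`|u| * `|v|).
Proof.
rewrite (le_trans (ler_norm_sum _ _ _))//.
rewrite -[X in X%:R * _](card_ord n) mulr_natl -sumr_const ler_sum// => i _.
by rewrite normrM ler_pM// coord_norm_le.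
Qed.

Lemma cvg_sum_ord n (T : Type) (F : set_system T) (f : 'I_n -> T -> R)
    (l : 'I_n -> R) : Filter F ->
  (forall i, f i x @[x --> F] --> l i) ->
  \sum_i f i x @[x --> F] --> \sum_i l i.
Proof. by move=> FF fl; apply: cvg_big => //; exact: add_continuous. Qed.

Lemma cvg_dot n (T : Type) (F : set_system T) (f g : T -> 'rV[R]_n)
    (a b : 'rV[R]_n) : Filter F ->
  f x @[x --> F] --> a -> g x @[x --> F] --> b ->
  dot (f x) (g x) @[x --> F] --> dot a b.
Proof.
move=> FF fa gb; apply: cvg_sum_ord => i.
by apply: cvgM; exact: cvg_rV_coord.
Qed.

Lemma cvg_mulmx_rV m n (T : Type) (F : set_system T) (f : T -> 'rV[R]_m)
    (B : 'M[R]_(m, n)) (a : 'rV[R]_m) : Filter F ->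
  f x @[x --> F] --> a -> f x *m B @[x --> F] --> a *m B.
Proof.
move=> FF fa; apply: cvg_rV => j; rewrite mxE.
under eq_fun do rewrite mxE.
apply: cvg_sum_ord => i; apply: cvgM; last exact: cvg_cst.
exact: cvg_rV_coord.
Qed.

Lemma continuous_sum_ord n (T : topologicalType) (f : 'I_n -> T -> R) :
  (forall i, continuous (f i)) -> continuous (fun x => \sum_i f i x).
Proof. by move=> cf x; apply: (@cvg_sum_ord _ _ (nbhs x)) => i; exact: cf. Qed.

Lemma continuous_dot n (T : topologicalType) (f g : T -> 'rV[R]_n) :
  continuous f -> continuous g -> continuous (fun x => dot (f x) (g x)).
Proof. by move=> cf cg x; apply: (@cvg_dot _ _ (nbhs x)); [exact: cf|exact: cg]. Qed.

Lemma continuous_normr (T : topologicalType) (V : normedModType R) (f : T -> V) :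
  continuous f -> continuous (fun x => `|f x|).
Proof. by move=> cf x; apply: (@cvg_norm _ _ _ (nbhs x)); exact: cf. Qed.

Lemma continuous_line n (v w : 'rV[R]_n) :
  continuous (fun th : R => th *: v + w).
Proof.
move=> th; apply: (@cvgD _ _ _ (nbhs th)); last exact: cvg_cst.
by apply: cvgZr_tmp; exact: cvg_id.
Qed.

End dot_product.

(** * Monotone matrices on the simplex *)

Section monotone_matrix.
Context {R : realType}.

(** The negative part, i.e. the maximum of [- a] and [0]. *)
Let negp (a : R) : R := (`|a| - a) / 2.

Let negp_ge0 a : 0 <= negp a.
Proof. by rewrite /negp divr_ge0// subr_ge0 ler_norm. Qed.

Let negpM a : negp a * a = - negp a ^+ 2.
Proof.
by rewrite /negp; have [a0|a0] := ger0P a; [rewrite subrr !mul0r expr0n/= oppr0|field].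
Qed.

(** Holds because [- (a + h) <= negp a - h]. The right-hand side is quadratic in [h], so the
    objective [Phi] below is compared with a quadratic instead of being differentiated. *)
Let negpD a h : negp (a + h) ^+ 2 <= (negp a - h) ^+ 2.
Proof.
have [ah|ah] := leP 0 (a + h).
  by rewrite /negp ger0_norm// subrr mul0r expr0n sqr_ge0.
rewrite ler_sqr ?nnegrE//.
  by rewrite /negp (ltr0_norm ah); have := ler_norm (- a); rewrite normrN; lra.
by have := ler_norm (- a); rewrite normrN /negp; lra.
Qed.

(* The minimiser of |(M t)^-|^2 over the simplex annihilates it: otherwise
   moving towards the normalised negative part decreases it. *)
Lemma monotone_matrix_simplex m (M : 'M[R]_m.+1) :
  (forall i j, 0 <= M i j + M j i) ->
  exists t : 'rV[R]_m.+1, [/\ forall j, 0 <= t ord0 j, \sum_j t ord0 j = 1 &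
    forall i, 0 <= \sum_j t ord0 j * M i j].
Proof.
move=> Mmon.
pose D := [set t : 'rV[R]_m.+1 | (forall j, 0 <= t ord0 j) /\ \sum_j t ord0 j = 1].
have cD : compact D.
  apply: (@compact_rV_bounded _ _ _ 1).
    have -> : D = [set t | forall j, - t ord0 j <= 0] `&`
       ([set t | \sum_j t ord0 j <= 1] `&` [set t | - \sum_j t ord0 j <= -1]).
      apply/seteqP; split => t /=.
        by move=> [t0 ->]; split => // j; rewrite oppr_le0.
      move=> [t0 [t1 t2]]; split => [j|]; first by rewrite -oppr_le0.
      by apply/eqP; rewrite eq_le t1/= -lerN2.
    have csum : continuous (fun t : 'rV[R]_m.+1 => \sum_j t ord0 j).
      by apply: continuous_sum_ord => j; exact: coord_continuous.
    have c1 := closed_sublevel (c := 1) csum.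
    have c2 : closed [set t : 'rV[R]_m.+1 | - \sum_j t ord0 j <= -1].
      by apply: closed_sublevel => t; apply: (@cvgN _ _ _ (nbhs t)); exact: csum.
    have c0 : closed [set t : 'rV[R]_m.+1 | forall j, - t ord0 j <= 0].
      have -> : [set t : 'rV[R]_m.+1 | forall j, - t ord0 j <= 0] =
          \bigcap_(j in [set: 'I_m.+1]) [set t | - t ord0 j <= 0].
        by apply/seteqP; split => [t tj j _|t tj j]; [exact: tj|exact: (tj j)].
      apply: closed_bigI => j _; apply: closed_sublevel => t.
      by apply: (@cvgN _ _ _ (nbhs t)); exact: coord_continuous.
    exact: closedI c0 (closedI c1 c2).
  move=> t [t0 t1]; apply: rV_norm_le => // j; rewrite ger0_norm//.
  by rewrite -t1 (bigD1 j)//= lerDl sumr_ge0.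
have D0 : D !=set0.
  exists (delta_mx ord0 ord0); split=> [j|]; first by rewrite mxE ler0n.
  rewrite (bigD1 ord0)//= big1 ?addr0 ?mxE ?eqxx// => j j0.
  by rewrite mxE (negbTE j0).
pose Mt (t : 'rV[R]_m.+1) i := \sum_j t ord0 j * M i j.
pose Phi t := \sum_i negp (Mt t i) ^+ 2.
have cPhi : continuous Phi.
  apply: continuous_sum_ord => i.
  have cMt : continuous (Mt^~ i).
    apply: continuous_sum_ord => j t.
    by apply: (@cvgM _ _ (nbhs t)); [exact: coord_continuous|exact: cvg_cst].
  have cn : continuous (fun t => negp (Mt t i)).
    move=> t; apply: (@cvgM _ _ (nbhs t)); last exact: cvg_cst.
    apply: (@cvgB _ _ _ (nbhs t)); last exact: cMt.
    exact: (cvg_norm (cMt t)).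
  move=> t; exact: (cvgM (cn t) (cn t)).
have [t] := EVT_min_rV D0 cD (continuous_subspaceT cPhi).
rewrite inE => -[t0 t1] tmin.
exists t; split => // i0.
pose r i := negp (Mt t i).
have r_ge0 i : 0 <= r i by exact: negp_ge0.
pose rho := \sum_i r i.
have [rho0|rho_neq0] := eqVneq rho 0.
  have ri : r i0 = 0 by apply: (psumr_eq0P _ rho0).
  rewrite -[X in 0 <= X]/(Mt t i0).
  by move: ri; rewrite /r /negp; have := normr_ge0 (Mt t i0); lra.
have rho_gt0 : 0 < rho by rewrite lt_neqAle eq_sym rho_neq0 sumr_ge0.
pose s : 'rV[R]_m.+1 := \row_i (r i / rho).
pose d i := Mt s i - Mt t i.
have MtD th i : Mt (t + th *: (s - t)) i = Mt t i + th * d i.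
  rewrite /Mt /d mulrBr !mulr_sumr -sumrB -big_split/=.
  by apply: eq_bigr => j _; rewrite !mxE; ring.
have s1 : \sum_j s ord0 j = 1.
  by under eq_bigr do rewrite mxE; rewrite -mulr_suml divff.
(* Minimality of [t] against the point at parameter [th] of the segment to [s]: bound [Phi] there by
   [negpD], cancel the squares of [r] and divide by [th]. *)
have key th : 0 < th -> th <= 1 -> 2 * \sum_i r i * d i <= th * \sum_i d i ^+ 2.
  move=> th0 th1.
  have /tmin : t + th *: (s - t) \in D.
    rewrite inE; split => [j|].
      have s0 : 0 <= s ord0 j by rewrite mxE divr_ge0// ltW.
      by rewrite !mxE; have := t0 j; rewrite mxE in s0; nra.
    under eq_bigr do rewrite !mxE.
    rewrite big_split/= t1 -mulr_sumr sumrB t1.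
    by rewrite -mulr_suml divff// subrr mulr0 addr0.
  have : Phi (t + th *: (s - t)) <= \sum_i (r i - th * d i) ^+ 2.
    by apply: ler_sum => i _; rewrite MtD negpD.
  move=> /[swap] /le_trans/[apply].
  rewrite /Phi -/(r _) -subr_ge0 -sumrB.
  have -> : \sum_i ((r i - th * d i) ^+ 2 - negp (Mt t i) ^+ 2) =
      th * (th * \sum_i d i ^+ 2 - 2 * \sum_i r i * d i).
    rewrite mulrBr !mulr_sumr -sumrB; apply: eq_bigr => i _; rewrite -/(r i); ring.
  by rewrite pmulr_rge0// subr_ge0.
have rd_le0 : \sum_i r i * d i <= 0.
  have Q0 : 0 <= \sum_i d i ^+ 2 by apply: sumr_ge0 => i _; exact: sqr_ge0.
  rewrite leNgt; apply/negP => rd0.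
  set X := \sum_i r i * d i in rd0 key; set Q := \sum_i d i ^+ 2 in Q0 key.
  (* For [X > 0] this parameter is at most 1 and satisfies [th * Q <= X < 2 * X], against [key]. *)
  have th0 : 0 < X / (X + Q) by rewrite divr_gt0// ltr_wpDr.
  have := key _ th0; rewrite ler_pdivrMr ?ltr_wpDr// mul1r lerDl Q0 => /(_ isT).
  have : X / (X + Q) * Q <= X.
    by rewrite mulrAC ler_pdivrMr ?ltr_wpDr//; nra.
  lra.
(* Up to the factor [rho] this is the quadratic form of [M] at [r]. It depends only on the
   symmetrised matrix, whose entries are nonnegative, as are those of [r]. *)
have rs : 0 <= \sum_i r i * Mt s i.
  have -> : \sum_i r i * Mt s i = (2 * rho)^-1 * \sum_i \sum_j r i * r j * (M i j + M j i).
    have E : \sum_i \sum_j r i * r j * (M i j + M j i) = 2 * \sum_i \sum_j r i * r j * M i j.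
      rewrite mulrDl !mul1r [X in _ = _ + X]exchange_big/= -big_split/=;
        apply: eq_bigr => i _.
      by rewrite -big_split/=; apply: eq_bigr => j _; ring.
    rewrite E; set Y := \sum_i \sum_j _.
    have -> : (2 * rho)^-1 * (2 * Y) = rho^-1 * Y by field.
    rewrite /Y.
    rewrite mulr_sumr; apply: eq_bigr => i _; rewrite /Mt !mulr_sumr.
    by apply: eq_bigr => j _; rewrite mxE; ring.
  rewrite mulr_ge0 ?invr_ge0 ?mulr_ge0 ?(ltW rho_gt0)//.
  by apply: sumr_ge0 => i _; apply: sumr_ge0 => j _; rewrite mulr_ge0// mulr_ge0.
have rt : \sum_i r i * Mt t i = - \sum_i r i ^+ 2.
  by rewrite -sumrN; apply: eq_bigr => i _; rewrite negpM.
(* By [rs] and [rt] the nonpositive sum in [rd_le0] is a nonnegative number plus the sum of the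
   squares of [r]. *)
have : \sum_i r i ^+ 2 <= 0.
  move: rd_le0; rewrite (eq_bigr (fun i => r i * Mt s i - r i * Mt t i)); last first.
    by move=> i _; rewrite mulrBr.
  by rewrite sumrB rt; lra.
rewrite le_eqVlt ltNge sumr_ge0 ?orbF => [/eqP r20|i _]; last exact: sqr_ge0.
have ri0 i : r i = 0.
  apply/eqP; rewrite -sqrf_eq0; apply/eqP; apply: (psumr_eq0P _ r20) => // j _.
  exact: sqr_ge0.
by move: rho_neq0; rewrite /rho big1 ?eqxx// => i _; exact: ri0.
Qed.

End monotone_matrix.

(** * Monotone variational inequalities on compact convex sets *)

Section variational_inequality.
Context {R : realType} {n : nat}.
Implicit Types (K : set 'rV[R]_n) (F : 'rV[R]_n -> 'rV[R]_n).

Definition convex_subset K : Prop := forall u v (th : R),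
  K u -> K v -> 0 <= th <= 1 -> K (th *: u + (1 - th) *: v).

(** Normalising in the conclusion, instead of assuming weights of sum 1, lets the induction drop the
    last weight. If the remaining weights are all 0, only the last point is left. *)
Lemma convex_subset_sum K m (t : 'I_m.+1 -> R) (u : 'I_m.+1 -> 'rV[R]_n) :
  convex_subset K -> (forall j, 0 <= t j) -> (forall j, K (u j)) ->
  0 < \sum_j t j -> K ((\sum_j t j)^-1 *: \sum_j (t j *: u j)).
Proof.
move=> cK; elim: m t u => [|m IH] t u t0 Ku.
  by rewrite !big_ord1 => tp; rewrite scalerA mulVf ?gt_eqF// scale1r.
rewrite [\sum_j t j]big_ord_recr/= [\sum_j t j *: u j]big_ord_recr/=.
set T := \sum_(j < m.+1) t _; set S := \sum_(j < m.+1) t _ *: _ => Tt.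
have T0 : 0 <= T by apply: sumr_ge0.
have [Te0|Tn0] := eqVneq T 0.
  have -> : S = 0.
    rewrite /S big1// => i _; rewrite (psumr_eq0P _ Te0) ?scale0r//.
  by move: Tt; rewrite Te0 !add0r => tp; rewrite scalerA mulVf ?gt_eqF// scale1r.
have T_gt0 : 0 < T by rewrite lt_neqAle eq_sym Tn0.
have := IH (fun j => t (widen_ord (leqnSn m.+1) j)) (fun j => u (widen_ord (leqnSn m.+1) j)).
move=> /(_ _ _ T_gt0) KS.
set tm := t ord_max in Tt *.
have -> : (T + tm)^-1 *: (S + tm *: u ord_max) =
    (T / (T + tm)) *: (T^-1 *: S) + (1 - T / (T + tm)) *: u ord_max.
  apply/rowP => i; rewrite !mxE.
  have Ttn : T + tm != 0 by rewrite gt_eqF.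
  by field; rewrite Tn0 Ttn.
apply: cK => //; first by apply: KS => j; [exact: t0|exact: Ku].
rewrite divr_ge0// ?(ltW Tt)//= ler_pdivrMr// mul1r lerDl; exact: t0.
Qed.

Theorem monotone_variational_inequality K F :
  compact K -> convex_subset K -> K !=set0 -> continuous F ->
  (forall u v, K u -> K v -> 0 <= dot (F u - F v) (u - v)) ->
  exists2 w, K w & forall u, K u -> 0 <= dot (F w) (u - w).
Proof.
move=> cK vK K0 cF monF.
have [w [Kw wminty]] : exists w, K w /\ forall u, K u -> 0 <= dot (F u) (u - w).
  pose g u := [set w : 'rV[R]_n | dot (F u) (w - u) <= 0].
  have := cK; rewrite compact_In0 => /(_ _ K (fun u => K `&` g u)).
  have clg : closed_fam_of K K (fun u => K `&` g u).
    exists g => // u _; apply: closed_sublevel; apply: continuous_dot => w.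
      exact: cst_continuous.
    by apply: (@cvgB _ _ _ (nbhs w)); [exact: cvg_id|exact: cvg_cst].
  move=> /(_ clg)[D' D'K|w wH].
    pose s := finmap.enum_fset D'.
    have [s0|[x0 x0s]] : s = [::] \/ exists x, x \in s.
      by case: s => [|x l]; [left|right; exists x; rewrite mem_head].
      have [k Kk] := K0; exists k => i iD.
      have : i \in s by [].
      by rewrite s0.
    have [m sm] : exists m, size s = m.+1.
      by case: (s) x0s => // a l _; exists (size l).
    pose u (i : 'I_m.+1) := nth x0 s i.
    have Ku i : K (u i).
      have : u i \in K by apply: D'K; apply: mem_nth; rewrite sm.
      by rewrite inE.
    (* The entries at [(i, j)] and [(j, i)] add up to the monotonicity expression of [F] for [u i]
       and [u j]. Row [i] of the conclusion says [0 <= dot (F (u i)) (u i - w)] for the convex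
       combination [w] with weights [t]. *)
    have [|t [t0 t1 tM]] := @monotone_matrix_simplex R m (\matrix_(i, j) dot (F (u i)) (u i - u j)).
      move=> i j; rewrite !mxE.
      have := monF _ _ (Ku i) (Ku j).
      by rewrite dotBl -[u j - u i]opprB dotNr.
    pose w := \sum_j (t ord0 j *: u j).
    have Kw : K w.
      have := @convex_subset_sum K m (t ord0) u vK t0 Ku; rewrite t1 ltr01 invr1 scale1r.
      by apply.
    exists w => v /= vD; split => //.
    have [i vi] : exists i : 'I_m.+1, v = u i.
      have vs : (index v s < m.+1)%N by rewrite -sm index_mem.
      by exists (Ordinal vs); rewrite /u nth_index.
    rewrite /g/= vi -[w - u i]opprB dotNr oppr_le0.
    have -> : u i - w = \sum_j t ord0 j *: (u i - u j).
      under eq_bigr do rewrite scalerBr.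
      by rewrite sumrB -scaler_suml t1 scale1r.
    rewrite dot_sumr; have := tM i.
    by under eq_bigr do rewrite mxE -dotZr.
  have [k Kk] := K0.
  exists w; split; first by have [] := wH _ Kk.
  by move=> u /wH[_]; rewrite /g/= -[w - u]opprB dotNr oppr_le0.
(* If [F w] had a negative product with [u - w], then by continuity so would [F] at points of the
   segment to [u] close to [w], contrary to the Minty inequality at those points. *)
exists w => // u Ku; rewrite leNgt; apply/negP => neg.
pose h (th : R) := dot (F (th *: (u - w) + w)) (u - w).
have ch : h th @[th --> (0 : R)] --> dot (F w) (u - w).
  apply: cvg_dot; last exact: cvg_cst.
  have cw : (th *: (u - w) + w) @[th --> (0 : R)] --> w.
    by have := @continuous_line _ _ (u - w) w 0; rewrite /continuous_at scale0r add0r.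
  exact: (cvg_comp _ _ cw (cF w)).
have h0 : \forall th \near (0 : R)^'+, h th < 0.
  by apply: cvg_within; exact: (cvgr_lt _ ch).
near (0 : R)^'+ => th.
have th0 : 0 < th by near: th; exact: nbhs_right_gt.
have th1 : th < 1 by near: th; exact: nbhs_right_lt.
have : h th < 0 by near: th.
rewrite ltNge => /negP; apply.
have Kth : K (th *: (u - w) + w).
  have -> : th *: (u - w) + w = th *: u + (1 - th) *: w.
    by apply/rowP => i; rewrite !mxE; ring.
  by apply: vK => //; rewrite (ltW th0) (ltW th1).
by have := wminty _ Kth; rewrite addrK dotZr pmulr_rge0.
Unshelve. all: by end_near. Qed.

End variational_inequality.

Section blocks.
Context {R : realType}.

Lemma cvg_row_mx n1 n2 (T : Type) (F : set_system T) (f : T -> 'rV[R]_n1)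
    (g : T -> 'rV[R]_n2) (a : 'rV[R]_n1) (b : 'rV[R]_n2) : Filter F ->
  f x @[x --> F] --> a -> g x @[x --> F] --> b ->
  row_mx (f x) (g x) @[x --> F] --> row_mx a b.
Proof.
move=> FF fa gb; apply: cvg_rV => i; case: (split_ordP i) => j ->.
  by rewrite row_mxEl; under eq_fun do rewrite row_mxEl; exact: cvg_rV_coord.
by rewrite row_mxEr; under eq_fun do rewrite row_mxEr; exact: cvg_rV_coord.
Qed.

Lemma cvg_lsubmx n1 n2 (T : Type) (F : set_system T)
    (f : T -> 'rV[R]_(n1 + n2)) (a : 'rV[R]_(n1 + n2)) : Filter F ->
  f x @[x --> F] --> a -> lsubmx (f x) @[x --> F] --> lsubmx a.
Proof.
move=> FF fa; apply: cvg_rV => i; rewrite mxE.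
by under eq_fun do rewrite mxE; exact: cvg_rV_coord.
Qed.

Lemma cvg_rsubmx n1 n2 (T : Type) (F : set_system T)
    (f : T -> 'rV[R]_(n1 + n2)) (a : 'rV[R]_(n1 + n2)) : Filter F ->
  f x @[x --> F] --> a -> rsubmx (f x) @[x --> F] --> rsubmx a.
Proof.
move=> FF fa; apply: cvg_rV => i; rewrite mxE.
by under eq_fun do rewrite mxE; exact: cvg_rV_coord.
Qed.

End blocks.

(** * First-order inequalities for convex functions *)

Section convexity.
Context {R : realType}.

Lemma convex_fun_le n (f : 'rV[R]_n -> R) (x y : 'rV[R]_n) (th : R) :
  convex_fun f -> 0 <= th <= 1 ->
  f (th *: x + (1 - th) *: y) <= th * f x + (1 - th) * f y.
Proof.
move=> cf /andP[th0 th1].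
by have := cf (Itv01 th0 th1) x y; apply; rewrite inE.
Qed.

(** Convexity is asked only along the segment from [w] to [v + w], since the objective is convex in
    [x] alone and concave in [y] alone; [v] will have one zero block. *)
Lemma grad_secant_le n (f : 'rV[R]_n -> R) (w v : 'rV[R]_n) :
  differentiable f w ->
  (forall th, 0 <= th <= 1 ->
    f (th *: v + w) <= th * f (v + w) + (1 - th) * f w) ->
  dot (grad f w) v <= f (v + w) - f w.
Proof.
move=> df fc; rewrite -diff_grad// -deriveE// leNgt; apply/negP => Hlt.
have dv : h^-1 *: (f (h *: v + w) - f w) @[h --> (0 : R)^'] --> 'D_v f w.
  have /cvg_ex[l fl] : derivable f w v by exact: diff_derivable.
  by rewrite /derive (cvg_lim _ fl).
have : \forall h \near (0 : R)^'+, f (v + w) - f w < h^-1 *: (f (h *: v + w) - f w).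
  have : \forall h \near (0 : R)^', f (v + w) - f w < h^-1 *: (f (h *: v + w) - f w).
    exact: (cvgr_gt _ dv).
  move=> /nbhs_ballP[e /= e0 H]; apply/nbhs_ballP; exists e => //= h eh h0.
  by apply: H => //; rewrite gt_eqF.
move=> nH.
near (0 : R)^'+ => h.
have h0 : 0 < h by near: h; exact: nbhs_right_gt.
have h1 : h < 1 by near: h; exact: nbhs_right_lt.
have : f (v + w) - f w < h^-1 *: (f (h *: v + w) - f w) by near: h.
have := fc h; rewrite (ltW h0) (ltW h1) => /(_ isT) fh.
rewrite ltNge => /negP; apply; rewrite [_ *: _]mulrC ler_pdivrMr//; lra.
Unshelve. all: by end_near. Qed.

Lemma convex_grad_le n (f : 'rV[R]_n -> R) (w u : 'rV[R]_n) :
  differentiable f w -> convex_fun f ->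
  dot (grad f w) (u - w) <= f u - f w.
Proof.
move=> df cf; rewrite -{2}(subrK w u); apply: grad_secant_le => // th th01.
rewrite subrK (_ : th *: (u - w) + w = th *: u + (1 - th) *: w).
  exact: convex_fun_le.
by apply/rowP => i; rewrite !mxE; ring.
Qed.

End convexity.

(** * Existence of a saddle point; bounded perturbations of the feasible set *)

Section minimax.
Context {R : realType} {nx ny p q : nat}.
Variable P : minimax_problem R nx ny p q.
Hypothesis G_convex : forall i, convex_fun (fun w => ineq P w ord0 i).

Lemma eq_residualE w :
  eq_residual P w = w *m (row_mx (eqA P) (eqB P))^T - Defs.eqb P.
Proof. by rewrite /eq_residual tr_row_mx -{3}(hsubmxK w) mul_row_col. Qed.

Lemma eq_residual_conv u v (th : R) :
  eq_residual P (th *: u + (1 - th) *: v) =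
  th *: eq_residual P u + (1 - th) *: eq_residual P v.
Proof.
rewrite !eq_residualE mulmxDl -!scalemxAl.
move: (u *m _) (v *m _) => X Y.
by apply/rowP => i; rewrite !mxE; ring.
Qed.

Lemma continuous_eq_residual : continuous (eq_residual P).
Proof.
rewrite (_ : eq_residual P = fun w => w *m (row_mx (eqA P) (eqB P))^T - Defs.eqb P).
  move=> w.
  apply: (@cvgB _ _ _ (nbhs w)); last exact: cvg_cst.
  by apply: (@cvg_mulmx_rV _ _ _ _ (nbhs w)); exact: cvg_id.
by apply/funext => w; exact: eq_residualE.
Qed.

Lemma feasible_convex : convex_subset (feasible P).
Proof.
move=> u v th [u0 Gu] [v0 Gv] th01; split.
  by rewrite eq_residual_conv u0 v0 !scaler0 addr0.
move=> i; apply: le_trans (convex_fun_le u v (G_convex i) th01) _.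
by have := Gu i; have := Gv i; nra.
Qed.

(** Add four secant inequalities, in [x] and in [y], from [u] and from [v]. The values of the
    objective at [u], [v] and at the two mixed points all cancel. *)
Lemma pseudo_gradient_monotone :
  (forall w, differentiable (obj P) w) ->
  (forall y, convex_fun (fun x => obj P (row_mx x y))) ->
  (forall x, concave_fun (fun y => obj P (row_mx x y))) ->
  forall u v, 0 <= dot (pseudo_gradient P u - pseudo_gradient P v) (u - v).
Proof.
move=> dJ Jx Jy u v.
pose J := obj P.
have secx (a b : 'rV[R]_(nx + ny)) : dot (lsubmx (grad J a)) (lsubmx b - lsubmx a) <=
    J (row_mx (lsubmx b) (rsubmx a)) - J a.
  have E : row_mx (lsubmx b - lsubmx a) 0 + a = row_mx (lsubmx b) (rsubmx a).
    by rewrite -{2}(hsubmxK a) add_row_mx subrK add0r.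
  have := @grad_secant_le _ _ J a (row_mx (lsubmx b - lsubmx a) 0) (dJ a).
  rewrite E -{1}(hsubmxK (grad J a)) dot_row_mx dot0r addr0; apply => th th01.
  have := convex_fun_le (lsubmx b) (lsubmx a) (Jx (rsubmx a)) th01.
  rewrite hsubmxK => /(le_trans _); apply; rewrite le_eqVlt; apply/orP; left.
  apply/eqP; congr (J _); rewrite -{2}(hsubmxK a) scale_row_mx scaler0 add_row_mx.
  by rewrite add0r; congr row_mx; apply/rowP => i; rewrite !mxE; ring.
have secy (a b : 'rV[R]_(nx + ny)) : - dot (rsubmx (grad J a)) (rsubmx b - rsubmx a) <=
    J a - J (row_mx (lsubmx a) (rsubmx b)).
  have E : row_mx 0 (rsubmx b - rsubmx a) + a = row_mx (lsubmx a) (rsubmx b).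
    by rewrite -{2}(hsubmxK a) add_row_mx subrK add0r.
  pose NJ w := - J w.
  have dNJ : differentiable NJ a by exact: (differentiableN (dJ a)).
  have := @grad_secant_le _ _ NJ a (row_mx 0 (rsubmx b - rsubmx a)) dNJ.
  have -> : grad NJ a = - grad J a.
    apply/rowP => i; rewrite !mxE (_ : NJ = - J)// deriveN//; exact: diff_derivable.
  rewrite E -{1}(hsubmxK (- grad J a)) dot_row_mx dot0r add0r linearN dotNl.
  rewrite /NJ opprK => H; rewrite [leRHS]addrC; apply: H => th th01.
  have := convex_fun_le (rsubmx b) (rsubmx a) (Jy (lsubmx a)) th01.
  rewrite hsubmxK => /(le_trans _); apply; rewrite le_eqVlt; apply/orP; left.
  apply/eqP; congr (- J _); rewrite -{2}(hsubmxK a) scale_row_mx scaler0 add_row_mx.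
  by rewrite add0r; congr row_mx; apply/rowP => i; rewrite !mxE; ring.
have x1 := secx u v; have x2 := secx v u; have y1 := secy u v; have y2 := secy v u.
rewrite -[u - v]hsubmxK !linearB/= /pseudo_gradient opp_row_mx add_row_mx dot_row_mx.
rewrite -/J in x1 x2 y1 y2 *.
move: x1 x2 y1 y2; rewrite !(dotBl, dotBr, dotNl, dotNr, opprK).
lra.
Qed.

Lemma continuous_pseudo_gradient :
  continuous (grad (obj P)) -> continuous (pseudo_gradient P).
Proof.
move=> cg w; apply: (@cvg_row_mx _ _ _ _ (nbhs w)).
  by apply: (@cvg_lsubmx _ _ _ _ (nbhs w)); exact: cg.
apply: (@cvgN _ _ _ (nbhs w)).
by apply: (@cvg_rsubmx _ _ _ _ (nbhs w)); exact: cg.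
Qed.

Theorem saddle_point_exists :
  C1 (obj P) ->
  (forall y, convex_fun (fun x => obj P (row_mx x y))) ->
  (forall x, concave_fun (fun y => obj P (row_mx x y))) ->
  compact (feasible P) -> feasible P !=set0 ->
  exists ws, saddle_point P ws.
Proof.
move=> [dJ cgJ] Jx Jy cK K0.
have [|u v _ _|w Kw wH] := @monotone_variational_inequality _ _ (feasible P)
  (pseudo_gradient P) cK feasible_convex K0.
- exact: continuous_pseudo_gradient.
- exact: pseudo_gradient_monotone.
- by exists w; split.
Qed.

Hypothesis G_continuous : continuous (ineq P).

(** The positive part. *)
Let pos (a : R) : R := (`|a| + a) / 2.

(** On a sphere about [w0] that strictly encloses the feasible set the total violation is at least
    some [m > 0]. A point beyond the sphere with small violation, pulled back to the sphere along
    the segment to the feasible [w0], would by convexity have a violation below [m]. *)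
Lemma perturbed_feasible_bounded (w0 : 'rV[R]_(nx + ny)) :
  compact (feasible P) -> feasible P w0 ->
  exists (d r : R), 0 < d /\ forall w, (forall i, ineq P w ord0 i <= d) ->
    `|eq_residual P w| <= d -> `|w - w0| <= r.
Proof.
move=> cK [w00 Gw0].
have [D D0 DK] : exists2 D : R, 0 < D & forall w, feasible P w -> `|w - w0| < D.
  have [M [_ MK]] := compact_bounded cK.
  exists (`|M| + 1 + `|w0| + 1) => [|w Kw]; first by have := normr_ge0 M;
    have := normr_ge0 w0; lra.
  have : `|w| <= `|M| + 1 by apply: MK => //; rewrite (le_lt_trans (ler_norm M))// ltrDl.
  by have := ler_normB w w0; lra.
pose viol w := \sum_i pos (ineq P w ord0 i) + `|eq_residual P w|.
have cviol : continuous viol.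
  have cs : continuous (fun w => \sum_i pos (ineq P w ord0 i)).
    apply: continuous_sum_ord => i w.
    have cGi : ineq P x ord0 i @[x --> w] --> ineq P w ord0 i.
      by apply: (@cvg_rV_coord _ _ _ (nbhs w)); exact: G_continuous.
    exact: cvgM (cvgD (cvg_norm cGi) cGi) (cvg_cst _).
  have ce : continuous (fun w => `|eq_residual P w|).
    by apply: continuous_normr; exact: continuous_eq_residual.
  by move=> w; apply: (@cvgD _ _ _ (nbhs w)); [exact: cs|exact: ce].
pose Sph := [set w : 'rV[R]_(nx + ny) | `|w - w0| = D].
have cSph : compact Sph.
  have -> : Sph = [set w | `|w - w0| <= D] `&` [set w | - `|w - w0| <= - D].
    apply/seteqP; split => w /=; first by move=> ->.
    by move=> [w1 w2]; apply/eqP; rewrite eq_le w1 -lerN2.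
  apply: compact_closedI; first exact: compact_rV_ball.
  apply: closed_sublevel => w; apply: (@cvgN _ _ _ (nbhs w)).
  apply: cvg_norm; apply: (@cvgB _ _ _ (nbhs w)); [exact: cvg_id|exact: cvg_cst].
have pos_ge0 a : 0 <= pos a.
  by rewrite /pos; have := ler_norm (- a); rewrite normrN; lra.
have [m m0 mH] : exists2 m : R, 0 < m & forall w, Sph w -> m <= viol w.
  (* The sphere is empty in dimension 0, where the extreme value theorem has no point to offer. *)
  have [S0|/set0P S0] := eqVneq Sph set0.
    by exists 1 => // w; rewrite S0.
  have [w1] := EVT_min_rV S0 cSph (continuous_subspaceT cviol).
  rewrite inE => Sw1 w1min; exists (viol w1) => [|w Sw]; last by apply: w1min; rewrite inE.
  have v0 : 0 <= viol w1 by rewrite addr_ge0// sumr_ge0.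
  rewrite lt_neqAle eq_sym v0 andbT; apply/negP => /eqP.
  move=> /eqP; rewrite paddr_eq0 ?sumr_ge0// => /andP[/eqP s0 /eqP e0].
  have : feasible P w1.
    split => [|i]; first exact/normr0_eq0.
    have : pos (ineq P w1 ord0 i) = 0 by apply: (psumr_eq0P _ s0).
    by rewrite /pos; have := normr_ge0 (ineq P w1 ord0 i); lra.
  by move=> /DK; rewrite Sw1 ltxx.
have p1 : 0 < p%:R + 1 + 1 :> R by rewrite ltr_wpDl// addr_ge0.
(* The violation on the sphere is then at most [p%:R * d] from the inequalities and [d] from the
   residual; the second [+ 1] makes the comparison with [m] strict. *)
exists (m / (p%:R + 1 + 1)), D; split => [|w Gw ew]; first by rewrite divr_gt0.
set d := m / (p%:R + 1 + 1) in Gw ew.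
have d0 : 0 < d by rewrite divr_gt0.
have dm : p%:R * d + d + d = m by rewrite -{2 3}[d]mul1r -!mulrDl mulrC divfK// gt_eqF.
rewrite leNgt; apply/negP => Dw.
have w0w : 0 < `|w - w0| by exact: lt_trans D0 Dw.
pose th := D / `|w - w0|.
have th0 : 0 < th by rewrite divr_gt0.
have th1 : th < 1 by rewrite ltr_pdivrMr// mul1r.
have th01 : 0 <= th <= 1 by rewrite !ltW.
pose w' := th *: w + (1 - th) *: w0.
have : Sph w'.
  rewrite /Sph/= (_ : w' - w0 = th *: (w - w0)).
    by rewrite normrZ gtr0_norm// divfK// gt_eqF.
  by apply/rowP => i; rewrite !mxE; ring.
move=> /mH; rewrite leNgt => /negP; apply.
have e' : `|eq_residual P w'| <= d.
  rewrite eq_residual_conv w00 scaler0 addr0 normrZ gtr0_norm//.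
  by have := normr_ge0 (eq_residual P w); nra.
have G' i : pos (ineq P w' ord0 i) <= d.
  have := convex_fun_le w w0 (G_convex i) th01; rewrite -/w'.
  have := Gw i; have := Gw0 i; set g := ineq P w' ord0 i => h1 h2 h3.
  have gd : g <= d by nra.
  by rewrite /pos; have [?|?] := ger0P g; lra.
have : \sum_i pos (ineq P w' ord0 i) <= p%:R * d.
  by rewrite -[X in X%:R](card_ord p) mulr_natl -sumr_const ler_sum.
rewrite /viol; lra.
Qed.

End minimax.

(** * Estimates for the smoothed complementarity function and multipliers *)

Section sublevel_bounds.
Context {R : realType}.

Lemma norm_mulmx_le m n (u : 'rV[R]_m) (B : 'M[R]_(m, n)) :
  `|u *m B| <= m%:R * (`|u| * `|B|).
Proof.
apply: rV_norm_le => [|j]; first by rewrite !mulr_ge0.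
rewrite mxE (le_trans (ler_norm_sum _ _ _))//.
rewrite -[X in X%:R * _](card_ord m) mulr_natl -sumr_const ler_sum// => i _.
rewrite normrM ler_pM// ?coord_norm_le//.
rewrite [leRHS]/Num.Def.normr/= mx_normrE.
exact: (le_bigmax _ (fun ij : 'I_m * 'I_n => `|B ij.1 ij.2|) (i, j)).
Qed.

Lemma continuous_ball_bounded n (f : 'rV[R]_n -> R) (c : 'rV[R]_n) (r : R) :
  continuous f -> exists2 C : R, 0 <= C & forall w, `|w - c| <= r -> f w <= C.
Proof.
move=> cf; pose B := [set w : 'rV[R]_n | `|w - c| <= r].
have [B0|/set0P B0] := eqVneq B set0.
  by exists 0 => // w wr; have : B w by []; rewrite B0.
have [w _ wmax] := EVT_max_rV B0 (@compact_rV_ball R n c r) (continuous_subspaceT cf).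
exists `|f w| => // u ur; apply: le_trans (ler_norm _).
by apply: wmax; rewrite inE.
Qed.

(* [phi eps a c = d] rewrites as [2 (a + d) (c + d) = eps ^ 2 + d ^ 2] with
   both factors positive. *)
Lemma phiP (eps a c : R) (d := phi eps a c) : 0 < eps ->
  [/\ 0 < a + d, 0 < c + d & 2 * ((a + d) * (c + d)) = eps ^+ 2 + d ^+ 2].
Proof.
move=> e0; rewrite /d /phi; set s := Num.sqrt _.
have e20 : 0 < eps ^+ 2 by rewrite exprn_gt0.
have x0 : 0 <= a ^+ 2 + c ^+ 2 + eps ^+ 2 by rewrite !addr_ge0 ?sqr_ge0.
have s2 : s ^+ 2 = a ^+ 2 + c ^+ 2 + eps ^+ 2 by rewrite sqr_sqrtr.
have s0 : 0 <= s by exact: sqrtr_ge0.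
have a2 := sqr_ge0 a; have c2 := sqr_ge0 c.
have sa : a < s by rewrite ltNge; apply/negP => sa; nra.
have sc : c < s by rewrite ltNge; apply/negP => sc; nra.
split; [lra|lra|].
rewrite (_ : a + _ = s - c); last by ring.
rewrite (_ : c + _ = s - a); last by ring.
have -> : 2 * ((s - c) * (s - a)) = s ^+ 2 + (s - (a + c)) ^+ 2 - a ^+ 2 - c ^+ 2 by ring.
rewrite s2; ring.
Qed.

(** The square root lies between the absolute value of [lam_i] and that value plus [eps], so the
    smoothed multiplier is the positive part of [lam_i] up to [eps]. *)
Lemma smooth_mult_bounds p (eps : R) (lam : 'rV[R]_p) i : 0 < eps ->
  [/\ 0 <= smooth_mult eps lam ord0 i, lam ord0 i <= smooth_mult eps lam ord0 i &
      smooth_mult eps lam ord0 i <= (`|lam ord0 i| + lam ord0 i) / 2 + eps].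
Proof.
move=> e0; rewrite mxE; set a := lam ord0 i; set s := Num.sqrt _.
have x0 : 0 <= a ^+ 2 + eps ^+ 2 by rewrite !addr_ge0 ?sqr_ge0.
have s2 : s ^+ 2 = a ^+ 2 + eps ^+ 2 by rewrite sqr_sqrtr.
have s0 : 0 <= s by exact: sqrtr_ge0.
have as_ : `|a| <= s.
  by rewrite -sqrtr_sqr ler_wsqrtr// lerDl sqr_ge0.
have sa : s <= `|a| + eps.
  have a0 := normr_ge0 a.
  rewrite -(@ler_pXn2r _ 2)// ?nnegrE ?addr_ge0// ?(ltW e0)// s2.
  by rewrite -[a ^+ 2]real_normK ?num_real//; nra.
move: as_; rewrite ler_norml => /andP[a1 a2].
by split; lra.
Qed.

End sublevel_bounds.

(** * Boundedness of small sublevel sets of [V] *)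

Section sublevel_compact.
Context {R : realType} {nx ny p q : nat}.
Variables (P : minimax_problem R nx ny p q) (eps : R).
Hypothesis eps_gt0 : 0 < eps.

(** Merging the [x] and [y] blocks allows stationarity to be tested against one direction and makes
    [[A B]] appear as a single matrix of full row rank. *)
Lemma Svec_stat (z : 'rV[R]_((nx + ny) + (p + q))) :
  lsubmx (Svec P eps z) = pseudo_gradient P (primal z) +
    eq_mult z *m row_mx (eqA P) (eqB P) +
    smooth_mult eps (ineq_mult z) *m Jac (ineq P) (primal z).
Proof.
rewrite /Svec row_mxKl /pseudo_gradient mul_mx_row -[in RHS](hsubmxK (Jac (ineq P) (primal z))).
by rewrite mul_mx_row !add_row_mx.
Qed.

Lemma coord_Svec_le z i : `|Svec P eps z ord0 i| <= Num.sqrt (2 * Vfun P eps z).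
Proof.
rewrite /Vfun mulrA divff ?mul1r; last by rewrite pnatr_eq0.
by rewrite sqrtr_sqr (ger0_norm (sqrtr_ge0 _)); exact: coord_enorm_le.
Qed.

Hypothesis full_rank : \rank (row_mx (eqA P) (eqB P)) = q.
Hypothesis G_convex : forall i, convex_fun (fun w => ineq P w ord0 i).
Hypothesis G_smooth : twice_differentiable (ineq P).
Hypothesis J_C1 : C1 (obj P).
Hypothesis feasible_compact : compact (feasible P).
Hypothesis slater_P : slater P.

(** With [L] the sum of the smoothed multipliers, full rank bounds [mu] by an affine function of
    [L], while the Slater test bounds [s * L] by terms that include [d] times the norm of [mu] and
    [d * L]. Taking [d] small relative to the Slater margin [s] absorbs the terms in [L] into half
    of [s * L]. *)
Lemma sublevel_bounded : exists (c r : R), 0 < c /\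
  forall z, Vfun P eps z <= c -> `|z| <= r.
Proof.
have [dG dJG] := G_smooth; have [dJ cgJ] := J_C1.
have [wb [ewb Gwb]] := slater_P.
have cG : continuous (ineq P) by move=> w; exact: differentiable_continuous.
have fwb : feasible P wb by split => // i; exact: ltW.
have [d1 [r1 [d1_gt0 r1H]]] := perturbed_feasible_bounded G_convex cG feasible_compact fwb.
(* The Slater margin is the slack of the tightest inequality, or 1 if there are no inequalities. *)
have [s s0 sH] : exists2 s : R, 0 < s & forall i, ineq P wb ord0 i <= - s.
  have [[i0 _]|noi] := pselect (exists i : 'I_p, True); last first.
    by exists 1 => // i; case: noi; exists i.
  case: (@arg_maxP _ _ _ i0 predT (fun i => ineq P wb ord0 i) isT) => i _ iH.
  by exists (- ineq P wb ord0 i) => [|j]; rewrite ?opprK ?oppr_gt0//; exact: iH.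
pose AB := row_mx (eqA P) (eqB P).
have [X ABX] : exists X, AB *m X = 1%:M.
  by apply/row_freeP; rewrite /row_free full_rank.
have [C1 C10 C1H] := @continuous_ball_bounded _ _ (fun w => `|pseudo_gradient P w|) wb r1
  (continuous_normr (continuous_pseudo_gradient cgJ)).
have [C2 C20 C2H] := @continuous_ball_bounded _ _ (fun w => `|Jac (ineq P) w|) wb r1
  (continuous_normr (fun w => differentiable_continuous (dJG w))).
have [C3 C30 C3H] := @continuous_ball_bounded _ _ (fun w => `|ineq P w|) wb r1
  (continuous_normr cG).
pose N : R := (nx + ny)%:R.
(* Multiplication by the right inverse [X] enlarges the norm at most by this factor. *)
pose kap : R := N * `|X|.
have kap0 : 0 <= kap by rewrite !mulr_ge0.
have r10 : 0 <= r1.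
  have := r1H wb; rewrite subrr normr0; apply => [i|].
    by rewrite (le_trans (ltW (Gwb i)))// ltW.
  by rewrite ewb normr0 ltW.
(* [d * K1] is the total coefficient of [L] on the right of [key]: the product comes from [mu], the
   1 from the approximate complementarity [ltG]. The choice of [d] makes it at most [s / 2]. *)
pose K1 := q%:R * kap * (p%:R * C2) + 1.
have K10 : 0 < K1 by rewrite ltr_wpDl// !mulr_ge0.
pose d := Order.min 1 (Order.min d1 (s / (2 * K1))).
have d_gt0 : 0 < d by rewrite !lt_min ltr01 d1_gt0 divr_gt0// mulr_gt0.
have d_le1 : d <= 1 by rewrite ge_min lexx.
have d_led1 : d <= d1 by rewrite !ge_min lexx !orbT.
have dK1 : d * K1 <= s / 2.
  have : d <= s / (2 * K1) by rewrite !ge_min lexx !orbT.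
  by rewrite invfM mulrA ler_pdivlMr.
(* [C5] bounds [lt_i * (- G_i)] up to [d * lt_i], for [lt] the smoothed
   multipliers; testing stationarity against the Slater direction [wb - w] then
   bounds their sum by [C6], and full row rank bounds [mu]. *)
pose C5 : R := (eps ^+ 2 + 1) / 2 + (2 + eps) * (C3 + 1).
pose C6 : R := (N * ((1 + C1) * r1) + q%:R * kap * (1 + C1) + p%:R * C5) * 2 / s.
pose r : R := r1 + `|wb| + (C6 + 1) + kap * (1 + C1 + p%:R * (C6 * C2)).
(* Each coordinate of [Svec] is at most the square root of [2 * V], hence at most [d] at this
   level. *)
exists (d ^+ 2 / 2), r; split; first by rewrite divr_gt0// exprn_gt0.
move=> z Vz.
have Sd i : `|Svec P eps z ord0 i| <= d.
  apply: le_trans (coord_Svec_le z i) _.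
  rewrite -[leRHS](ger0_norm (ltW d_gt0)) -sqrtr_sqr ler_wsqrtr//; lra.
set w := primal z; set lam := ineq_mult z; set mu := eq_mult z.
set lt := smooth_mult eps lam.
have phid i : `|phi eps (lam ord0 i) (- ineq P w ord0 i)| <= d.
  have := Sd (rshift _ (lshift _ i)); rewrite /Svec row_mxEr row_mxEl mxE; exact.
have resd : `|eq_residual P w| <= d.
  apply: rV_norm_le; first exact: ltW.
  by move=> i; have := Sd (rshift _ (rshift _ i)); rewrite /Svec row_mxEr row_mxEr.
have statd : `|lsubmx (Svec P eps z)| <= d.
  by apply: rV_norm_le; [exact: ltW|move=> i; rewrite mxE; exact: Sd].
have Gd i : ineq P w ord0 i <= d.
  have [_ h _] := phiP (lam ord0 i) (- ineq P w ord0 i) eps_gt0.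
  by have := phid i; rewrite ler_norml => /andP[_]; lra.
have wr : `|w - wb| <= r1.
  apply: r1H => [i|]; first by rewrite (le_trans (Gd i)).
  exact: le_trans resd d_led1.
have C1w := C1H _ wr; have C2w := C2H _ wr; have C3w := C3H _ wr.
have lt_ge0 i : 0 <= lt ord0 i by have [] := smooth_mult_bounds lam i eps_gt0.
have ltG i : lt ord0 i * - ineq P w ord0 i <= C5 + d * lt ord0 i.
  have [h1 h2 h3] := phiP (lam ord0 i) (- ineq P w ord0 i) eps_gt0.
  have := phid i; set de := phi _ _ _ in h1 h2 h3 *; rewrite ler_norml => /andP[e1 e2].
  have [l1 _ l2] := smooth_mult_bounds lam i eps_gt0.
  have gC : - ineq P w ord0 i <= C3.
    by rewrite (le_trans _ C3w)// (le_trans (ler_norm _))// normrN coord_norm_le.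
  rewrite -/lt in l1 l2; set a := lam ord0 i in h1 h3 l2;
    set g := - ineq P w ord0 i in h2 h3 gC *.
  set t := lt ord0 i in l1 l2 *.
  (* [phiP] evaluates the product of [a + de] and [g + de]. Replacing [a + de] by [t] costs at most
     [(2 + eps) * (C3 + 1)], and removing [de] from the other factor costs [d * t]. *)
  have l3 : t <= (a + de) + (2 + eps).
    by move: l2; have [?|?] := ger0P a; lra.
  have de2 : de ^+ 2 <= 1 by nra.
  have : t * (g + de) <= (a + de + (2 + eps)) * (g + de) by rewrite ler_wpM2r// ltW.
  have : (2 + eps) * (g + de) <= (2 + eps) * (C3 + 1)
    by rewrite ler_wpM2l ?lerD// ?addr_ge0 ?(ltW eps_gt0)// (le_trans e2).
  have : - (t * de) <= d * t by nra.
  rewrite /C5 mulrDl [t * (g + de)]mulrDr; lra.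
pose L := \sum_i lt ord0 i.
have L0 : 0 <= L by apply: sumr_ge0.
have ltL : `|lt| <= L.
  apply: rV_norm_le => // i; rewrite ger0_norm// /L (bigD1 i)//= lerDl.
  by apply: sumr_ge0.
have muL : `|mu| <= kap * (1 + C1 + p%:R * (L * C2)).
  have -> : mu = (mu *m AB) *m X by rewrite -mulmxA ABX mulmx1.
  have mAB : `|mu *m AB| <= 1 + C1 + p%:R * (L * C2).
    have -> : mu *m AB = lsubmx (Svec P eps z) - pseudo_gradient P w - lt *m Jac (ineq P) w.
      by rewrite Svec_stat -/w -/mu -/lam -/lt -/AB addrAC addrK addrAC subrr add0r.
    rewrite (le_trans (ler_normB _ _))// lerD//.
      by rewrite (le_trans (ler_normB _ _))// lerD// (le_trans statd).
    rewrite (le_trans (norm_mulmx_le _ _))// ler_wpM2l// ler_pM//.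
  rewrite (le_trans (norm_mulmx_le _ _))// /kap -/N -mulrA ler_wpM2l//.
  by rewrite [leLHS]mulrC ler_wpM2l.
pose h := wb - w.
have key : s * L <= N * ((1 + C1) * r1) + q%:R * (`|mu| * d) + (p%:R * C5 + d * L).
  (* As [wb] has zero residual, [mu] is paired only with the residual of [w], which is at most [d].
     This is what gives [mu] a small coefficient. *)
  have e1 : dot (lsubmx (Svec P eps z)) h = dot (pseudo_gradient P w) h
      - dot mu (eq_residual P w) + \sum_i lt ord0 i * dot (row i (Jac (ineq P) w)) h.
    rewrite Svec_stat !dotDl -/w -/mu -/lam -/lt -/AB; congr (_ + _ + _).
      rewrite dot_mulmx -dotNr; congr dot.
      move: ewb => /eqP; rewrite !eq_residualE -/AB subr_eq0 => /eqP ewb'.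
      by rewrite /h mulmxBl ewb' opprB.
    rewrite dot_mulmx; apply: eq_bigr => i _; congr (_ * _); rewrite mxE.
    by apply: eq_bigr => j _; rewrite !mxE mulrC.
  have e2 : \sum_i lt ord0 i * dot (row i (Jac (ineq P) w)) h <= - (s * L) + (p%:R * C5 + d * L).
    have -> : - (s * L) + (p%:R * C5 + d * L) = \sum_i (- (s * lt ord0 i) + (C5 + d * lt ord0 i)).
      rewrite big_split/= sumrN -mulr_sumr; congr (_ + _).
      by rewrite big_split/= sumr_const card_ord mulr_natl -mulr_sumr.
    apply: ler_sum => i _; rewrite Jac_coord//.
    have gi : dot (grad (fun x => ineq P x ord0 i) w) h <= - s - ineq P w ord0 i.
      apply: le_trans (convex_grad_le wb _ (G_convex i)) _; last by rewrite lerD2r.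
      exact: differentiable_rV_coord.
    have := ltG i; have := ler_wpM2l (lt_ge0 i) gi; rewrite mulrBr mulrN; lra.
  have hr : `|h| <= r1 by rewrite /h distrC.
  have e3 := norm_dot_le (lsubmx (Svec P eps z)) h.
  have e4 := norm_dot_le (pseudo_gradient P w) h.
  have e5 := norm_dot_le mu (eq_residual P w).
  have e6 : N * (`|lsubmx (Svec P eps z)| * `|h|) <= N * (1 * r1).
    by rewrite ler_wpM2l// ler_pM// (le_trans statd).
  have e7 : N * (`|pseudo_gradient P w| * `|h|) <= N * (C1 * r1).
    by rewrite ler_wpM2l// ler_pM.
  have e8 : q%:R * (`|mu| * `|eq_residual P w|) <= q%:R * (`|mu| * d).
    by rewrite ler_wpM2l// ler_wpM2l.
  move: e3 e4 e5; rewrite !ler_norml -/N => /andP[e31 _] /andP[_ e42] /andP[e51 _].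
  rewrite !mulrDl mulrDr; lra.
(* Insert the bound [muL] into [key]; the terms in [L] amount to [L * (d * K1)], at most half of
   [s * L], whence the factor [2 / s] in [C6]. *)
have LC6 : L <= C6.
  have m1 : q%:R * (`|mu| * d) <= q%:R * kap * (1 + C1) + d * L * (q%:R * kap * (p%:R * C2)).
    have : q%:R * (`|mu| * d) <= q%:R * (kap * (1 + C1 + p%:R * (L * C2)) * d).
      by rewrite ler_wpM2l// ler_wpM2r// ltW.
    move=> /le_trans; apply.
    have qk : 0 <= q%:R * kap * (1 + C1) by rewrite !mulr_ge0// addr_ge0.
    have : q%:R * kap * (1 + C1) * d <= q%:R * kap * (1 + C1) * 1 by rewrite ler_wpM2l.
    set y := q%:R * kap * (1 + C1) in qk *.
    have -> : q%:R * (kap * (1 + C1 + p%:R * (L * C2)) * d) =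
      y * d + d * L * (q%:R * kap * (p%:R * C2)) by rewrite /y; ring.
    lra.
  have m2 : L * (d * K1) <= L * (s / 2) by rewrite ler_wpM2l.
  have m3 : d * L * (q%:R * kap * (p%:R * C2)) + d * L = L * (d * K1) by rewrite /K1; ring.
  rewrite /C6 ler_pdivlMr//; lra.
have lamC i : `|lam ord0 i| <= C6 + 1.
  have [h1 h2 h3] := smooth_mult_bounds lam i eps_gt0.
  have [h4 _ _] := phiP (lam ord0 i) (- ineq P w ord0 i) eps_gt0.
  have h5 : lt ord0 i <= C6.
    by rewrite (le_trans _ LC6)// (le_trans _ ltL)// (le_trans (ler_norm _)) ?coord_norm_le.
  have := phid i; rewrite !ler_norml => /andP[_ h6].
  rewrite -/lt in h2; apply/andP; split; lra.
have C60 : 0 <= C6 by exact: le_trans LC6.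
have muC : `|mu| <= kap * (1 + C1 + p%:R * (C6 * C2)).
  rewrite (le_trans muL)// ler_wpM2l// lerD2l ler_wpM2l// ler_wpM2r//.
have wC : `|w| <= r1 + `|wb|.
  by rewrite -(subrK wb w) (le_trans (ler_normD _ _))// lerD2r.
have mu0 := normr_ge0 mu; have w0 := normr_ge0 w; have wb0 := normr_ge0 wb.
apply: rV_norm_le => [|i]; first by rewrite /r; lra.
rewrite /r; case: (split_ordP i) => j ->.
  have := coord_norm_le w j; rewrite {1}/w mxE; lra.
case: (split_ordP j) => k ->.
  have := lamC k; rewrite /lam /ineq_mult !mxE; lra.
have := coord_norm_le mu k; rewrite {1}/mu /eq_mult !mxE; lra.
Qed.

End sublevel_compact.

(** * Differentiability and gradients of composite functions *)

Section gradients.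
Context {R : realType}.

Lemma differentiable_sum_ord n (V : normedModType R) (f : 'I_n -> V -> R) (x : V) :
  (forall i, differentiable (f i) x) -> differentiable (fun y => \sum_i f i y) x.
Proof.
move=> df.
have -> : (fun y => \sum_i f i y) = \sum_i f i by apply/funext => y; rewrite fct_sumE.
exact: differentiable_sum.
Qed.

Lemma differentiable_sqr (V : normedModType R) (f : V -> R) (x : V) :
  differentiable f x -> differentiable (fun y => f y ^+ 2) x.
Proof. by move=> df; under eq_fun do rewrite expr2; exact: differentiableM. Qed.

Lemma differentiable_sqrt_comp (V : normedModType R) (f : V -> R) (x : V) :
  0 < f x -> differentiable f x -> differentiable (fun y => Num.sqrt (f y)) x.
Proof.
move=> fx df.
apply: (@differentiable_comp _ _ _ _ f (@Num.sqrt R)) => //.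
by apply/derivable1_diffP; have [] := is_derive1_sqrt fx.
Qed.

Lemma differentiable_mx_coord m n (V : normedModType R) (F : V -> 'M[R]_(m, n))
    (x : V) i j :
  differentiable F x -> differentiable (fun y => F y i j) x.
Proof.
move=> dF.
exact: (differentiable_comp dF (differentiable_coord (F x) i j)).
Qed.

Lemma is_derive_comp_grad n (f : 'rV[R]_n -> R) (z : R -> 'rV[R]_n) (t : R) v :
  differentiable f (z t) -> is_derive t (1 : R) z v ->
  is_derive t (1 : R) (fun s => f (z s)) (dot (grad f (z t)) v).
Proof.
move=> df [dz zv].
have diffz : differentiable z t by apply/derivable1_diffP.
have dfz : differentiable (f \o z) t by exact: differentiable_comp.
apply: DeriveDef; first exact/derivable1_diffP.
rewrite -[LHS]/('D_1 (f \o z) t) deriveE// diff_comp//= diff_grad//.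
by congr dot; rewrite -zv deriveE.
Qed.

Lemma grad_half_norm_sqr m n (F : 'rV[R]_n -> 'rV[R]_m) w :
  differentiable F w ->
  grad (fun x => 2^-1 * enorm (F x) ^+ 2) w = F w *m Jac F w.
Proof.
move=> dF; pose f i x := F x ord0 i.
have df i : differentiable (f i) w by exact: differentiable_rV_coord.
have -> : (fun x => 2^-1 * enorm (F x) ^+ 2) = 2^-1 *: \sum_i (f i * f i).
  by apply/funext => x; rewrite enorm_sqr /= [in RHS]/GRing.scale/= fct_sumE.
apply/rowP => j; rewrite !mxE.
have der i : derivable (f i) w (delta_mx ord0 j) by exact: diff_derivable.
rewrite deriveZ; last by apply: derivable_sum => i; exact: derivableM.
rewrite derive_sum; last by move=> i; exact: derivableM.
rewrite [LHS]mulr_sumr; apply: eq_bigr => i _.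
have -> : Jac F w i j = 'D_(delta_mx ord0 j) (f i) w.
  by have := Jac_coord dF i => /rowP/(_ j); rewrite !mxE.
rewrite deriveM// -/(f i w) /GRing.scale/=.
by field.
Qed.

End gradients.

(** * Differentiability of [Svec], the gradient of [V], and small sublevel sets near [Sset] *)

Section stationarity.
Context {R : realType} {nx ny p q : nat}.
Variables (P : minimax_problem R nx ny p q) (eps : R).
Hypothesis eps_gt0 : 0 < eps.
Hypothesis G_smooth : twice_differentiable (ineq P).
Hypothesis J_C2 : C2 (obj P).

(** Positivity of [eps] keeps both radicands away from 0; the remaining operations on the
    coordinates are smooth, the gradient of the objective and the Jacobian of the constraints being
    differentiable. *)
Lemma differentiable_Svec z : differentiable (Svec P eps) z.
Proof.
have [dG dJG] := G_smooth; have [[dJ cgJ] dgJ _] := J_C2.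
have dcoord k : differentiable (fun z : 'rV[R]_((nx + ny) + (p + q)) => z ord0 k) z.
  exact: differentiable_coord.
have dprim : differentiable (@primal R nx ny p q) z.
  by apply: differentiable_rV => i; under eq_fun do rewrite mxE; exact: dcoord.
have dlam i : differentiable (fun z : 'rV[R]_((nx + ny) + (p + q)) => ineq_mult z ord0 i) z.
  by under eq_fun do rewrite !mxE; exact: dcoord.
have dmu i : differentiable (fun z : 'rV[R]_((nx + ny) + (p + q)) => eq_mult z ord0 i) z.
  by under eq_fun do rewrite !mxE; exact: dcoord.
have dGi i : differentiable (fun z : 'rV[R]_((nx + ny) + (p + q)) => ineq P (primal z) ord0 i) z.
  by apply: differentiable_mx_coord; exact: (differentiable_comp dprim).
have dsm i : differentiable (fun z : 'rV[R]_((nx + ny) + (p + q)) =>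
    smooth_mult eps (ineq_mult z) ord0 i) z.
  under eq_fun do rewrite mxE.
  apply: differentiableM; first exact: differentiable_cst.
  apply: differentiableD => //; apply: differentiable_sqrt_comp.
    by rewrite ltr_wpDl ?sqr_ge0// exprn_gt0.
  apply: differentiableD; last exact: differentiable_cst.
  exact: differentiable_sqr.
have dpg i : differentiable (fun z : 'rV[R]_((nx + ny) + (p + q)) =>
    pseudo_gradient P (primal z) ord0 i) z.
  have dgi k : differentiable (fun z : 'rV[R]_((nx + ny) + (p + q)) =>
      grad (obj P) (primal z) ord0 k) z.
    by apply: differentiable_mx_coord; exact: (differentiable_comp dprim).
  case: (split_ordP i) => k ->.
    by under eq_fun do rewrite row_mxEl mxE.
  by under eq_fun do rewrite row_mxEr 2!mxE; exact: differentiableN.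
apply: differentiable_rV => i; case: (split_ordP i) => k ->.
  have -> : (fun z => Svec P eps z ord0 (lshift (p + q) k)) =
    (fun z => pseudo_gradient P (primal z) ord0 k +
      \sum_l eq_mult z ord0 l * row_mx (eqA P) (eqB P) l k +
      \sum_l smooth_mult eps (ineq_mult z) ord0 l * Jac (ineq P) (primal z) l k).
    apply/funext => y; have := Svec_stat P eps y => /rowP/(_ k).
    by rewrite mxE => ->; rewrite 2!mxE; congr (_ + _ + _); rewrite mxE.
  apply: differentiableD.
    apply: differentiableD => //; apply: differentiable_sum_ord => l.
    by apply: differentiableM => //; exact: differentiable_cst.
  apply: differentiable_sum_ord => l; apply: differentiableM => //.
  by apply: differentiable_mx_coord; exact: (differentiable_comp dprim).
case: (split_ordP k) => l ->.
  have -> : (fun z => Svec P eps z ord0 (rshift (nx + ny) (lshift q l))) =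
      (fun z => phi eps (ineq_mult z ord0 l) (- ineq P (primal z) ord0 l)).
    by apply/funext => y; rewrite /Svec row_mxEr row_mxEl mxE.
  have dN : differentiable (fun z : 'rV[R]_((nx + ny) + (p + q)) => - ineq P (primal z) ord0 l) z.
    exact: differentiableN.
  apply: differentiableB; last exact: differentiableD.
  apply: differentiable_sqrt_comp.
    by rewrite ltr_wpDl ?addr_ge0 ?sqr_ge0// exprn_gt0.
  apply: differentiableD; last exact: differentiable_cst.
  by apply: differentiableD; exact: differentiable_sqr.
have -> : (fun z => Svec P eps z ord0 (rshift (nx + ny) (rshift p l))) =
    (fun z => \sum_k primal z ord0 k * (row_mx (eqA P) (eqB P))^T k l - Defs.eqb P ord0 l).
  by apply/funext => y; rewrite /Svec row_mxEr row_mxEr eq_residualE 2!mxE [X in _ + X]mxE.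
apply: differentiableB; last exact: differentiable_cst.
apply: differentiable_sum_ord => k'; apply: differentiableM; last exact: differentiable_cst.
exact: differentiable_mx_coord.
Qed.

(** Connects the assumptions, which concern the gradient of [V], with the vector field, which is
    written with [descent]. *)
Lemma grad_Vfun z : grad (Vfun P eps) z = descent P eps z.
Proof. exact: (grad_half_norm_sqr (differentiable_Svec z)). Qed.

Lemma Vfun_ge0 z : 0 <= Vfun P eps z.
Proof. by rewrite mulr_ge0 ?invr_ge0// sqr_ge0. Qed.

Lemma Vfun_eq0 z : Vfun P eps z = 0 <-> Sset P eps z.
Proof.
rewrite /Vfun enorm_sqr /Sset/=; split=> [/eqP|->]; last by rewrite dot0r mulr0.
by rewrite mulf_eq0 invr_eq0 pnatr_eq0/= dotvv_eq0 => /eqP.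
Qed.

Lemma Vfun_gt0 z : ~ Sset P eps z -> 0 < Vfun P eps z.
Proof.
move=> Sz; rewrite lt_neqAle Vfun_ge0 andbT eq_sym.
by apply/negP => /eqP/Vfun_eq0.
Qed.

Hypothesis full_rank : \rank (row_mx (eqA P) (eqB P)) = q.
Hypothesis G_convex : forall i, convex_fun (fun w => ineq P w ord0 i).
Hypothesis feasible_compact : compact (feasible P).
Hypothesis slater_P : slater P.
Hypothesis V_continuous : continuous (Vfun P eps).

Lemma sublevel_compact_small : exists2 c0 : R, 0 < c0 &
  forall c, c <= c0 -> compact [set z | Vfun P eps z <= c].
Proof.
have [J1 _ _] := J_C2.
have [c0 [r [c00 rH]]] :=
  sublevel_bounded eps_gt0 full_rank G_convex G_smooth J1 feasible_compact slater_P.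
exists c0 => // c cc0; apply: (@compact_rV_bounded _ _ _ r).
  exact: closed_sublevel.
by move=> z /= Vz; apply: rH; exact: le_trans Vz cc0.
Qed.

(** Outside an open set [C] with [Sset] inside [C] and [C] inside [N], a compact sublevel set misses
    [Sset], so [V] has a positive minimum there; the level is half of it, to be strictly below. *)
Lemma sublevel_sub_nbhs (N : set 'rV[R]_((nx + ny) + (p + q))) :
  set_nbhs (Sset P eps) N ->
  exists2 c0 : R, 0 < c0 & [set z | Vfun P eps z <= c0] `<=` N.
Proof.
move=> /set_nbhsP[C [oC SC CN]].
have [c1 c10 c1H] := sublevel_compact_small.
pose K := [set z | Vfun P eps z <= c1] `&` ~` C.
have cK : compact K by apply: compact_closedI; [exact: c1H|exact: open_closedC].
have [K0|/set0P K0] := eqVneq K set0.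
  exists c1 => // z Vz; apply: CN; apply: contrapT => Cz.
  by have : K z by []; rewrite K0.
have [z0] := EVT_min_rV K0 cK (continuous_subspaceT V_continuous).
rewrite inE => -[_ Cz0] z0min.
have V0 : 0 < Vfun P eps z0 by apply: Vfun_gt0 => /SC.
exists (Order.min c1 (Vfun P eps z0 / 2)); first by rewrite lt_min c10 divr_gt0.
move=> z /=; rewrite le_min => /andP[Vz1 Vz2]; apply: CN; apply: contrapT => Cz.
have : z \in K by rewrite inE.
by move=> /z0min; lra.
Qed.

End stationarity.

(** * Mean value inequalities and real powers *)

Section real_growth.
Context {R : realType}.
Implicit Types (f df v : R -> R) (a b t : R).

(** Derivatives are taken in the open interval only, since solutions are differentiated at positive
    times and are merely continuous at time 0. *)
Lemma le_incr_derive f df a b (k : R) : a <= b ->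
  {within `[a, b], continuous f} ->
  (forall x, a < x < b -> is_derive x (1 : R) f (df x)) ->
  (forall x, a < x < b -> df x <= k) -> f b - f a <= k * (b - a).
Proof.
rewrite le_eqVlt => /predU1P[->|ab] cf dfx dfk; first by rewrite !subrr mulr0.
have dfx' x : x \in `]a, b[ -> is_derive x (1 : R) f (df x).
  by rewrite in_itv/=; exact: dfx.
have [c + ->] := MVT ab dfx' cf.
by rewrite in_itv/= => /dfk dk; rewrite ler_pM2r// subr_gt0.
Qed.

Lemma ge_incr_derive f df a b (k : R) : a <= b ->
  {within `[a, b], continuous f} ->
  (forall x, a < x < b -> is_derive x (1 : R) f (df x)) ->
  (forall x, a < x < b -> k <= df x) -> k * (b - a) <= f b - f a.
Proof.
rewrite le_eqVlt => /predU1P[->|ab] cf dfx dfk; first by rewrite !subrr mulr0.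
have dfx' x : x \in `]a, b[ -> is_derive x (1 : R) f (df x).
  by rewrite in_itv/=; exact: dfx.
have [c + ->] := MVT ab dfx' cf.
by rewrite in_itv/= => /dfk dk; rewrite ler_pM2r// subr_gt0.
Qed.

Lemma continuous_powR (a e : R) : 0 < a -> {for a, continuous (fun x : R => x `^ e)}.
Proof. by move=> a0; exact: is_derive_continuous (is_derive1_powR e a0). Qed.

Lemma cvg_powR (T : Type) (F : set_system T) (f : T -> R) (a e : R) : Filter F ->
  0 < e -> (forall x, 0 <= f x) -> f x @[x --> F] --> a ->
  f x `^ e @[x --> F] --> a `^ e.
Proof.
move=> FF e0 f0 fa.
have [a0|a0|/esym a_eq0] := ltgtP 0 a.
- exact: (cvg_comp _ _ fa (continuous_powR (e := e) a0)).
(* [F] is not assumed proper: nonnegative values with a negative limit put [set0] into [F], and then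
   everything converges. *)
- have F0 : F set0.
    have := @cvgr_lt _ _ F FF f a fa 0 a0.
    by apply: filterS => x; rewrite ltNge f0.
  by move=> A _; apply: (@filterS _ F FF _ _ _ F0).
rewrite a_eq0 powR0 ?gt_eqF//.
apply/cvgrPdist_le => d d0.
have d'0 : 0 < d `^ e^-1 by exact: powR_gt0.
have := @cvgr_le _ _ F FF f a fa (d `^ e^-1); rewrite a_eq0 => /(_ d'0).
apply: filterS => x fx; rewrite sub0r normrN ger0_norm ?powR_ge0//.
have -> : d = (d `^ e^-1) `^ e by rewrite -powRrM mulVf ?gt_eqF// powRr1// ltW.
by apply: ge0_ler_powR => //; rewrite ?nnegrE ?powR_ge0// ltW.
Qed.

Lemma within_continuous_powR (A : set R) v e : {within A, continuous v} ->
  (forall x, A x -> 0 < v x) -> {within A, continuous (fun x => v x `^ e)}.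
Proof.
move=> /subspace_continuousP cv v0; apply/subspace_continuousP => x Ax.
exact: (cvg_comp _ _ (cv x Ax) (continuous_powR (e := e) (v0 x Ax))).
Qed.

Lemma is_derive_powR_comp v (e t dv : R) : 0 < v t ->
  is_derive t (1 : R) v dv ->
  is_derive t (1 : R) (fun s => v s `^ e) (e * v t `^ (e - 1) * dv).
Proof.
move=> vt dvt.
exact: (@is_derive1_comp _ (fun x => x `^ e) v t _ _ (is_derive1_powR e vt) dvt).
Qed.

Lemma is_derive_mulf f g (t df dg : R) : is_derive t (1 : R) f df ->
  is_derive t (1 : R) g dg ->
  is_derive t (1 : R) (fun s => f s * g s) (f t * dg + g t * df).
Proof. by move=> Hf Hg; exact: (@is_deriveM R R f g t 1 df dg Hf Hg). Qed.

Lemma is_derive_scale (c t : R) : is_derive t (1 : R) (fun s : R => c * s) c.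
Proof.
have := @is_deriveZ R R R id c t 1 1 (is_derive_id t (1 : R)).
by rewrite [c *: 1]mulr1.
Qed.

End real_growth.

(** * The scalar equation for [V] under the four decay laws *)

Section decay_laws.
Context {R : realType}.
Variable l : @decay_law R.
Hypothesis l_adm : admissible l.

Lemma horizon_gt0 : (0 < horizon l)%E.
Proof. by case: l l_adm => //= mu T [_ T0]; rewrite lte_fin. Qed.

Lemma sigma_ge0 (v t : R) : 0 <= v -> (t%:E < horizon l)%E -> 0 <= sigma l v t.
Proof.
case: l l_adm => /= [c0 c00|k g [k0 _ _]|a b g d [a0 b0 _ _ _]|mu T [mu0 T0]] v0 tT.
- by rewrite mulr_ge0// ltW.
- by rewrite mulr_ge0 ?powR_ge0// ltW.
- by rewrite addr_ge0// mulr_ge0 ?powR_ge0// ltW.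
- by rewrite mulr_ge0// divr_ge0 ?ltW// subr_gt0 -lte_fin.
Qed.

Lemma sigma0 (t : R) : sigma l 0 t = 0.
Proof.
case: l l_adm => /= [c0 c00|k g [_ g0 _]|a b g d [_ _ g0 _ d1]|mu T _].
- by rewrite mulr0.
- by rewrite powR0 ?mulr0// gt_eqF.
- by rewrite !powR0 ?mulr0 ?addr0// gt_eqF//; lra.
- by rewrite mulr0.
Qed.

Lemma cvg_sigma (T : Type) (F : set_system T) (f g : T -> R) (v t : R) :
  Filter F -> (forall x, 0 <= f x) -> f x @[x --> F] --> v ->
  g x @[x --> F] --> t -> (t%:E < horizon l)%E ->
  sigma l (f x) (g x) @[x --> F] --> sigma l v t.
Proof.
move=> FF f0 fv gt.
case: l l_adm => /= [c0 c00|k ga [_ g0 _]|a b ga de [_ _ g0 _ d1]|mu T' _] tT.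
- exact: cvgM (cvg_cst _) fv.
- exact: cvgM (cvg_cst _) (cvg_powR _ g0 f0 fv).
- apply: cvgD; first exact: cvgM (cvg_cst _) (cvg_powR _ g0 f0 fv).
  apply: cvgM; first exact: cvg_cst.
  by apply: cvg_powR => //; lra.
- apply: cvgM => //; apply: cvgM; first exact: cvg_cst.
  apply: cvgV; first by rewrite gt_eqF// subr_gt0 -lte_fin.
  exact: cvgB (cvg_cst _) gt.
Qed.

(** The end time [tau] is arbitrary because monotonicity is used for maximal solutions before they
    are known to reach the horizon. *)
Lemma decay_nonincreasing (tau : \bar R) (v : R -> R) : (tau <= horizon l)%E ->
  (forall t, 0 <= v t) -> {within times tau, continuous v} ->
  (forall t, times tau t -> 0 < t ->
    is_derive t (1 : R) v (- sigma l (v t) t)) ->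
  forall s t, 0 <= s -> s <= t -> times tau t -> v t <= v s.
Proof.
move=> tauh v0 cv dv s t s0 st [_ tt].
have tau_lt x : x <= t -> (x%:E < tau)%E.
  by move=> xt; apply: le_lt_trans tt; rewrite lee_fin.
rewrite -subr_le0 -[leRHS](mul0r (t - s)).
apply: (le_incr_derive (f := v) (df := fun x => - sigma l (v x) x)) => //.
- apply: continuous_subspaceW cv => x /=; rewrite in_itv/= => /andP[sx xt].
  by split; [exact: le_trans sx|exact: tau_lt].
- move=> x /andP[sx xt]; have x0 := le_lt_trans s0 sx.
  by apply: dv => //; split; [exact: ltW|exact: tau_lt (ltW xt)].
- move=> x /andP[sx xt]; rewrite oppr_le0 sigma_ge0//.
  by apply: lt_le_trans tauh; exact: tau_lt (ltW xt).
Qed.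

Variable v : R -> R.
Hypothesis v_ge0 : forall t, 0 <= v t.
Hypothesis v_cont : {within times (horizon l), continuous v}.
Hypothesis v_der : forall t, times (horizon l) t -> 0 < t ->
  is_derive t (1 : R) v (- sigma l (v t) t).

Let itv_cont a b : 0 <= a -> times (horizon l) b -> {within `[a, b], continuous v}.
Proof.
move=> a0 [_ bh]; apply: continuous_subspaceW v_cont => x /=.
rewrite in_itv/= => /andP[ax xb]; split; first exact: le_trans ax.
by apply: le_lt_trans bh; rewrite lee_fin.
Qed.

Let itv_times a b x : 0 <= a -> times (horizon l) b -> a < x < b ->
  times (horizon l) x /\ 0 < x.
Proof.
move=> a0 [_ bh] /andP[ax xb]; have x0 := le_lt_trans a0 ax.
split => //; split; first exact: ltW.
by apply: lt_trans bh; rewrite lte_fin.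
Qed.

Let nincr s t : 0 <= s -> s <= t -> times (horizon l) t -> v t <= v s.
Proof. exact: decay_nonincreasing (lexx _) v_ge0 v_cont v_der s t. Qed.

(** Positivity at [b] spreads to the whole interval, as [v] does not increase; so the power is
    differentiable there even for small or negative exponents. *)
Let powR_incr_le e K a b : 0 <= a -> a <= b -> times (horizon l) b -> 0 < v b ->
  (forall x, a < x < b -> 0 < v x -> e * v x `^ (e - 1) * - sigma l (v x) x <= K) ->
  v b `^ e - v a `^ e <= K * (b - a).
Proof.
move=> a0 ab hb vb HK.
have vpos x : a <= x -> x <= b -> 0 < v x.
  by move=> ax xb; apply: lt_le_trans vb _; apply: nincr => //; exact: le_trans ax.
apply: (le_incr_derive (f := fun x => v x `^ e)
  (df := fun x => e * v x `^ (e - 1) * - sigma l (v x) x)) => //.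
- apply: within_continuous_powR; first exact: itv_cont.
  by move=> x /=; rewrite in_itv/= => /andP[ax xb]; exact: vpos.
- move=> x xab; have [hx x0] := itv_times a0 hb xab; apply: is_derive_powR_comp;
  last exact: v_der.
  by move/andP: xab => [ax xb]; apply: vpos; exact: ltW.
- move=> x xab; apply: HK => //.
  by move/andP: xab => [ax xb]; apply: vpos; exact: ltW.
Qed.

(** Each law has its own transform. For [Exp] and [PT], [v] times an integrating factor is constant.
    For [FT], the power [1 - gamma] of [v] falls at the constant rate [k * (1 - gamma)]. For [FxT],
    the [delta] term first brings [v] below 1 from any initial value, then the [gamma] term brings
    it to 0. *)
Lemma decay_timing_holds : decay_timing l v.
Proof.
move: l_adm; case El : l => [c0|k g|a b g d|mu T] /=;
  [move=> c00|move=> [k0 g0 g1]|move=> [a0 b0 g0 g1 d1]|move=> [mu0 T0]].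
- move=> t t0.
  have ht : times (horizon l) t by rewrite El; split => //; exact: ltry.
  pose f s := v s * expR (c0 * s).
  have : f t - f 0 <= 0 * (t - 0).
    apply: (le_incr_derive (f := f) (df := fun=> 0)) => //.
    + apply/subspace_continuousP => x xt; apply: cvgM.
        by have /subspace_continuousP := itv_cont (lexx 0) ht; exact.
      apply: cvg_within_filter.
      have : continuous (fun s : R => expR (c0 * s)).
        move=> y; apply: (@continuous_comp _ _ _ (fun s => c0 * s) expR);
          last exact: continuous_expR.
        exact: mulrl_continuous.
      exact.
    + move=> x xt; have [hx x0] := itv_times (lexx 0) ht xt.
      have := v_der hx x0; rewrite El /= => dv.
      have de : is_derive x (1 : R) (fun s : R => expR (c0 * s)) (expR (c0 * x) * c0).
        exact: (@is_derive1_comp _ expR _ _ _ _ (is_derive_expR _) (is_derive_scale c0 x)).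
      have dvde := is_derive_mulf dv de.
      apply: (is_derive_eq dvde).
      by ring.
  rewrite mul0r /f mulr0 expR0 mulr1 subr_le0 expRN => H.
  by rewrite ler_pdivlMr// expR_gt0.
- have g1' : 0 < 1 - g by lra.
  have D0 : 0 < k * (1 - g) by rewrite mulr_gt0.
  set ts := v 0 `^ (1 - g) / (k * (1 - g)).
  have ts0 : 0 <= ts by rewrite divr_ge0 ?powR_ge0// ltW.
  have hts t : 0 <= t -> times (horizon l) t by move=> t0; rewrite El; split => //;
    exact: ltry.
  (* Otherwise the power [1 - g] of [v] would be differentiable up to [ts] and would have lost its
     whole initial value by then, leaving nothing positive. *)
  have vts : v ts = 0.
    apply/eqP; apply: contrapT => /negP vn0.
    have vts : 0 < v ts by rewrite lt_neqAle eq_sym vn0 v_ge0.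
    have := @powR_incr_le (1 - g) (- (k * (1 - g))) 0 ts (lexx 0) ts0 (hts _ ts0) vts.
    rewrite subr0 mulNr [_ * ts]mulrC /ts divfK ?gt_eqF// -/ts => /(_ _)/wrap[x _ vx|].
      rewrite El/= (_ : 1 - g - 1 = - g); last by ring.
      rewrite powRN mulrN -mulrA [_^-1 * _]mulrCA mulVf ?mulr1;
        last by rewrite gt_eqF// powR_gt0.
      by rewrite mulrC.
    by have := @powR_gt0 _ (v ts) (1 - g) vts; lra.
  exists ts; first by rewrite ts0 lexx.
  move=> t tst; apply/eqP; rewrite eq_le v_ge0 andbT -vts.
  by apply: nincr => //; apply: hts; exact: le_trans tst.
- have g1' : 0 < 1 - g by lra.
  have d1' : 0 < d - 1 by lra.
  (* [T1] is the time allotted to going below 1, and [T2] the time allotted to going from there to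
     0. *)
  set T2 := (a * (1 - g))^-1; set T1 := (b * (d - 1))^-1.
  have T10 : 0 < T1 by rewrite invr_gt0 mulr_gt0.
  have T20 : 0 < T2 by rewrite invr_gt0 mulr_gt0.
  have hts t : 0 <= t -> times (horizon l) t by move=> t0; rewrite El; split => //;
    exact: ltry.
  have T0 : 0 <= T2 + T1 by rewrite addr_ge0// ltW.
  have vT : v (T2 + T1) = 0.
    apply/eqP; apply: contrapT => /negP vn0.
    have vT : 0 < v (T2 + T1) by rewrite lt_neqAle eq_sym vn0 v_ge0.
    have vT1 : 0 < v T1.
      by apply: lt_le_trans vT _; apply: nincr; [exact: ltW|lra|exact: hts].
    have v0 : 0 < v 0.
      by apply: lt_le_trans vT1 _; apply: nincr => //; [exact: ltW|apply: hts; exact: ltW].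
    (* The power [1 - d] of [v], of negative exponent, grows at least at the rate [b * (d - 1)], so
       it exceeds 1 at [T1] whatever [v 0] is; hence [v T1 <= 1]. *)
    have vT1_lt1 : v T1 `^ (1 - g) <= 1.
      have H : (b * (d - 1)) * (T1 - 0) <= v T1 `^ (1 - d) - v 0 `^ (1 - d).
        apply: (ge_incr_derive (f := fun x => v x `^ (1 - d))
          (df := fun x => (1 - d) * v x `^ (1 - d - 1) * - sigma l (v x) x)) => //.
        + exact: ltW.
        + apply: within_continuous_powR; first by apply: itv_cont => //; apply: hts;
          exact: ltW.
          move=> x /=; rewrite in_itv/= => /andP[x0 xT]; apply: lt_le_trans vT1 _.
          by apply: nincr => //; apply: hts; exact: ltW.
        + move=> x /andP[x0 xT]; apply: is_derive_powR_comp; last by apply: v_der => //;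
          apply: hts; exact: ltW.
          by apply: lt_le_trans vT1 _; apply: nincr; [exact: ltW|exact: ltW|apply: hts;
            exact: ltW].
        + move=> x /andP[x0 xT].
          have vx : 0 < v x by apply: lt_le_trans vT1 _; apply: nincr;
            [exact: ltW|exact: ltW|apply: hts; exact: ltW].
          rewrite El/= (_ : 1 - d - 1 = - d); last by ring.
          rewrite powRN; have pd := powR_gt0 d vx; have pg := powR_gt0 g vx.
          have -> : (1 - d) * (v x `^ d)^-1 * - (a * v x `^ g + b * v x `^ d) =
             b * (d - 1) + (d - 1) * a * (v x `^ g / v x `^ d).
            by field; rewrite gt_eqF.
          by rewrite lerDl !mulr_ge0 ?invr_ge0// ?(ltW a0)// ?(ltW pd)// ?(ltW pg)// (ltW d1').
      rewrite subr0 /T1 divff ?gt_eqF ?mulr_gt0// -/T1 in H.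
      have H1 : 1 < v T1 `^ (1 - d) by have := powR_gt0 (1 - d) v0; lra.
      have vT1' : v T1 <= 1.
        rewrite leNgt; apply/negP => v1.
        have := @ler_powR _ (v T1) (ltW v1) (1 - d) 0; rewrite powRr0 => H2.
        by have := H2 (ltac:(lra)); lra.
      have p1 : (1 : R) `^ (1 - g) = 1 by rewrite powR1.
      rewrite -[leRHS]p1; apply: ge0_ler_powR; rewrite ?nnegrE//; exact: ltW.
    have := @powR_incr_le (1 - g) (- (a * (1 - g))) T1 (T2 + T1) (ltW T10) (ltac:(lra)) (hts _ T0) vT.
    rewrite addrK mulNr /T2 divff ?gt_eqF ?mulr_gt0// -/T2 => /(_ _)/wrap[x _ vx|].
      rewrite El/= (_ : 1 - g - 1 = - g); last by ring.
      rewrite powRN; have pd := powR_gt0 d vx; have pg := powR_gt0 g vx.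
      have -> : (1 - g) * (v x `^ g)^-1 * - (a * v x `^ g + b * v x `^ d) =
         - (a * (1 - g)) - (1 - g) * b * (v x `^ d / v x `^ g).
        by field; rewrite gt_eqF.
      by rewrite gerDl oppr_le0 !mulr_ge0 ?invr_ge0// ?(ltW b0)// ?(ltW pd)// ?(ltW pg)// (ltW g1').
    by have := @powR_gt0 _ (v (T2 + T1)) (1 - g) vT; lra.
  exists (T2 + T1); first by rewrite T0 lexx.
  move=> t tst; apply/eqP; rewrite eq_le v_ge0 andbT -vT.
  by apply: nincr => //; apply: hts; exact: le_trans tst.
- pose f s := v s * (T - s) `^ (- mu).
  have ht t : 0 <= t -> t < T -> times (horizon l) t by move=> t0 tT; rewrite El;
    split => //=; rewrite lte_fin.
  have fE t : 0 <= t -> t < T -> f t = f 0.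
    move=> t0 tT; apply/eqP; rewrite -subr_eq0 eq_le.
    have cf : {within `[0, t], continuous f}.
      apply/subspace_continuousP => x xt; apply: cvgM.
        by have /subspace_continuousP := itv_cont (lexx 0) (ht _ t0 tT); exact.
      apply: cvg_within_filter.
      have x_lt : x < T by move: xt; rewrite /= in_itv/= => /andP[_ xt];
        exact: le_lt_trans tT.
      have Tx0 : 0 < T - x by rewrite subr_gt0.
      have cTx : {for x, continuous (fun s : R => T - s)} by apply: cvgB;
        [exact: cvg_cst|exact: cvg_id].
      exact: (cvg_comp _ _ cTx (continuous_powR (e := - mu) Tx0)).
    have df x : 0 < x < t -> is_derive x (1 : R) f 0.
      move=> /andP[x0 xt].
      have xT : x < T by exact: lt_trans tT.
      have Tx0 : 0 < T - x by rewrite subr_gt0.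
      have := v_der (ht _ (ltW x0) xT) x0; rewrite El/= => dv.
      have dTx : is_derive x (1 : R) (fun s : R => T - s) (-1).
        have := @is_deriveB R R R (cst T) id x 1 0 1 (is_derive_cst T x (1 : R)) (is_derive_id x (1 : R)).
        by rewrite sub0r.
      have dp := @is_derive_powR_comp R (fun s => T - s) (- mu) x (-1) Tx0 dTx.
      have dvdp := is_derive_mulf dv dp.
      apply: (is_derive_eq dvdp).
      rewrite powRB; last by apply/implyP => _; rewrite gt_eqF.
      by rewrite powRr1 ?(ltW Tx0)//; field; rewrite gt_eqF.
    apply/andP; split.
      by have := le_incr_derive (k := 0) t0 cf df (fun x _ => lexx 0); rewrite mul0r.
    by have := ge_incr_derive (k := 0) t0 cf df (fun x _ => lexx 0); rewrite mul0r.
  have vE t : 0 <= t -> t < T -> v t = f 0 * (T - t) `^ mu.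
    move=> t0 tT; rewrite -(fE t)// /f -mulrA -powRD ?addNr ?powRr0 ?mulr1//.
    by rewrite eqxx/= gt_eqF// subr_gt0.
  split.
    have c1 : `|T - t| @[t --> T^'-] --> `|T - T|.
      apply: cvg_norm; apply: cvgB; first exact: cvg_cst.
      by apply: (@cvg_within_filter _ _ _ (nbhs T)); exact: cvg_id.
    have c2 : `|T - t| `^ mu @[t --> T^'-] --> `|T - T| `^ mu by exact: cvg_powR.
    rewrite subrr normr0 powR0 ?gt_eqF// in c2.
    have E : f 0 * `|T - t| `^ mu @[t --> T^'-] --> f 0 * 0.
      by apply: cvgM => //; exact: cvg_cst.
    rewrite mulr0 in E; apply: cvg_trans E; apply: near_eq_cvg; near=> t.
    have tT : t < T by near: t; exact: nbhs_left_lt.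
    rewrite vE//; last by near: t; exact: nbhs_left_ge.
    by rewrite gtr0_norm// subr_gt0.
  move=> v0 t /andP[t0 tT]; rewrite vE// mulr_gt0 ?powR_gt0 ?subr_gt0//.
  by rewrite /f mulr_gt0// powR_gt0// subr0.
Unshelve. all: by end_near. Qed.

Lemma decay_cvg0 : v t @[t --> to_horizon l] --> 0.
Proof.
move: decay_timing_holds l_adm.
case El : l => [c0|k g|a b g d|mu T] /=.
- move=> H c00; apply/cvgrPdist_le => e e0.
  have c1 : v 0 * expR (- (c0 * t)) @[t --> +oo] --> v 0 * 0.
    apply: cvgM; first exact: cvg_cst.
    have cy : c0 * t @[t --> +oo] --> +oo.
      apply/cvgryPge => B; by near=> t; rewrite mulrC -ler_pdivrMr.
    exact: (cvg_comp _ _ cy (@cvgr_expR R)).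
  rewrite mulr0 in c1.
  have c2 : \forall t \near +oo, v 0 * expR (- (c0 * t)) <= e.
    exact: (cvgr_le _ c1).
  near=> t; rewrite sub0r normrN ger0_norm//; apply: le_trans (H t _) _.
    by near: t; apply: nbhs_pinfty_ge; exact: num_real.
  by near: t.
- move=> [ts _ H] _; apply/cvgrPdist_le => e e0; near=> t.
  by rewrite H ?subrr ?normr0 ?(ltW e0).
- move=> [ts _ H] _; apply/cvgrPdist_le => e e0; near=> t.
  by rewrite H ?subrr ?normr0 ?(ltW e0).
- by case.
Unshelve. all: by end_near. Qed.

End decay_laws.

(** * [V] along solutions, and limits at a finite end time *)

Section trajectories.
Context {R : realType} {nx ny p q : nat}.
Variables (P : minimax_problem R nx ny p q) (eps : R).
Hypothesis eps_gt0 : 0 < eps.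
Hypothesis G_smooth : twice_differentiable (ineq P).
Hypothesis J_C2 : C2 (obj P).
Hypothesis V_C1 : C1 (Vfun P eps).
Variable l : @decay_law R.
Hypothesis l_adm : admissible l.

Local Notation state := 'rV[R]_((nx + ny) + (p + q)).
Local Notation V := (Vfun P eps).
Local Notation Z := (Sset P eps).
Local Notation desc := (descent P eps).
Local Notation vf := (vfield P eps l).
Local Notation sol := (solution_on P eps l).

Let V_cont : continuous V.
Proof. by have [dV _] := V_C1; move=> z; exact: differentiable_continuous. Qed.

Let gradV z : grad V z = desc z.
Proof. exact: grad_Vfun. Qed.

Let desc_cont : continuous desc.
Proof.
have [_ cg] := V_C1.
by rewrite (_ : desc = grad V) //; apply/funext => z; rewrite gradV.
Qed.

Let V_ge0 z : 0 <= V z. Proof. exact: Vfun_ge0. Qed.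

Lemma near_lt_ereal (tau : \bar R) (t : R) : (t%:E < tau)%E ->
  \forall x \near t, (x%:E < tau)%E.
Proof.
case: tau => [r||] //; rewrite ?lte_fin => tr.
  by near=> x; rewrite lte_fin; near: x; exact: lt_nbhsl.
by near=> x; exact: ltry.
Unshelve. all: by end_near. Qed.

Lemma near_times (tau : \bar R) (t : R) : times tau t -> 0 < t ->
  \forall x \near t, times tau x.
Proof.
move=> [_ tt] t0; near=> x; split; last by near: x; exact: near_lt_ereal.
by apply: ltW; near: x; exact: lt_nbhsr.
Unshelve. all: by end_near. Qed.

Lemma cvg_vfield (T : Type) (F : set_system T) (f : T -> state) (g : T -> R)
    (z : state) (t : R) : Filter F -> f x @[x --> F] --> z ->
  g x @[x --> F] --> t -> (t%:E < horizon l)%E -> desc z != 0 ->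
  vf (f x) (g x) @[x --> F] --> vf z t.
Proof.
move=> FF fz gt th dz.
have cd : desc (f x) @[x --> F] --> desc z by exact: cvg_continuous_comp.
have cV : V (f x) @[x --> F] --> V z by exact: cvg_continuous_comp.
have n0 : enorm (desc z) ^+ 2 != 0 by rewrite enorm_sqr dotvv_eq0.
have ce : enorm (desc (f x)) ^+ 2 @[x --> F] --> enorm (desc z) ^+ 2.
  rewrite (_ : (fun x => enorm (desc (f x)) ^+ 2) =
      fun x => dot (desc (f x)) (desc (f x))); last first.
    by apply/funext => x; rewrite enorm_sqr.
  by rewrite enorm_sqr; exact: cvg_dot.
have cs : sigma l (V (f x)) (g x) @[x --> F] --> sigma l (V z) t.
  exact: cvg_sigma.
exact: cvgZ (cvgN (cvgM cs (cvgV n0 ce))) cd.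
Qed.

Section solution.
Variables (tau : \bar R) (z : R -> state).
Hypotheses (tau_le : (tau <= horizon l)%E) (solz : sol tau z).

Lemma solution_within t : times tau t ->
  z x @[x --> within (times tau) (nbhs t)] --> z t.
Proof. by have [/subspace_continuousP cz _ _ _] := solz; exact: cz. Qed.

Lemma solution_continuous t : times tau t -> 0 < t -> z x @[x --> t] --> z t.
Proof.
move=> ht t0; have := solution_within ht.
by rewrite within_interior//; exact: near_times.
Qed.

Lemma solution_V_within : {within times tau, continuous (fun t => V (z t))}.
Proof.
apply/subspace_continuousP => t ht.
exact: cvg_continuous_comp (solution_within ht) V_cont.
Qed.

(** In the chain rule the product of the gradient with [descent] is the squared norm by which the
    field is divided, so exactly [- sigma] remains. *)
Let derive_out t : times tau t -> 0 < t -> ~ Z (z t) ->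
  is_derive t (1 : R) (fun t => V (z t)) (- sigma l (V (z t)) t).
Proof.
move=> ht t0 nZ; have [_ dne dz _] := solz; have [dV _] := V_C1.
have d0 := dne _ ht nZ.
have dVz := is_derive_comp_grad (dV (z t)) (dz _ ht t0 nZ).
apply: (is_derive_eq dVz).
by rewrite gradV /vfield dotZr enorm_sqr mulNr divfK// dotvv_eq0.
Qed.

(* At the time when the solution hits [Sset], the derivative is obtained as
   the limit of the derivatives at neighbouring times. *)
Lemma solution_V_derive t : times tau t -> 0 < t ->
  is_derive t (1 : R) (fun t => V (z t)) (- sigma l (V (z t)) t).
Proof.
move=> ht t0; have [|Zt] := pselect (~ Z (z t)); first exact: derive_out.
move: Zt => /contrapT Zt; have [_ _ _ rest] := solz.
have V0 x : Z x -> V x = 0 by move/(Vfun_eq0 P eps).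
have derive0 x s : 0 <= s -> s < x -> Z (z s) -> times tau x ->
    is_derive x (1 : R) (fun t => V (z t)) (- sigma l (V (z x)) x).
  move=> s0 sx Zs hx.
  have -> : V (z x) = 0 by rewrite (rest s x)// ?s0 ?(ltW sx)// V0.
  rewrite sigma0// oppr0.
  apply: (@near_eq_is_derive R R R (cst 0) (fun t => V (z t)) x 1 0).
  have near_x : \forall y \near x, times tau y by apply: near_times => //;
    exact: le_lt_trans sx.
  near=> y; rewrite (rest s y) ?V0// ?s0/=.
    by near: y.
  by apply: ltW; near: y; exact: lt_nbhsr.
(* If [Sset] was reached before [t], the solution is at rest around [t]. Otherwise [t] is the first
   time of arrival: just before [t] the law holds off [Sset], just after [t] the solution rests, and
   both derivatives tend to 0. *)
have [[s [s0 st Zs]]|nos] := pselect (exists s, [/\ 0 <= s, s < t & Z (z s)]).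
  exact: derive0 Zs ht.
have cV : V (z x) @[x --> t] --> V (z t).
  exact: cvg_continuous_comp (solution_continuous ht t0) V_cont.
apply: (@is_derive_punctured _ _ (fun s => - sigma l (V (z s)) s)).
- exact: cV.
- near=> s.
  have hs : times tau s.
    by near: s; apply: nbhs_dnbhs; exact: near_times.
  have s0 : 0 < s by near: s; apply: nbhs_dnbhs; exact: lt_nbhsr.
  have st : s != t by near: s; exact: nbhs_dnbhs_neq.
  have [lts|gts|/eqP] := ltgtP s t; last by rewrite (negbTE st).
    by apply: derive_out => // Zs; apply: nos; exists s; rewrite (ltW s0).
  exact: (derive0 _ t (ltW t0)).
- apply: cvgN; apply: cvg_sigma => //; last by case: ht => _ /lt_le_trans; apply.
    by apply: (@cvg_within_filter _ _ _ (nbhs t)); exact: cV.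
  by apply: cvg_within_filter; exact: cvg_id.
Unshelve. all: by end_near. Qed.

Lemma solution_V_nonincreasing s t : 0 <= s -> s <= t -> times tau t ->
  V (z t) <= V (z s).
Proof.
move: s t; apply: (decay_nonincreasing l_adm tau_le (v := fun t => V (z t))).
- by move=> t; exact: V_ge0.
- exact: solution_V_within.
- exact: solution_V_derive.
Qed.

End solution.

(* The Lojasiewicz inequality makes [z_i + C V(z)^(1 - alpha)] monotone, so
   that a solution has a limit at a finite end time. *)
Lemma solution_limit (t1 cL alpha r : R) (z : R -> state) :
  0 < t1 -> (t1%:E <= horizon l)%E -> sol t1%:E z -> 0 < cL -> 0 <= alpha < 1 ->
  (forall t, times t1%:E t -> cL * V (z t) `^ alpha <= enorm (grad V (z t))) ->
  (forall t, times t1%:E t -> `|z t| <= r) ->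
  exists zl : state, z t @[t --> t1^'-] --> zl.
Proof.
move=> t10 t1h solz cL0 /andP[a0 a1] loj zr.
have [_ dne dz rest] := solz.
have ht t : 0 < t -> t < t1 -> times t1%:E t.
  by move=> t0 tt1; split; [exact: ltW|rewrite lte_fin].
have [[s [hs Zs]]|nos] := pselect (exists s, times t1%:E s /\ Z (z s)).
  have [s0] := hs; rewrite lte_fin => st1.
  exists (z s); apply: cvg_near_cst; near=> t.
  apply: rest => //.
    apply: ht; last by near: t; exact: nbhs_left_lt.
    by near: t; exact: nbhs_left_gt.
  by rewrite s0/=; near: t; exact: nbhs_left_ge.
have nZ t : 0 < t -> t < t1 -> ~ Z (z t).
  by move=> t0 tt1 Zt; apply: nos; exists t; split => //; exact: ht.
pose v t := V (z t).
have v_gt0 t : 0 < t -> t < t1 -> 0 < v t.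
  by move=> t0 tt1; apply: Vfun_gt0; exact: nZ.
have a1' : 0 < 1 - alpha by lra.
(* With this constant the speed of each coordinate, at most [sigma] over the gradient norm, is at
   most [C] times the derivative of minus the power [1 - alpha] of [v]. *)
pose C := (cL * (1 - alpha))^-1.
have C0 : 0 < C by rewrite invr_gt0 mulr_gt0.
have dv t : 0 < t -> t < t1 -> is_derive t (1 : R) v (- sigma l (v t) t).
  by move=> t0 tt1; apply: (solution_V_derive t1h solz); [exact: ht|].
have sig0 t : 0 < t -> t < t1 -> 0 <= sigma l (v t) t.
  move=> t0 tt1; apply: sigma_ge0 => //; first exact: V_ge0.
  by apply: lt_le_trans t1h; rewrite lte_fin.
have cvg_left (g dg : R -> R) (B : R) :
    (forall t, 0 < t -> t < t1 -> is_derive t (1 : R) g (dg t)) ->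
    (forall t, 0 < t -> t < t1 -> 0 <= dg t) ->
    (forall t, 0 < t -> t < t1 -> g t <= B) -> cvg (g t @[t --> t1^'-]).
  move=> gd dg0 gB; apply: nondecreasing_at_left_is_cvgr.
    near=> x.
    have x0 : 0 < x by near: x; exact: nbhs_left_gt.
    move=> s t; rewrite !in_itv/= => /andP[xs st1] /andP[xt tt1] st.
    have s0 := lt_trans x0 xs.
    rewrite -subr_ge0 -[leLHS](mul0r (t - s)).
    apply: (ge_incr_derive (f := g) (df := dg)) => //.
    - apply: continuous_in_subspaceT => y; rewrite inE/= in_itv/= => /andP[sy yt].
      apply: is_derive_continuous (gd y _ _);
        [exact: lt_le_trans sy|exact: le_lt_trans tt1].
    - by move=> y /andP[sy yt]; apply: gd; [exact: lt_trans sy|exact: lt_trans tt1].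
    - by move=> y /andP[sy yt]; apply: dg0; [exact: lt_trans sy|exact: lt_trans tt1].
  near=> x; exists B => _ [y /= + <-]; rewrite in_itv/= => /andP[xy yt1]; apply: gB => //.
  by apply: lt_trans xy; near: x; exact: nbhs_left_gt.
have dpow t : 0 < t -> t < t1 -> is_derive t (1 : R) (fun s => - (v s `^ (1 - alpha)))
    ((1 - alpha) * (sigma l (v t) t / v t `^ alpha)).
  move=> t0 tt1.
  have := @is_derive_powR_comp _ v (1 - alpha) t _ (v_gt0 _ t0 tt1) (dv _ t0 tt1).
  move=> /is_deriveN/is_derive_eq; apply.
  rewrite (_ : 1 - alpha - 1 = - alpha); last by ring.
  by rewrite powRN; have := powR_gt0 alpha (v_gt0 _ t0 tt1) => /lt0r_neq0 ?; field.
have dpow0 t : 0 < t -> t < t1 -> 0 <= (1 - alpha) * (sigma l (v t) t / v t `^ alpha).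
  move=> t0 tt1; rewrite mulr_ge0 ?(ltW a1')// divr_ge0 ?powR_ge0//; exact: sig0.
have /cvg_ex[L hL] : cvg (- (v t `^ (1 - alpha)) @[t --> t1^'-]).
  by apply: (@cvg_left _ _ 0 dpow dpow0) => t _ _; rewrite oppr_le0 powR_ge0.
have coord i : cvg (z t ord0 i @[t --> t1^'-]).
  pose d t := desc (z t).
  have dzi t : 0 < t -> t < t1 -> is_derive t (1 : R) (fun s => z s ord0 i) (vf (z t) t ord0 i).
    move=> t0 tt1; apply: (is_derive_rV z t _).1.
    by apply: dz => //; [exact: ht|exact: nZ].
  have vfi t : 0 < t -> t < t1 ->
      `|vf (z t) t ord0 i| <= C * ((1 - alpha) * (sigma l (v t) t / v t `^ alpha)).
    move=> t0 tt1; have dn0 := dne _ (ht _ t0 tt1) (nZ _ t0 tt1).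
    have e0 : 0 < enorm (d t).
      rewrite lt_neqAle sqrtr_ge0 andbT eq_sym -sqrf_eq0 enorm_sqr dotvv_eq0//.
    have va := powR_gt0 alpha (v_gt0 _ t0 tt1).
    have lo : cL * v t `^ alpha <= enorm (d t) by have := loj _ (ht _ t0 tt1);
      rewrite gradV.
    rewrite /vfield mxE normrM normrN normrM (ger0_norm (sig0 _ t0 tt1)).
    rewrite -/(v t) -/(d t) ger0_norm ?invr_ge0 ?sqr_ge0//.
    have -> : C * ((1 - alpha) * (sigma l (v t) t / v t `^ alpha)) =
        sigma l (v t) t / (cL * v t `^ alpha).
      by rewrite /C; field; rewrite !gt_eqF.
    rewrite -mulrA ler_wpM2l ?sig0//.
    apply: (@le_trans _ _ (enorm (d t))^-1); last by rewrite lef_pV2 ?posrE// mulr_gt0.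
    rewrite mulrC ler_pdivrMr ?exprn_gt0// expr2 mulrA mulVf ?mul1r ?gt_eqF//.
    exact: coord_enorm_le.
  pose g t := C * - (v t `^ (1 - alpha)) - z t ord0 i.
  have /cvg_ex[L' hL'] : cvg (g t @[t --> t1^'-]).
    apply: (@cvg_left g (fun t =>
      C * ((1 - alpha) * (sigma l (v t) t / v t `^ alpha)) - vf (z t) t ord0 i) r).
    - move=> t t0 tt1.
      have d1 := is_derive_mulf (is_derive_cst C t (1 : R)) (dpow t t0 tt1).
      have d2 := @is_deriveB R R R _ _ t 1 _ _ d1 (dzi t t0 tt1).
      by apply: (is_derive_eq d2); rewrite mulr0 addr0.
    - by move=> t t0 tt1; rewrite subr_ge0 (le_trans (ler_norm _))// vfi.
    - move=> t t0 tt1; rewrite /g.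
      have h1 := coord_norm_le (z t) i; have h2 := zr _ (ht _ t0 tt1).
      have h3 := ler_norm (- z t ord0 i); rewrite normrN in h3.
      have h4 : 0 <= C * v t `^ (1 - alpha) by rewrite mulr_ge0 ?powR_ge0// ltW.
      by rewrite mulrN; lra.
  have E : (fun t => z t ord0 i) = (fun t => C * - (v t `^ (1 - alpha)) - g t).
    by apply/funext => t; rewrite /g; ring.
  rewrite E; apply/cvg_ex; exists (C * L - L').
  by apply: cvgB => //; apply: cvgM => //; exact: cvg_cst.
exists (\row_i lim (z t ord0 i @[t --> t1^'-])); apply: cvg_rV => i.
by rewrite mxE; exact: coord.
Unshelve. all: by end_near. Qed.

End trajectories.

(** * Local existence, continuation and maximal solutions *)

Section flow.
Context {R : realType} {nx ny p q : nat}.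
Variables (P : minimax_problem R nx ny p q) (eps : R).
Hypothesis eps_gt0 : 0 < eps.
Hypothesis G_smooth : twice_differentiable (ineq P).
Hypothesis J_C2 : C2 (obj P).
Hypothesis V_C1 : C1 (Vfun P eps).
Variable l : @decay_law R.
Hypothesis l_adm : admissible l.

Local Notation state := 'rV[R]_((nx + ny) + (p + q)).
Local Notation V := (Vfun P eps).
Local Notation Z := (Sset P eps).
Local Notation desc := (descent P eps).
Local Notation vf := (vfield P eps l).
Local Notation sol := (solution_on P eps l).

Let V_cont : continuous V.
Proof. by have [dV _] := V_C1; move=> z; exact: differentiable_continuous. Qed.

Let gradV z : grad V z = desc z.
Proof. exact: grad_Vfun. Qed.

Let desc_cont : continuous desc.
Proof.
have [_ cg] := V_C1.
by rewrite (_ : desc = grad V) //; apply/funext => z; rewrite gradV.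
Qed.

(** [peano] needs a globally bounded field, so [vfield] is set to 0 outside a box where it is
    bounded by [M] and where [V] and [descent] do not vanish. Until [t1 + h] the solution stays in
    the box, where the cut-off has no effect; its Lipschitz bound holds at all later times. *)
Lemma local_solution (t1 : R) (z1 : state) : (t1%:E < horizon l)%E ->
  ~ Z z1 -> desc z1 != 0 ->
  exists (h : R) (y : R -> state) (M : R),
    [/\ 0 < h /\ ((t1 + h)%:E <= horizon l)%E, y t1 = z1,
      forall s t, t1 <= s -> s <= t -> `|y t - y s| <= M * (t - s),
      forall t, t1 <= t -> t < t1 + h -> ~ Z (y t) /\ desc (y t) != 0 &
      forall t, t1 < t -> t < t1 + h -> is_derive t (1 : R) y (vf (y t) t)].
Proof.
move=> t1h nZ1 d1.
pose M := `|vf z1 t1| + 1.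
have M0 : 0 < M by rewrite ltr_wpDl.
have c1 : p.1 @[p --> (t1, z1)] --> t1 by exact: cvg_fst.
have c2 : p.2 @[p --> (t1, z1)] --> z1 by exact: cvg_snd.
have cvf : vf p.2 p.1 @[p --> (t1, z1)] --> vf z1 t1 by exact: cvg_vfield.
have n1 : \forall p \near (t1, z1), (p.1%:E < horizon l)%E.
  exact: (c1 _ (near_lt_ereal t1h)).
have n2 : \forall p \near (t1, z1), 0 < V p.2.
  by apply: (cvgr_gt _ (cvg_continuous_comp c2 V_cont)); exact: Vfun_gt0.
have n3 : \forall p \near (t1, z1), 0 < dot (desc p.2) (desc p.2).
  have cd := cvg_continuous_comp c2 desc_cont.
  apply: (cvgr_gt _ (cvg_dot _ cd cd)).
  by rewrite lt_neqAle dotvv_ge0 andbT eq_sym dotvv_eq0.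
have n4 : \forall p \near (t1, z1), `|vf p.2 p.1| <= M.
  by apply: (cvgr_le _ (cvg_norm cvf)); rewrite ltrDl.
have [d /= d0 dH] : exists2 d : R, 0 < d & forall s x, `|s - t1| < d -> `|x - z1| < d ->
    [/\ (s%:E < horizon l)%E, 0 < V x, 0 < dot (desc x) (desc x) & `|vf x s| <= M].
  have : nbhs (t1, z1) [set p : R * state | (p.1%:E < horizon l)%E /\
      0 < V p.2 /\ 0 < dot (desc p.2) (desc p.2) /\ `|vf p.2 p.1| <= M].
    exact: (filterI n1 (filterI n2 (filterI n3 n4))).
  move=> /nbhs_ballP[d /= d0 H].
  exists d => // s x sd xd.
  have [|a1 [a2 [a3 a4]]] := H (s, x); last by split.
  split => /=; first by rewrite /ball/= distrC.
  by rewrite -ball_normE/= distrC.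
pose f (t : R) (x : state) := if (`|t - t1| < d) && (`|x - z1| < d) then vf x t else 0.
have fM t x : `|f t x| <= M.
  rewrite /f; case: ifPn => [/andP[td xd]|_]; first by have [] := dH _ _ td xd.
  by rewrite normr0 ltW.
have fvf t (x : state) : `|t - t1| < d -> `|x - z1| < d -> f t x = vf x t.
  by move=> td xd; rewrite /f td xd.
have [y [y1 ylip yder]] := peano z1 t1 fM.
(* Ensures both [h < d] and [M * h < d], so neither time nor state leaves the box. *)
pose h := d / (M + 1) / 2.
have M1 : 0 < M + 1 by lra.
have h0 : 0 < h by rewrite !divr_gt0.
have M1n : M + 1 != 0 by rewrite gt_eqF.
have hd : h * 2 * (M + 1) = d by rewrite /h; field.
have hd1 : h < d by rewrite -hd; nra.
have near_y t : t1 <= t -> t < t1 + h -> `|t - t1| < d /\ `|y t - z1| < d.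
  move=> tt1 tth; split; first by rewrite ger0_norm ?subr_ge0//; lra.
  apply: le_lt_trans (_ : M * (t - t1) < d); first by rewrite -y1; exact: ylip.
  by rewrite -hd; nra.
exists h, y, M; split; [|exact: y1|exact: ylip| |].
- split => //; apply: ltW.
  have [] // := dH (t1 + h) z1; rewrite ?subrr ?normr0//.
  by rewrite addrAC subrr add0r gtr0_norm.
- move=> t tt1 tth; have [a1 a2] := near_y _ tt1 tth.
  have [_ Vy dy _] := dH _ _ a1 a2; split.
    by move=> /(Vfun_eq0 P eps) V0; move: Vy; rewrite V0 ltxx.
  by apply/eqP => d0'; move: dy; rewrite d0' dot0r ltxx.
- move=> t tt1 tth; have [a1 a2] := near_y _ (ltW tt1) tth.
  have [th Vy dy _] := dH _ _ a1 a2.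
  have fE : f t (y t) = vf (y t) t by exact: fvf.
  suff cf : f p.1 p.2 @[p --> (t, y t)] --> f t (y t) by rewrite -fE; exact: yder tt1 cf.
  rewrite fE.
  have b1 : p.1 @[p --> (t, y t)] --> t by exact: cvg_fst.
  have b2 : p.2 @[p --> (t, y t)] --> y t by exact: cvg_snd.
  have cy : vf p.2 p.1 @[p --> (t, y t)] --> vf (y t) t.
    have dyn : desc (y t) != 0 by rewrite -dotvv_eq0 gt_eqF.
    exact: cvg_vfield.
  have nf : nbhs (t, y t) [set p : R * state | `|p.1 - t1| < d /\ `|p.2 - z1| < d].
    apply: filterI.
      exact: (cvgr_lt _ (cvg_norm (cvgB b1 (cvg_cst t1)))).
    exact: (cvgr_lt _ (cvg_norm (cvgB b2 (cvg_cst z1)))).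
  apply: cvg_trans cy; apply: near_eq_cvg.
  apply: (@filterS _ (nbhs (t, y t)) _ _ _ _ nf) => -[s x] /= [sd xd].
  exact: esym (fvf s x sd xd).
Qed.

Lemma start_solution (h : R) (y : R -> state) (M : R) : 0 < h ->
  (forall s t, 0 <= s -> s <= t -> `|y t - y s| <= M * (t - s)) ->
  (forall t, 0 <= t -> t < h -> ~ Z (y t) /\ desc (y t) != 0) ->
  (forall t, 0 < t -> t < h -> is_derive t (1 : R) y (vf (y t) t)) ->
  sol h%:E y.
Proof.
move=> h0 ylip ynd yder; split.
- apply: within_continuousP => t ht.
  apply: (lipschitz_within (y := y) (M := M)) => // s x [s0 _] [x0 _] sx; exact: ylip.
- by move=> t [t0]; rewrite lte_fin => th _; have [] := ynd _ t0 th.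
- by move=> t [_]; rewrite lte_fin => th t0 _; exact: yder.
- move=> s t [t0]; rewrite lte_fin => th /andP[s0 st] Zs.
  by have [] := ynd s s0 (le_lt_trans st th).
Qed.

(** Stated so as to cover both continuations at once: [y] a local solution, or [y] constantly a
    point of [Sset], which is why its conditions on derivatives are restricted to states outside
    [Sset]. *)
Lemma glue_solution (t1 M : R) (tau2 : \bar R) (z y : R -> state) :
  0 < t1 -> (t1%:E < tau2)%E -> (tau2 <= horizon l)%E -> sol t1%:E z ->
  z t @[t --> t1^'-] --> y t1 ->
  (forall s t, t1 <= s -> s <= t -> `|y t - y s| <= M * (t - s)) ->
  (forall t, t1 <= t -> (t%:E < tau2)%E -> ~ Z (y t) -> desc (y t) != 0) ->
  (forall t, t1 < t -> (t%:E < tau2)%E -> ~ Z (y t) ->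
    is_derive t (1 : R) y (vf (y t) t)) ->
  (forall s t, t1 <= s -> s <= t -> (t%:E < tau2)%E -> Z (y s) -> y t = y s) ->
  sol tau2 (fun t => if t < t1 then z t else y t).
Proof.
move=> t10 t12 tau2h solz zy ylip ynd yder yrest.
have [_ znd zder zrest] := solz.
pose w t := if t < t1 then z t else y t.
have wl t : t < t1 -> w t = z t by rewrite /w => ->.
have wr t : t1 <= t -> w t = y t by rewrite /w ltNge => ->.
have htz t : 0 <= t -> t < t1 -> times t1%:E t by move=> *; split => //; rewrite lte_fin.
have nwz t : t < t1 -> \forall x \near t, z x = w x.
  by move=> tt1; near=> x; rewrite wl//; near: x; exact: lt_nbhsl.
have nwy t : t1 < t -> \forall x \near t, y x = w x.
  by move=> tt1; near=> x; rewrite wr//; apply: ltW; near: x; exact: lt_nbhsr.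
have ywithin t : t1 <= t -> y x @[x --> within [set x | t1 <= x] (nbhs t)] --> y t.
  move=> tt1; apply: (lipschitz_within (y := y) (M := M)) => // s x s0 x0 sx; exact: ylip.
have cw1 : w x @[x --> t1] --> w t1.
  rewrite wr//; apply/cvgrPdist_le => e e0.
  have nl : nbhs t1 [set x | x < t1 -> `|y t1 - z x| <= e].
    by move/cvgrPdist_le : zy => /(_ e e0).
  have nr : nbhs t1 [set x | t1 <= x -> `|y t1 - y x| <= e].
    by have /cvgrPdist_le := ywithin _ (lexx t1) => /(_ e e0).
  near=> x; have [xt1|t1x] := ltP x t1.
    by rewrite wl//; move: xt1; near: x.
  by rewrite wr//; move: t1x; near: x.
have cw t : 0 < t -> (t%:E < tau2)%E -> w x @[x --> t] --> w t.
  move=> t0 tt2; have [tt1|tt1|->//] := ltgtP t t1.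
    rewrite wl//; have := solution_continuous solz (htz _ (ltW t0) tt1) t0.
    by apply: cvg_trans; apply: near_eq_cvg; exact: nwz.
  rewrite wr ?(ltW tt1)//.
  have yt : y x @[x --> t] --> y t.
    have := ywithin _ (ltW tt1); rewrite within_interior//.
    by near=> x; apply: ltW; near: x; exact: lt_nbhsr.
  by apply: cvg_trans yt; apply: near_eq_cvg; exact: nwy.
have dw t : t != t1 -> 0 < t -> (t%:E < tau2)%E -> ~ Z (w t) ->
    is_derive t (1 : R) w (vf (w t) t).
  move=> tn t0 tt2; have [tt1|tt1|/eqP] := ltgtP t t1; last by rewrite (negbTE tn).
    rewrite wl// => nZ; apply: (@near_eq_is_derive R R _ z); first exact: nwz.
    by apply: zder => //; exact: htz (ltW t0) tt1.
  rewrite wr ?(ltW tt1)// => nZ; apply: (@near_eq_is_derive R R _ y); first exact: nwy.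
  exact: yder.
split.
- apply: within_continuousP => t [+ tt2]; rewrite le_eqVlt => /predU1P[t0|t0].
    subst t; rewrite -/(w 0) wl//; apply/cvgrPdist_le => e e0.
    have : nbhs (0 : R) [set x | times t1%:E x -> `|z 0 - z x| <= e].
      by have /cvgrPdist_le := solution_within solz (htz _ (lexx 0) t10) => /(_ e e0).
    move=> nz; have : nbhs (0 : R) [set x | times tau2 x -> `|z 0 - w x| <= e].
      near=> x => -[x0 _].
      have xt1 : x < t1 by near: x; exact: lt_nbhsl.
      by rewrite wl//; have := htz _ x0 xt1; near: x.
    exact.
  by apply: cvg_within_filter; exact: cw.
- move=> t [t0 tt2]; rewrite -/(w t); have [tt1|tt1] := ltP t t1.
    by rewrite wl//; apply: znd; exact: htz.
  by rewrite wr//; exact: ynd.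
- move=> t [_ tt2] t0; rewrite -/(w t) -/w => nZ.
  have [tt1|] := eqVneq t t1; last by move=> tn; exact: dw.
  (* At the junction neither piece is known to be differentiable from both sides, but the field
     along [w] is continuous there, so each coordinate of [w] has it as derivative. *)
  subst t; apply/(is_derive_rV w) => i.
  have c1 := cw _ t0 tt2.
  apply: (@is_derive_punctured _ _ (fun s => vf (w s) s ord0 i)).
  + exact: cvg_rV_coord.
  + have nV : \forall s \near t1, 0 < V (w s).
      by apply: (cvgr_gt _ (cvg_continuous_comp c1 V_cont)); exact: Vfun_gt0.
    near=> s.
    have st1 : s != t1 by near: s; exact: nbhs_dnbhs_neq.
    have s0 : 0 < s by near: s; apply: nbhs_dnbhs; exact: lt_nbhsr.
    have st2 : (s%:E < tau2)%E by near: s; apply: nbhs_dnbhs; exact: near_lt_ereal.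
    have Vs : 0 < V (w s) by near: s; exact: nbhs_dnbhs.
    apply: (is_derive_rV w s _).1; apply: dw => //.
    by move=> /(Vfun_eq0 P eps) V0; move: Vs; rewrite V0 ltxx.
  + apply: cvg_rV_coord; apply: cvg_within_filter.
    apply: cvg_vfield => //; first exact: lt_le_trans tau2h.
    by rewrite wr//; apply: ynd => //; rewrite -wr.
- move=> s t [t0 tt2] /andP[s0 st]; rewrite -/(w s) -/(w t).
  have [tt1|tt1] := ltP t t1.
    rewrite !wl//; last exact: le_lt_trans tt1.
    by move=> Zs; apply: zrest; [exact: htz|rewrite s0|].
  have [st1|st1] := ltP s t1; last by rewrite !wr// => Zs; exact: yrest.
  rewrite wl// wr// => Zs.
  (* If [z] was already at rest at [s], its left limit [y t1] is [z s], a point of [Sset]; hence [y]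
     rests as well. *)
  have zs : z x @[x --> t1^'-] --> z s.
    apply: cvg_near_cst; near=> x; apply: zrest => //.
      apply: htz; last by near: x; exact: nbhs_left_lt.
      by apply: le_trans s0 _; near: x; exact: nbhs_left_ge.
    by rewrite s0/=; near: x; exact: nbhs_left_ge.
  have E : y t1 = z s by exact: (cvg_unique _ zy zs).
  by rewrite (yrest t1 t)// E.
Unshelve. all: by end_near. Qed.

Lemma extend_solution (t1 : R) (z : R -> state) (zl : state) :
  0 < t1 -> (t1%:E < horizon l)%E -> sol t1%:E z ->
  z t @[t --> t1^'-] --> zl -> (Z zl \/ desc zl != 0) ->
  exists (tau' : \bar R) (z' : R -> state),
    [/\ (t1%:E < tau' <= horizon l)%E, sol tau' z' & forall t, t < t1 -> z' t = z t].
Proof.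
move=> t10 t1h solz zzl Zd.
have [Zl|nZl] := pselect (Z zl).
  exists (horizon l), (fun t => if t < t1 then z t else zl); split.
  - by rewrite t1h lexx.
  - apply: (@glue_solution t1 0 (horizon l) z (fun=> zl)) => //.
    by move=> s t _ st; rewrite subrr normr0 mul0r.
  - by move=> t ->.
have dl : desc zl != 0 by case: Zd.
have [h [y [M [[h0 hh] y1 ylip ynd yder]]]] := local_solution t1h nZl dl.
exists (t1 + h)%:E, (fun t => if t < t1 then z t else y t); split.
- by rewrite lte_fin ltrDl h0 hh.
- apply: (@glue_solution t1 M (t1 + h)%:E z y t10 _ hh solz _ ylip).
  + by rewrite lte_fin ltrDl.
  + by rewrite y1.
  + by move=> t tt1; rewrite lte_fin => tth _; have [] := ynd _ tt1 tth.
  + move=> t tt1; rewrite lte_fin => tth _; exact: yder tt1 tth.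
  + move=> s t t1s st; rewrite lte_fin => tth Zs.
    by have [] := ynd _ t1s (le_lt_trans st tth).
- by move=> t ->.
Qed.

(** All conditions on a solution are local, except resting, which looks back in time. As each piece
    starts at time 0, it contains the earlier time too. This makes the union of a chain of solutions
    a solution. *)
Lemma local_pieces_solution (tau : \bar R) (z : R -> state) :
  (forall t, times tau t -> exists (tau1 : \bar R) (z1 : R -> state),
    [/\ (tau1 <= tau)%E, sol tau1 z1, times tau1 t &
        forall x, times tau1 x -> z x = z1 x]) -> sol tau z.
Proof.
move=> H; split.
- apply: within_continuousP => t /H[tau1 [z1 [t1t sol1 ht1 zE]]].
  rewrite zE//; apply/cvgrPdist_le => e e0.
  have nz : nbhs t [set x | times tau1 x -> `|z1 t - z1 x| <= e].
    by have /cvgrPdist_le := solution_within sol1 ht1 => /(_ e e0).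
  have : nbhs t [set x | times tau x -> `|z1 t - z x| <= e].
    near=> x => -[x0 _].
    have hx : times tau1 x.
      by split => //; near: x; apply: near_lt_ereal; case: ht1.
    by rewrite zE//; move: hx; near: x.
  exact.
- move=> t /H[tau1 [z1 [_ [_ nd _ _] ht1 zE]]]; rewrite zE//; exact: nd.
- move=> t /H[tau1 [z1 [_ [_ _ der _] ht1 zE]]] t0; rewrite zE// => nZ.
  apply: (@near_eq_is_derive R R _ z1); last exact: der.
  have nt := near_times ht1 t0.
  by near=> x; rewrite zE//; near: x.
- move=> s t /H[tau1 [z1 [_ [_ _ _ rest] ht1 zE]]] /andP[s0 st].
  have hs : times tau1 s.
    by split => //; have [_] := ht1; apply: le_lt_trans; rewrite lee_fin.
  by rewrite !zE// => Zs; apply: rest => //; rewrite s0.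
Unshelve. all: by end_near. Qed.

Lemma maximal_solution_exists (z0 : state) : (Z z0 \/ desc z0 != 0) ->
  exists tau z, maximal_solution P eps l tau z /\ z 0 = z0.
Proof.
move=> Zd; have h0 := horizon_gt0 l_adm.
have [tau0 [y0 [tau00 soly y00]]] : exists (tau0 : \bar R) (y0 : R -> state),
    [/\ (0 < tau0 <= horizon l)%E, sol tau0 y0 & y0 0 = z0].
  have [Z0|nZ0] := pselect (Z z0).
    exists (horizon l), (fun=> z0); split => //; first by rewrite h0 lexx.
    split => //.
    by apply: within_continuousP => t _; exact: cvg_cst.
  have d0 : desc z0 != 0 by case: Zd.
  have [h [y [M [[hp hh] y1 ylip ynd yder]]]] := local_solution h0 nZ0 d0.
  rewrite add0r in hh; exists h%:E, y; split; [by rewrite lte_fin hp| |exact: y1].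
  apply: (start_solution hp ylip) => t t0 th.
    by apply: (ynd t t0); rewrite add0r.
  by apply: (yder t t0); rewrite add0r.
pose good (c : \bar R * (R -> state)) :=
  [/\ (0 < c.1 <= horizon l)%E, sol c.1 c.2 & c.2 0 = z0].
pose T := {c | good c}.
(* Only a preorder: two functions that agree on [times] of the same end time may differ
   elsewhere. *)
pose rel (a b : T) : bool := `[< ((sval a).1 <= (sval b).1)%E /\
  forall t, times (sval a).1 t -> (sval b).2 t = (sval a).2 t >].
have relxx (a : T) : rel a a by apply/asboolP; split.
have times_le (a b : \bar R) t : (a <= b)%E -> times a t -> times b t.
  by move=> ab [t0 ta]; split => //; exact: lt_le_trans ab.
have reltr (a b c : T) : rel a b -> rel b c -> rel a c.
  move=> /asboolP[ab1 ab2] /asboolP[bc1 bc2]; apply/asboolP; split.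
    exact: le_trans bc1.
  by move=> t ta; rewrite bc2 ?ab2//; exact: times_le ta.
have start : T by exists (tau0, y0); split.
have [|m mmax] := ZL_preorder start relxx reltr.
  move=> A Atot.
  have [A0|/set0P[a0 Aa0]] := eqVneq A set0.
    by exists start => s; rewrite A0.
  pose taus := ereal_sup [set (sval a).1 | a in A].
  have inA t : times taus t -> exists a, A a /\ times (sval a).1 t.
    move=> [t0 ts]; have [_ [a Aa <-] ta] := ereal_sup_gt ts.
    by exists a; split.
  (* At each time some member of the chain living then is chosen; totality of the chain makes the
     value independent of the choice. *)
  pose zs t := if pselect (exists a, A a /\ times (sval a).1 t) is left e
    then (sval (projT1 (cid e))).2 t else 0.
  have zsE a t : A a -> times (sval a).1 t -> zs t = (sval a).2 t.
    move=> Aa ta; rewrite /zs; case: pselect => [e|]; last by case; exists a.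
    case: cid => b [Ab tb] /=.
    have [/asboolP[_ ab]|/asboolP[_ ba]] := Atot _ _ Aa Ab; first exact: ab.
    by rewrite ba.
  have le_taus a : A a -> ((sval a).1 <= taus)%E.
    by move=> Aa; apply: ereal_sup_ubound; exists a.
  have gs : good (taus, zs).
    split => /=.
    - apply/andP; split.
        apply: lt_le_trans (le_taus _ Aa0).
        by case: (svalP a0) => /andP[].
      apply: ge_ereal_sup => _ [a Aa <-].
      by case: (svalP a) => /andP[].
    - apply: local_pieces_solution => t /inA[a [Aa ta]].
      exists (sval a).1, (sval a).2; split => //; first exact: le_taus.
        by case: (svalP a).
      by move=> x; exact: zsE.
    - rewrite (zsE a0)//; first by case: (svalP a0).
      by split => //; case: (svalP a0) => /andP[].
  exists (exist _ _ gs) => a Aa; apply/asboolP; split => /=; first exact: le_taus.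
  by move=> t; exact: zsE.
case: m mmax => -[tau z] /= g mmax; case: (g) => /= taub solz z00.
exists tau, z; split => //; split => //.
move=> tau' z' /andP[tt' t'h] solz' zE.
have g' : good (tau', z').
  split => //=.
    by rewrite t'h andbT; case/andP: taub => /lt_trans + _; apply.
  rewrite zE ?z00// inE; split => //=; by case/andP: taub.
have /asboolP[/= tt _] : rel (exist _ _ g') (exist _ _ g).
  apply: mmax; apply/asboolP; split => /=; first exact: ltW.
  by move=> t ht; apply: zE; rewrite inE.
by move: tt'; rewrite ltNge tt.
Qed.

Lemma sublevel_forward_invariant (U : set state) (c cL alpha r : R) :
  (forall z, V z <= c -> U z) -> (forall z, V z <= c -> `|z| <= r) ->
  (forall z, U z -> V z != 0 -> grad V z != 0) ->
  0 < cL -> 0 <= alpha < 1 ->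
  (forall z, V z <= c -> cL * V z `^ alpha <= enorm (grad V z)) ->
  forward_invariant P eps l (Omega P eps U c).
Proof.
move=> VU Vr regU cL0 al loj tau z [/andP[tau0 tauh] solz zmax] [_ Vz0].
have Vc t : times tau t -> V (z t) <= c.
  move=> ht; apply: le_trans Vz0;
    apply: (solution_V_nonincreasing _ _ _ _ _ tauh solz) => //.
  by case: ht.
split; last by move=> t ht; split; [apply: VU|]; exact: Vc.
apply/eqP; apply: contrapT => /negP tau_neq.
have {tau_neq} tau_lt : (tau < horizon l)%E by rewrite lt_neqAle tau_neq.
case: tau tau0 tauh solz zmax Vc tau_lt => [t1||]; last 2 first.
- by move=> _ _ _ _ _; rewrite ltNge leey.
- by rewrite ltNge leNye.
rewrite lte_fin => t10 t1h solz zmax Vc t1lt.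
have [zl zzl] : exists zl : state, z t @[t --> t1^'-] --> zl.
  apply: (solution_limit _ _ _ _ _ t10 t1h solz cL0 al) => // t ht.
    by apply: loj; exact: Vc.
  by apply: Vr; exact: Vc.
have Vzl : V zl <= c.
  have cV := cvg_continuous_comp zzl V_cont.
  rewrite -(cvg_lim (@Rhausdorff R) cV); apply: limr_le; first by apply/cvg_ex;
    exists (V zl).
  near=> t; apply: Vc; split; last by rewrite lte_fin; near: t; exact: nbhs_left_lt.
  by near: t; exact: nbhs_left_ge.
(* The limit stays in the sublevel set, hence in [U], where regularity makes the field defined at
   [zl] unless [zl] lies in [Sset]; in both cases the solution extends, against maximality. *)
have Zd : Z zl \/ desc zl != 0.
  have [Zl|nZl] := pselect (Z zl); [by left|right].
  by rewrite -gradV; apply: regU; [exact: VU|rewrite gt_eqF// Vfun_gt0].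
have [tau' [z' [tau'b solz' zE]]] := extend_solution t10 t1lt solz zzl Zd.
apply: (zmax _ _ tau'b solz') => t; rewrite inE => -[_]; rewrite lte_fin; exact: zE.
Unshelve. all: by end_near. Qed.

End flow.

(** * Convergence and cluster points of trajectories *)

Section convergence.
Context {R : realType} {nx ny p q : nat}.
Variables (P : minimax_problem R nx ny p q) (eps : R).
Hypothesis eps_gt0 : 0 < eps.
Hypothesis G_smooth : twice_differentiable (ineq P).
Hypothesis J_C2 : C2 (obj P).
Hypothesis V_C1 : C1 (Vfun P eps).
Variable l : @decay_law R.
Hypothesis l_adm : admissible l.

Local Notation state := 'rV[R]_((nx + ny) + (p + q)).
Local Notation V := (Vfun P eps).

Global Instance to_horizon_proper : ProperFilter (to_horizon l).
Proof. by case: l => /= *; exact: _. Qed.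

Lemma near_to_horizon : \forall t \near to_horizon l, times (horizon l) t.
Proof.
have ge0_pinfty : \forall t \near +oo, times (R := R) +oo t.
  near=> t; split; last exact: ltry.
  by near: t; exact: nbhs_pinfty_ge.
move: l_adm; case: l => [c0|k g|a b g d|mu T] //= [_ T0].
near=> t; split.
  by near: t; exact: nbhs_left_ge.
by rewrite lte_fin; near: t; exact: nbhs_left_lt.
Unshelve. all: by end_near. Qed.

(** No end time beyond the horizon is allowed, so a trajectory cannot be extended. Thus
    [forward_invariant], which speaks of maximal solutions, applies to trajectories. *)
Lemma maximal_trajectory (z : R -> state) :
  trajectory P eps l z -> maximal_solution P eps l (horizon l) z.
Proof.
move=> trz; split; [|exact: trz|].
  by rewrite (horizon_gt0 l_adm) lexx.
by move=> tau' z' /andP[/lt_le_trans h /h]; rewrite ltxx.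
Qed.

Section trajectory.
Variable z : R -> state.
Hypothesis trz : trajectory P eps l z.

Lemma trajectory_V_timing : decay_timing l (fun t => V (z t)).
Proof.
apply: (decay_timing_holds l_adm (v := fun t => V (z t))).
- by move=> t; exact: Vfun_ge0.
- exact: (solution_V_within V_C1 trz).
- exact: (solution_V_derive eps_gt0 G_smooth J_C2 V_C1 l_adm (lexx _) trz).
Qed.

Lemma trajectory_V_cvg0 : V (z t) @[t --> to_horizon l] --> 0.
Proof.
apply: (decay_cvg0 l_adm (v := fun t => V (z t))).
- by move=> t; exact: Vfun_ge0.
- exact: (solution_V_within V_C1 trz).
- exact: (solution_V_derive eps_gt0 G_smooth J_C2 V_C1 l_adm (lexx _) trz).
Qed.

Lemma trajectory_Svec_cvg0 : Svec P eps (z t) @[t --> to_horizon l] --> (0 : state).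
Proof.
apply: cvg_rV => i; rewrite mxE; apply/cvgrPdist_le => e e0.
have V_small : \forall t \near to_horizon l, V (z t) <= e ^+ 2 / 2.
  apply: (cvgr_le _ trajectory_V_cvg0).
  by rewrite divr_gt0// exprn_gt0.
apply: filterS V_small => t Vt.
rewrite sub0r normrN; apply: le_trans (coord_Svec_le _ _ _ _) _.
rewrite -[leRHS](ger0_norm (ltW e0)) -sqrtr_sqr ler_wsqrtr//.
by rewrite mulrC -ler_pdivlMr.
Qed.

Lemma trajectory_eventually_sublevel (c : R) : 0 < c ->
  \forall t \near to_horizon l, V (z t) <= c.
Proof. by move=> c0; apply: (cvgr_le _ trajectory_V_cvg0). Qed.

(** The level [c] may lie far below the initial value of [V]: the trajectory enters that sublevel
    set at some time [T1] and stays there by monotonicity, while the arc before [T1] is the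
    continuous image of a segment. *)
Lemma trajectory_compact_range (c : R) : 0 < c -> compact [set x | V x <= c] ->
  exists T1 : R, times (horizon l) T1 /\
    compact (z @` `[0, T1] `|` [set x | V x <= c]) /\
    forall t, times (horizon l) t ->
      (z @` `[0, T1] `|` [set x | V x <= c]) (z t).
Proof.
move=> c0 Kc.
have [T1 [hT1 VT1]] : exists T1, times (horizon l) T1 /\ V (z T1) <= c.
  apply: (@filter_ex _ (to_horizon l)).
  exact: filterI near_to_horizon (trajectory_eventually_sublevel c0).
exists T1; split => //; split.
  apply: compactU => //; apply: continuous_compact; last exact: segment_compact.
  have [cz _ _ _] := trz; apply: continuous_subspaceW cz => t /=.
  rewrite in_itv/= => /andP[t0 tT]; split => //.
  by have [_] := hT1; apply: le_lt_trans; rewrite lee_fin.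
move=> t ht; have [t0 _] := ht; have [tT|Tt] := leP t T1.
  by left; exists t => //=; rewrite in_itv/= t0.
right => /=; apply: le_trans VT1.
have [T0 _] := hT1.
exact: (solution_V_nonincreasing eps_gt0 G_smooth J_C2 V_C1 l_adm (lexx _) trz T0 (ltW Tt) ht).
Qed.

Lemma trajectory_cluster_exists (c : R) : 0 < c -> compact [set x | V x <= c] ->
  exists zc, cluster (z t @[t --> to_horizon l]) zc.
Proof.
move=> c0 Kc.
have [|zc [_ ?]] := Kc (z t @[t --> to_horizon l]) _; last by exists zc.
exact: (trajectory_eventually_sublevel c0).
Qed.

Lemma trajectory_cluster_Sset zc :
  cluster (z t @[t --> to_horizon l]) zc -> Sset P eps zc.
Proof.
move=> zcP; apply/Vfun_eq0/eqP; rewrite eq_le Vfun_ge0 andbT.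
apply/ler_addgt0Pr => e e0; rewrite add0r.
have cV : continuous V by have [dV _] := V_C1; move=> x; exact: differentiable_continuous.
suff : [set x | V x <= e] zc by [].
rewrite (closure_id [set x | V x <= e]).1; last exact: closed_sublevel.
move: zcP; rewrite clusterE; apply.
exact: (trajectory_eventually_sublevel e0).
Qed.

End trajectory.

(** Regularity at [z0] lets a maximal solution start, and forward invariance, as it includes
    existence up to the horizon, turns it into a trajectory. *)
Lemma trajectory_exists (U : set state) (c : R) (z0 : state) :
  (forall x, U x -> V x != 0 -> grad V x != 0) ->
  forward_invariant P eps l (Omega P eps U c) -> Omega P eps U c z0 ->
  exists2 z, trajectory P eps l z & z 0 = z0.
Proof.
move=> regU inv Oz0.
have Zd : Sset P eps z0 \/ descent P eps z0 != 0.
  have [Z0|nZ0] := pselect (Sset P eps z0); [by left|right].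
  rewrite -grad_Vfun//; apply: regU; first by case: Oz0.
  by rewrite gt_eqF// Vfun_gt0.
have [tau [z [maxz z00]]] := maximal_solution_exists eps_gt0 G_smooth J_C2 V_C1 l_adm Zd.
have [tauE _] : tau = horizon l /\ forall t, times tau t -> Omega P eps U c (z t).
  by apply: inv maxz _; rewrite z00.
by exists z => //; rewrite /trajectory -tauE; case: maxz.
Qed.

End convergence.

Theorem theoremV1 (R : realType) (nx ny p q : nat)
    (P : minimax_problem R nx ny p q) (eps : R)
    (full_rank : \rank (row_mx (eqA P) (eqB P)) = q)
    (G_convex : forall i, convex_fun (fun w => ineq P w ord0 i))
    (G_smooth : twice_differentiable (ineq P))
    (J_C2 : C2 (obj P))
    (J_convex_x : forall y, convex_fun (fun x => obj P (row_mx x y)))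
    (J_concave_y : forall x, concave_fun (fun y => obj P (row_mx x y)))
    (feasible_compact : compact (feasible P))
    (eps_gt0 : 0 < eps)
    (slater_P : slater P) :
  (exists ws, saddle_point P ws) /\
  forall (zs : 'rV[R]_((nx + ny) + (p + q)))
         (U : set 'rV[R]_((nx + ny) + (p + q))) (l : decay_law),
    saddle_point P (primal zs) -> KKT P zs -> LICQ P (primal zs) -> U zs ->
    OLF_regularity P eps U -> Lojasiewicz P eps U -> admissible l ->
    (exists2 rho : R, threshold P eps l U rho &
       forall c : R, 0 < c <= rho -> compact (Omega P eps U c)) /\
    forall rho c : R, threshold P eps l U rho -> 0 < c <= rho ->
    forall z0, Omega P eps U c z0 ->
      (exists2 z, trajectory P eps l z & z 0 = z0) /\
      forall z, trajectory P eps l z -> z 0 = z0 ->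
        [/\ exists K : set 'rV[R]_((nx + ny) + (p + q)), [/\ compact K, K `<=` Omega P eps U c
                        & forall t, times (horizon l) t -> K (z t)],
            Svec P eps (z t) @[t --> to_horizon l] -->
              (0 : 'rV[R]_((nx + ny) + (p + q))),
            forall t, times (horizon l) t -> 0 < t ->
              is_derive t (1 : R) (fun s : R => Vfun P eps (z s))
                (- sigma l (Vfun P eps (z t)) t),
            decay_timing l (fun t => Vfun P eps (z t))
          & (exists zc, cluster (z t @[t --> to_horizon l]) zc) /\
            forall zc, cluster (z t @[t --> to_horizon l]) zc ->
              Omega P eps U c zc /\ KKT_up_to_smoothing P eps zc].
Proof.
have [J_C1 _ _] := J_C2.
split.
  apply: (saddle_point_exists G_convex J_C1 J_convex_x J_concave_y feasible_compact).
  have [w [ew Gw]] := slater_P.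
  by exists w; split => // i; apply: ltW; exact: Gw.
move=> zs U l _ _ _ _ [[V_C1 _ _] openU SU regU].
move=> [N [cL [alpha [NU nbhsN cL0 alpha01 loj]]]] l_adm.
have V_cont : continuous (Vfun P eps).
  by have [dV _] := V_C1; move=> z; exact: differentiable_continuous.
have [c1 [r [c10 bnd]]] := sublevel_bounded eps_gt0 full_rank G_convex G_smooth J_C1
  feasible_compact slater_P.
have [c2 c20 cpt] := sublevel_compact_small eps_gt0 G_smooth J_C2 full_rank G_convex
  feasible_compact slater_P V_cont.
(* Since [Sset] is contained in [U], the set [N] is a neighbourhood of all of [Sset], as the lemma
   requires. *)
have [c3 c30 subN] : exists2 c0 : R, 0 < c0 & [set z | Vfun P eps z <= c0] `<=` N.
  apply: (sublevel_sub_nbhs eps_gt0 G_smooth J_C2 full_rank G_convex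
    feasible_compact slater_P V_cont).
  by move: nbhsN; rewrite setIidl.
(* Up to this level the sublevel sets of [V] are bounded by [r], compact, and contained in [N].
   Being inside [N], they lie in [U], so [Omega] is the whole sublevel set. *)
pose rho0 := Num.min c1 (Num.min c2 c3).
have rho0_gt0 : 0 < rho0 by rewrite !lt_min c10 c20 c30.
have [rho01 rho02 rho03] : [/\ rho0 <= c1, rho0 <= c2 & rho0 <= c3].
  by split; rewrite !ge_min lexx ?orbT.
have sublevelN c z : c <= rho0 -> Vfun P eps z <= c -> N z.
  move=> cr Vz; apply: subN; exact: le_trans Vz (le_trans cr rho03).
have OmegaE c : c <= rho0 -> Omega P eps U c = [set z | Vfun P eps z <= c].
  move=> cr; apply/seteqP; split => z /=; first by case.
  by move=> Vz; split => //; apply: NU; exact: sublevelN Vz.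
have compactV c : c <= rho0 -> compact [set z | Vfun P eps z <= c].
  by move=> cr; apply: cpt; exact: le_trans rho02.
split.
  exists rho0; last by move=> c /andP[_ cr]; rewrite OmegaE//; exact: compactV.
  split => // c /andP[c0 cr]; split.
    exists [set z | Vfun P eps z <= c]; first exact: closed_sublevel.
    by [].
  apply: (sublevel_forward_invariant eps_gt0 G_smooth J_C2 V_C1 l_adm
    (r := r) _ _ regU cL0 alpha01).
  - by move=> z Vz; apply: NU; exact: sublevelN Vz.
  - by move=> z Vz; apply: bnd; exact: le_trans Vz (le_trans cr rho01).
  - by move=> z Vz; apply: loj; exact: sublevelN Vz.
move=> rho c [_ thr] crho z0 Oz0; have [_ inv] := thr c crho.
split; first exact: (trajectory_exists eps_gt0 G_smooth J_C2 V_C1 l_adm regU inv Oz0).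
move=> z trz z00.
have [_ zO] := inv _ _ (maximal_trajectory l_adm trz) (eq_ind_r _ Oz0 z00).
have c0 : 0 < c by case/andP: crho.
(* The given threshold is arbitrary and [c] may exceed [rho0], so the tail of the trajectory is
   caught in this smaller sublevel set, which is compact and contained in [Omega P eps U c]. *)
pose c' := Num.min c rho0.
have c'0 : 0 < c' by rewrite lt_min c0.
have c'rho : c' <= rho0 by rewrite ge_min lexx orbT.
split.
- have [T1 [hT1 [Kcompact zK]]] := trajectory_compact_range eps_gt0 G_smooth J_C2 V_C1
    l_adm trz c'0 (compactV _ c'rho).
  exists (z @` `[0, T1] `|` [set x | Vfun P eps x <= c']); split;
    [exact: Kcompact| |exact: zK].
  move=> x [[t /=]|/= Vx].
    rewrite in_itv/= => /andP[t0 tT] <-; apply: zO; split => //.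
    by have [_] := hT1; apply: le_lt_trans; rewrite lee_fin.
  split; first by apply: NU; exact: sublevelN Vx.
  by apply: le_trans Vx _; rewrite ge_min lexx.
- exact: (trajectory_Svec_cvg0 eps_gt0 G_smooth J_C2 V_C1 l_adm trz).
- exact: (solution_V_derive eps_gt0 G_smooth J_C2 V_C1 l_adm (lexx _) trz).
- exact: (trajectory_V_timing eps_gt0 G_smooth J_C2 V_C1 l_adm trz).
- split.
    exact: (trajectory_cluster_exists eps_gt0 G_smooth J_C2 V_C1 l_adm trz c'0
      (compactV _ c'rho)).
  move=> zc /(trajectory_cluster_Sset eps_gt0 G_smooth J_C2 V_C1 l_adm trz) Zzc.
  split; last exact: Zzc.
  split; first exact: SU.
  by move/(Vfun_eq0 P eps) : Zzc => ->; exact: ltW.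
Qed.
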